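(* Let $B_e:\mathbb{T}^3\to\mathbb{R}^3$ be $C^\infty$. Then there exist (explicit) constants $\kappa>0$ and $c>0$ such that for every $f_0\in L^2(dxd\mu)$ with $\iint f_0(x,v)\,dx\,d\mu=0$, the solution $f$ of $$\partial_t f+v\cdot\nabla_x f-(v\wedge B_e)\cdot\nabla_v f=-(-\nabla_v+v)\cdot\nabla_v f,\qquad f(0,x,v)=f_0(x,v),$$ satisfies $$\forall t\ge 0,\qquad \|f(t)\|_{L^2(dxd\mu)}\le c\,e^{-\kappa t}\,\|f_0\|_{L^2(dxd\mu)}.$$
   Context: $\mathbb{T}^3\equiv[0,2\pi]^3$ is the flat torus, $x\in\mathbb{T}^3$, $v\in\mathbb{R}^3$, and $\wedge$ is the cross product in $\mathbb{R}^3$. $\mu(v)=(2\pi)^{-3/2}e^{-|v|^2/2}$, $d\mu=\mu(v)\,dv$, and $L^2(dxd\mu)$ has norm $\|h\|^2=\iint_{\mathbb{T}^3\times\mathbb{R}^3}|h(x,v)|^2\,dx\,d\mu$. Solutions are understood in the semigroup sense: $f(t)=S(t)f_0$, where $S(t)$ is the strongly continuous semigroup on $L^2(dxd\mu)$ generated by $-\overline{P_1}$, $\overline{P_1}$ being the closure in $L^2(dxd\mu)$ of $P_1=v\cdot\nabla_x-(v\wedge B_e)\cdot\nabla_v+(-\nabla_v+v)\cdot\nabla_v$ defined on $C_0^\infty(\mathbb{T}^3\times\mathbb{R}^3)$. *)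

(* Defs.v *)
From HB Require Import structures.
From mathcomp Require Import all_boot all_order all_algebra.
From mathcomp Require Import all_classical all_reals all_analysis.
From mathcomp Require Import measurable_realfun ring lra.
Set Implicit Arguments.
Unset Strict Implicit.
Unset Printing Implicit Defensive.
Import Order.TTheory GRing.Theory Num.Theory.
Import numFieldNormedType.Exports.
Local Open Scope classical_set_scope.
Local Open Scope ring_scope.

(* [measurableTypeR R] is convertible to [R]; it is the carrier on which
   [lebesgue_measure] is declared. *)
Notation R3 R :=
  (measurableTypeR R * measurableTypeR R * measurableTypeR R)%type.

Section vectors.
Context {R : realType}.
Implicit Types u w : R3 R.

Definition coord3 u (i : 'I_3) : R := tnth [tuple u.1.1 : R; u.1.2; u.2] i.

Definition basis3 (i : 'I_3) : R3 R :=
  ((i == 0 :> nat)%:R : R, (i == 1 :> nat)%:R : R, (i == 2 :> nat)%:R : R).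

Definition dot u w : R := \sum_(i < 3) coord3 u i * coord3 w i.

Definition cross u w : R3 R :=
  let: (u1, u2, u3) := u in let: (w1, w2, w3) := w in
  (u2 * w3 - u3 * w2 : R, u3 * w1 - u1 * w3 : R, u1 * w2 - u2 * w1 : R).

End vectors.

(* In finite dimension, C^n is equivalent to the existence of all directional
   derivatives up to order n, together with their continuity. *)
Fixpoint Cn {R : realType} {V W : normedModType R} (n : nat) (f : V -> W) :
    Prop :=
  continuous f /\
  if n is m.+1 then
    forall w : V, (forall x, derivable f x w) /\ Cn m ('D_w f)
  else True.

Definition smooth {R : realType} {V W : normedModType R} (f : V -> W) : Prop :=
  forall n, Cn n f.

(* Functions on the torus are 2 pi-periodic functions on R^3. *)
Definition torus_periodic {R : realType} {T : Type} (f : R3 R -> T) : Prop :=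
  forall (x : R3 R) i, f (x + (2 * pi) *: basis3 i) = f x.

(* The library's sigma-finiteness instance for [\x] is shadowed by a later
   instance for subprobabilities, hence this restatement. *)
Lemma sigma_finite_prod d1 d2 (T1 : measurableType d1) (T2 : measurableType d2)
    (R : realType) (m1 : {sigma_finite_measure set T1 -> \bar R})
    (m2 : {sigma_finite_measure set T2 -> \bar R}) :
  sigma_finite [set: T1 * T2] (m1 \x m2)%E.
Proof.
have /sigma_finiteP[F [TF ndF Foo]] := sigma_finiteT m1.
have /sigma_finiteP[G [TG ndG Goo]] := sigma_finiteT m2.
exists (fun n => F n `*` G n).
  rewrite -setXTT TF TG predeqE => -[x y]; split.
    move=> [/= [n _ Fnx] [k _ Gky]]; exists (maxn n k) => //; split.
    - by move: x Fnx; exact/subsetPset/ndF/leq_maxl.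
    - by move: y Gky; exact/subsetPset/ndG/leq_maxr.
  by move=> [n _ []/= ? ?]; split; exists n.
move=> k; have [? ?] := Foo k; have [? ?] := Goo k.
split; first exact: measurableX.
by rewrite product_measure1E// lte_mul_pinfty// ge0_fin_numE.
Qed.

Section phase_measure.
Context {R : realType}.

Definition lebesgue2 : set (measurableTypeR R * measurableTypeR R)%type -> \bar R :=
  (@lebesgue_measure R \x @lebesgue_measure R)%E.

HB.instance Definition _ := Measure.on lebesgue2.
HB.instance Definition _ := @Measure_isSigmaFinite.Build _ _ _ lebesgue2
  (sigma_finite_prod _ _).

Definition lebesgue3 : set (R3 R) -> \bar R :=
  (lebesgue2 \x @lebesgue_measure R)%E.

HB.instance Definition _ := Measure.on lebesgue3.
HB.instance Definition _ := @Measure_isSigmaFinite.Build _ _ _ lebesgue3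
  (sigma_finite_prod _ _).

Definition torus_cell : set (R3 R) :=
  (`[0, 2 * pi] `*` `[0, 2 * pi]) `*` `[0, 2 * pi].

Lemma measurable_torus_cell : measurable torus_cell.
Proof. by apply: measurableX => //; exact: measurableX. Qed.

Definition torus_measure : set (R3 R) -> \bar R :=
  mrestr lebesgue3 measurable_torus_cell.

HB.instance Definition _ := Measure.on torus_measure.

Definition maxwellian (v : R3 R) : R :=
  (2 * pi) `^ (- (3 / 2)) * expR (- dot v v / 2).

Definition gaussian (A : set (R3 R)) : \bar R :=
  (\int[lebesgue3]_(v in A) (maxwellian v)%:E)%E.

Lemma maxwellian_ge0 v : 0 <= maxwellian v.
Proof. by rewrite mulr_ge0 ?powR_ge0 ?expR_ge0. Qed.

Lemma maxwellianE v : maxwellian v =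
  normal_pdf 0 1 (v.1.1 : R) * normal_pdf 0 1 (v.1.2 : R) *
  normal_pdf 0 1 (v.2 : R).
Proof.
rewrite normal_pdfE ?oner_neq0//= /normal_peak /normal_fun /maxwellian.
rewrite !subr0 expr1n mul1r.
set p := Num.sqrt _.
have -> : (2 * pi) `^ (- (3 / 2)) = p^-1 * p^-1 * p^-1 :> R.
  rewrite powRN -!invfM; congr (_^-1).
  have -> : p = (2 * pi) `^ 2^-1.
    by rewrite powR12_sqrt ?mulr_ge0 ?pi_ge0// mulr_natl.
  have pi2 : (0 : R) < 2 * pi by rewrite mulr_gt0 ?pi_gt0.
  rewrite -!powRD ?(gt_eqF pi2) ?implybT//.
  by congr (_ `^ _); lra.
have -> : dot v v = v.1.1 ^+ 2 + v.1.2 ^+ 2 + v.2 ^+ 2 :> R.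
  rewrite /dot !big_ord_recl big_ord0 addr0 /coord3 !(tnth_nth 0)/= -!expr2.
  by rewrite addrA.
rewrite !opprD !mulrDl !expRD.
by rewrite [in LHS](mulrCA _ _ _); ring.
Qed.

Lemma measurable_maxwellian : measurable_fun setT maxwellian.
Proof.
rewrite (_ : maxwellian = fun v => normal_pdf 0 1 (v.1.1 : R) *
  normal_pdf 0 1 (v.1.2 : R) * normal_pdf 0 1 (v.2 : R)); last first.
  by apply/funext => v; rewrite maxwellianE.
have m1 : measurable_fun setT (fun v : R3 R => v.1.1) by exact: measurableT_comp.
have m2 : measurable_fun setT (fun v : R3 R => v.1.2) by exact: measurableT_comp.
by apply: measurable_funM; [apply: measurable_funM|];
  apply: measurableT_comp => //; exact: measurable_normal_pdf.
Qed.

Let gaussian0 : gaussian set0 = 0%E.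
Proof. by rewrite /gaussian integral_set0. Qed.

Let gaussian_ge0 A : (0 <= gaussian A)%E.
Proof. by apply: integral_ge0 => v _; rewrite lee_fin maxwellian_ge0. Qed.

Let gaussian_sigma_additive : semi_sigma_additive gaussian.
Proof.
move=> /= A mA tA mUA; rewrite /gaussian/= ge0_integral_bigcup//=.
- apply: is_cvg_ereal_nneg_natsum_cond => n _ _.
  by apply: integral_ge0 => v _; rewrite lee_fin maxwellian_ge0.
- apply: measurable_funTS; apply/measurable_EFinP.
  exact: measurable_maxwellian.
- by move=> v _; rewrite lee_fin maxwellian_ge0.
Qed.

HB.instance Definition _ := isMeasure.Build _ _ _ gaussian
  gaussian0 gaussian_ge0 gaussian_sigma_additive.

Let gaussianT : gaussian setT = 1%E.
Proof.
pose g (x : measurableTypeR R) : \bar R := (normal_pdf 0 1 (x : R))%:E.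
have g0 x : (0 <= g x)%E by rewrite lee_fin normal_pdf_ge0.
have mg : measurable_fun setT g.
  by apply/measurable_EFinP; exact: measurable_normal_pdf.
have ig : (\int[lebesgue_measure]_x g x = 1)%E by exact: integral_normal_pdf.
have m11 : measurable_fun setT (fun v : R3 R => v.1.1) by exact: measurableT_comp.
have m12 : measurable_fun setT (fun v : R3 R => v.1.2) by exact: measurableT_comp.
rewrite /gaussian.
under eq_integral do rewrite maxwellianE !EFinM.
rewrite /lebesgue3 fubini_tonelli1/=; last first.
- by move=> v; rewrite !mule_ge0 ?g0//; exact: g0.
- apply: emeasurable_funM; [apply: emeasurable_funM|].
  + by apply: (measurableT_comp mg m11).
  + by apply: (measurableT_comp mg m12).
  + by apply: (measurableT_comp mg measurable_snd).
rewrite /fubini_F/=.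
under eq_integral => x _.
  rewrite ge0_integralZl//; [|by move=> ? _; exact: g0|].
    rewrite ig mule1; over.
  by rewrite mule_ge0//; exact: g0.
rewrite /lebesgue2 fubini_tonelli1/=; last first.
- by move=> v; rewrite mule_ge0//; exact: g0.
- apply: emeasurable_funM.
  + by apply: (measurableT_comp mg measurable_fst).
  + by apply: (measurableT_comp mg measurable_snd).
rewrite /fubini_F/=.
under eq_integral => x _.
  rewrite ge0_integralZl//; [|by move=> ? _; exact: g0|exact: g0].
  rewrite ig mule1; over.
exact: ig.
Qed.

HB.instance Definition _ :=
  @Measure_isProbability.Build _ _ R gaussian gaussianT.

Definition phase_measure : set (R3 R * R3 R)%type -> \bar R :=
  (torus_measure \x gaussian)%E.

HB.instance Definition _ := Measure.on phase_measure.

End phase_measure.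

Section L2_space.
Context {R : realType}.

Lemma le1_2 : (1 <= (2 : R)%:E)%E.
Proof. by rewrite lee_fin ler1n. Qed.

(* Elements are square-integrable functions, not classes: equality in
   L^2(dx dmu) is equality almost everywhere. *)
Definition L2 := LfunType (@phase_measure R) le1_2.

Definition L2norm (f : R3 R * R3 R -> R) : \bar R :=
  'N[@phase_measure R]_(2%:E)[EFin \o f]%E.

Definition L2_cvg {I : Type} (F : set_system I) (u : I -> L2) (l : L2) : Prop :=
  L2norm (u i - l) @[i --> F] --> 0%E.

Definition C0_semigroup (S : R -> L2 -> L2) : Prop :=
  [/\ forall (t a : R) (f g : L2), 0 <= t ->
        S t (a *: f + g) = a *: S t f + S t g %[ae @phase_measure R],
      forall t : R, 0 <= t ->
        exists M : R, forall f : L2, (L2norm (S t f) <= M%:E * L2norm f)%E,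
      forall f : L2, S 0 f = f %[ae @phase_measure R],
      forall (s t : R) (f : L2), 0 <= s -> 0 <= t ->
        S (s + t) f = S s (S t f) %[ae @phase_measure R]
    & forall f : L2, L2_cvg 0^'+ (S ^~ f) f].

(* Unbounded operators on L^2 are represented by their graphs. *)
Definition semigroup_generator (S : R -> L2 -> L2) (f g : L2) : Prop :=
  L2_cvg 0^'+ (fun h => h^-1 *: (S h f - f)) g.

Definition op_closure (A : L2 -> L2 -> Prop) (f g : L2) : Prop :=
  exists u v : nat -> L2,
    [/\ forall n, A (u n) (v n), L2_cvg \oo u f & L2_cvg \oo v g].

Definition op_opp (A : L2 -> L2 -> Prop) (f g : L2) : Prop := A f (- g).

End L2_space.
Arguments L2 : clear implicits.

Section fokker_planck.
Context {R : realType}.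
Implicit Types h : R3 R * R3 R -> R.

(* C_0^oo(T^3 x R^3): since the torus is compact, compact support amounts to
   bounded support in v. *)
Definition test_function h : Prop :=
  [/\ smooth h,
      forall v, torus_periodic (fun x => h (x, v))
    & exists r : R, forall x v : R3 R, r < `|v| -> h (x, v) = 0].

Definition dx (i : 'I_3) h : R3 R * R3 R -> R :=
  'D_((basis3 i, 0) : R3 R * R3 R) h.
Definition dv (i : 'I_3) h : R3 R * R3 R -> R :=
  'D_((0, basis3 i) : R3 R * R3 R) h.

Definition P1 (Be : R3 R -> R3 R) h : R3 R * R3 R -> R :=
  fun p => let: (x, v) := p in
    \sum_(i < 3) coord3 v i * dx i h p
    - \sum_(i < 3) coord3 (cross v (Be x)) i * dv i h p
    + \sum_(i < 3) (- dv i (dv i h) p + coord3 v i * dv i h p).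

Definition P1_op (Be : R3 R -> R3 R) (f g : L2 R) : Prop :=
  exists h, [/\ test_function h, f = h %[ae @phase_measure R]
    & g = P1 Be h %[ae @phase_measure R]].

End fokker_planck.

(* Main.v *)
Require Import Defs.
From HB Require Import structures.
From mathcomp Require Import all_boot all_order all_algebra.
From mathcomp Require Import all_classical all_reals all_analysis.
From mathcomp Require Import measurable_realfun ring lra.
Set Implicit Arguments.
Unset Strict Implicit.
Unset Printing Implicit Defensive.
Import Order.TTheory GRing.Theory Num.Theory.
Import numFieldNormedType.Exports.
Local Open Scope classical_set_scope.
Local Open Scope ring_scope.

(** The decay is an instance of $L^2$ hypocoercivity. Write $P$ for the kinetic
operator. For a test function $h$ only the friction contributes to the energy:
$\langle Ph,h\rangle=\sum_i\|\partial_{v_i}h\|^2$ ([kinetic_energy]). This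
dissipation controls the oscillation of $h$ in the velocity, by the Gaussian
Poincare inequality, but not the oscillation of the spatial density. A small
bilinear correction is therefore added to the energy $\frac12\|h\|^2$.

Let $\theta_k=\cos(k\cdot x)+\sin(k\cdot x)$, let $a_k(h)=\langle h,\theta_k\rangle$ be
the modes of the density, and let
$\pi_k(h)=|k|^{-2}\sum_ik_i\langle h,v_i\theta_{-k}\rangle$, with $\pi_0=0$. The
correction is $b(u,w)=\sum_ka_k(u)\pi_k(w)$; Bessel's inequality, for the two
orthogonal families $(\theta_k)_k$ and $(v_i\theta_k)_k$, makes it a bounded form.
Along the flow the density and the current satisfy moment equations
([kinetic_density], [kinetic_current]), obtained by integration by parts, in which
the magnetic field enters only through its supremum, since $v\cdot(v\wedge B_e)=0$.
The stress contains the density itself, and so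
$b(Ph,h)+b(h,Ph)\ge\frac12\sum_ka_k(h)^2-\frac12a_0(h)^2-C\sum_i\|\partial_{v_i}h\|^2$
([mode_estimate], [correction_lower]).

It remains to bound $\|h\|^2$ by $\sum_ka_k(h)^2$ and the dissipation
([macroscopic_bound]). The mean of $K(x-y)(h(x,v)-h(y,w))^2$ over two points of the
phase space, where $K$ is a Fejer kernel, is computed exactly: up to a factor two it
is the difference between the volume times $\|h\|^2$ and a Cesaro mean of the $a_k(h)^2$.
It is also at most a Poincare term for the change of velocity plus a term for the
change of position, which vanishes as the kernel concentrates.

The modified energy is thus equivalent to the square of the norm, and it is
coercive on test functions up to the conserved mass $a_0$. Closing $P$ extends this to
the domain of the generator, the energy estimate along orbits gives exponential
decay there, and the density of the domain gives it everywhere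
([lyapunov_decay]). A semigroup is bounded on compact time intervals by the uniform
boundedness principle, which is proved for semi-definite scalar products, because
the elements of the space are functions and not classes. *)

(** * Semi-definite scalar products *)

(** The square-integrable functions are not identified when they agree almost
everywhere, so that a nonzero vector may have norm zero. *)
Record semi_inner (R : realType) (V : lmodType R) (ip : V -> V -> R) : Prop :=
  SemiInner {
    sipC : forall u w, ip u w = ip w u;
    sipDl : forall u v w, ip (u + v) w = ip u w + ip v w;
    sipZl : forall a u w, ip (a *: u) w = a * ip u w;
    sip_ge0 : forall u, 0 <= ip u u }.

Definition snorm (R : realType) (V : lmodType R) (ip : V -> V -> R) (u : V) :=
  Num.sqrt (ip u u).

Section semi_inner_theory.
Context {R : realType} {V : lmodType R} {ip : V -> V -> R}.
Context (sip : semi_inner ip).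
Local Notation N := (snorm ip).

Lemma sipDr u v w : ip u (v + w) = ip u v + ip u w.
Proof. by rewrite sipC// sipDl// ![ip _ u]sipC. Qed.

Lemma sipZr a u w : ip u (a *: w) = a * ip u w.
Proof. by rewrite sipC// sipZl// [ip _ u]sipC. Qed.

Lemma sipNl u w : ip (- u) w = - ip u w.
Proof. by rewrite -scaleN1r sipZl// mulN1r. Qed.

Lemma sipNr u w : ip u (- w) = - ip u w.
Proof. by rewrite -scaleN1r sipZr mulN1r. Qed.

Lemma sip0l w : ip 0 w = 0.
Proof. by rewrite -(scale0r 0) sipZl// mul0r. Qed.

Lemma sip0r w : ip w 0 = 0.
Proof. by rewrite sipC// sip0l. Qed.

Lemma sip_suml I (r : seq I) (P : pred I) (F : I -> V) w :
  ip (\sum_(i <- r | P i) F i) w = \sum_(i <- r | P i) ip (F i) w.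
Proof.
elim/big_rec2: _ => [|i y u _ <-]; first exact: sip0l.
by rewrite sipDl.
Qed.

Lemma sip_sumr I (r : seq I) (P : pred I) (F : I -> V) w :
  ip w (\sum_(i <- r | P i) F i) = \sum_(i <- r | P i) ip w (F i).
Proof. by rewrite sipC// sip_suml; apply: eq_bigr => i _; rewrite sipC. Qed.

Lemma snorm_ge0 u : 0 <= N u.
Proof. exact: sqrtr_ge0. Qed.

Lemma snorm_sqr u : N u ^+ 2 = ip u u.
Proof. by rewrite sqr_sqrtr// sip_ge0. Qed.

Lemma snorm0 : N 0 = 0.
Proof. by rewrite /snorm sip0l sqrtr0. Qed.

Lemma snormZ a u : N (a *: u) = `|a| * N u.
Proof.
by rewrite /snorm sipZl// sipZr mulrA -expr2 sqrtrM ?sqr_ge0// sqrtr_sqr.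
Qed.

Lemma snormN u : N (- u) = N u.
Proof. by rewrite -scaleN1r snormZ normrN1 mul1r. Qed.

Lemma snormBC u w : N (u - w) = N (w - u).
Proof. by rewrite -opprB snormN. Qed.

Lemma cauchy_schwarz u w : `|ip u w| <= N u * N w.
Proof.
have key a : 0 <= ip u u - 2 * a * ip u w + a ^+ 2 * ip w w.
  have := sip_ge0 sip (u - a *: w).
  rewrite !(sipDl sip, sipDr, sipNl, sipNr, sipZl sip, sipZr) (sipC sip w u).
  by move/le_trans; apply; rewrite le_eqVlt; apply/orP; left; apply/eqP; ring.
have uu := sip_ge0 sip u; have ww := sip_ge0 sip w.
suff : ip u w ^+ 2 <= ip u u * ip w w.
  rewrite -!snorm_sqr -exprMn -real_normK ?num_real//.
  by rewrite ler_pXn2r ?nnegrE// ?mulr_ge0 ?snorm_ge0.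
have [w0|w0] := eqVneq (ip w w) 0; last first.
  have wp : 0 < ip w w by rewrite lt_neqAle eq_sym w0.
  have := key (ip u w / ip w w).
  set z := ip u w / ip w w; have zE : ip u w = z * ip w w by rewrite divfK.
  by rewrite zE; nra.
rewrite w0 mulr0; have [->|x0] := eqVneq (ip u w) 0; first by rewrite expr0n.
have := key ((ip u u + 1) / ip u w); rewrite w0 mulr0 addr0.
rewrite -mulrA divfK//; lra.
Qed.

Lemma snormD u w : N (u + w) <= N u + N w.
Proof.
have := cauchy_schwarz u w; have := snorm_ge0 u; have := snorm_ge0 w.
move=> n1 n2; rewrite ler_norml => /andP[_ h].
rewrite -(@ler_pXn2r _ 2)// ?nnegrE ?addr_ge0 ?snorm_ge0//.
rewrite snorm_sqr sipDl// !sipDr (sipC sip w u) -!snorm_sqr.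
by rewrite sqrrD; lra.
Qed.

Lemma snormB u w : N (u - w) <= N u + N w.
Proof. by rewrite -(snormN w); exact: snormD. Qed.

Lemma snorm_trans v u w : N (u - w) <= N (u - v) + N (v - w).
Proof. by apply: le_trans (snormD _ _); rewrite addrA subrK. Qed.

Lemma snorm_le_dist u w : N u <= N w + N (u - w).
Proof. by apply: le_trans (snormD _ _); rewrite subrKC. Qed.

Lemma snorm_sum I (r : seq I) (P : pred I) (F : I -> V) :
  N (\sum_(i <- r | P i) F i) <= \sum_(i <- r | P i) N (F i).
Proof.
elim/big_rec2: _ => [|i y u _ h]; first by rewrite snorm0.
by rewrite (le_trans (snormD _ _))// lerD2l.
Qed.

Lemma snorm_le u a : 0 <= a -> ip u u <= a ^+ 2 -> N u <= a.
Proof.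
move=> a0 h; rewrite -(@ler_pXn2r _ 2)// ?nnegrE ?snorm_ge0//.
by rewrite snorm_sqr.
Qed.

(** Some of the [e n] may be zero, so they are not normalised: the proof expands the
square of $Ku-\sum_i\langle u,e_i\rangle e_i$. *)
Lemma bessel (e : nat -> V) (K : R) (n : nat) u : 0 < K ->
    (forall i j, i != j -> ip (e i) (e j) = 0) ->
    (forall i, ip (e i) (e i) <= K) ->
  \sum_(i < n) ip u (e i) ^+ 2 <= K * ip u u.
Proof.
move=> K0 orth eK; set s := \sum_(i < n) _.
pose p := \sum_(i < n) ip u (e i) *: e i.
have up : ip u p = s.
  by rewrite /p sip_sumr; apply: eq_bigr => i _; rewrite sipZr expr2.
have pp : ip p p <= K * s.
  rewrite {1}/p sip_suml mulr_sumr; apply: ler_sum => i _.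
  rewrite sipZl// /p sip_sumr (bigD1 i)//= big1 ?addr0; last first.
    by move=> j ji; rewrite sipZr orth ?mulr0// eq_sym.
  rewrite sipZr mulrA -expr2 mulrC ler_wpM2r ?sqr_ge0//.
have := sip_ge0 sip (K *: u - p).
rewrite !(sipDl sip, sipDr, sipNl, sipNr, sipZl sip, sipZr) (sipC sip p u) up => h.
have : 0 <= K * (K * ip u u - s) by lra.
by rewrite pmulr_rge0// subr_ge0.
Qed.

End semi_inner_theory.

Definition cauchy_complete (R : realType) (V : lmodType R) (ip : V -> V -> R) :=
  forall u : nat -> V,
    (forall e, 0 < e -> exists n0, forall n m, (n0 <= n)%N -> (n0 <= m)%N ->
      snorm ip (u n - u m) <= e) ->
  exists l, forall e, 0 < e -> exists n0, forall n, (n0 <= n)%N ->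
      snorm ip (u n - l) <= e.

(** Linearity up to null vectors, which is what can be asked of an operator on
functions that are only identified almost everywhere. *)
Definition ae_linear (R : realType) (V : lmodType R) (ip : V -> V -> R)
    (T : V -> V) :=
  forall a f g, snorm ip (T (a *: f + g) - (a *: T f + T g)) = 0.

Definition op_bound (R : realType) (V : lmodType R) (ip : V -> V -> R)
    (T : V -> V) (M : R) :=
  forall f, snorm ip (T f) <= M * snorm ip f.

Section ae_linear_theory.
Context {R : realType} {V : lmodType R} {ip : V -> V -> R}.
Context (sip : semi_inner ip).
Local Notation N := (snorm ip).
Local Notation snorm_trans := (snorm_trans sip).

Lemma snorm_eq0P u : N u <= 0 -> N u = 0.
Proof. by move=> h; apply/eqP; rewrite eq_le h snorm_ge0. Qed.

Lemma snorm_null_l u v w : N (u - v) = 0 -> N (u - w) = N (v - w).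
Proof.
move=> h; have := snorm_trans v u w; have := snorm_trans u v w.
by rewrite (snormBC sip v u) h; lra.
Qed.

Lemma snorm_null u v : N (u - v) = 0 -> N u = N v.
Proof. by move=> h; have := snorm_null_l 0 h; rewrite !subr0. Qed.

Lemma snorm_null_r u v w : N (u - v) = 0 -> N (w - u) = N (w - v).
Proof. by move=> h; rewrite !(snormBC sip w); exact: snorm_null_l. Qed.

Context (T : V -> V) (M : R) (linT : ae_linear ip T) (bT : op_bound ip T M).

Lemma ae_linearB f g : N (T (f - g) - (T f - T g)) = 0.
Proof. by have := linT (-1) g f; rewrite !scaleN1r ![- _ + _]addrC. Qed.

Lemma ae_linearD f g : N (T (f + g) - (T f + T g)) = 0.
Proof. by have := linT 1 f g; rewrite !scale1r. Qed.

Lemma ae_linear0 : N (T 0) = 0.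
Proof. by apply: snorm_eq0P; have := bT 0; rewrite snorm0// mulr0. Qed.

Lemma ae_linearZ a f : N (T (a *: f) - a *: T f) = 0.
Proof.
apply: snorm_eq0P; have := linT a f 0; rewrite addr0 => h.
apply: (le_trans (snorm_trans (a *: T f + T 0) _ _)).
by rewrite h add0r addrAC subrr add0r ae_linear0.
Qed.

Lemma ae_linear_sum n (F : 'I_n -> V) :
  N (T (\sum_(i < n) F i) - \sum_(i < n) T (F i)) = 0.
Proof.
elim: n F => [|n IH] F; first by rewrite !big_ord0 subr0 ae_linear0.
rewrite !big_ord_recr/=; apply: snorm_eq0P.
set A := \sum_(i < n) _; set B := \sum_(i < n) _.
apply: (le_trans (snorm_trans (T A + T (F ord_max)) _ _)).
rewrite ae_linearD add0r opprD addrACA subrr addr0.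
by rewrite IH.
Qed.

Lemma op_bound_dist f g : N (T f - T g) <= M * N (f - g).
Proof. by rewrite -(snorm_null (ae_linearB f g)); exact: bT. Qed.

End ae_linear_theory.

(** * Uniform boundedness *)

Lemma nat_above (R : realType) (x : R) : exists n : nat, x < n%:R.
Proof.
exists (Num.Def.archi_bound `|x|).
by apply: le_lt_trans (archi_boundP (normr_ge0 x)); exact: ler_norm.
Qed.

Section banach_steinhaus.
Context {R : realType} {V : lmodType R} {ip : V -> V -> R}.
Context (sip : semi_inner ip) (compl : cauchy_complete ip).
Local Notation N := (snorm ip).

(** The operator norm, as a supremum over the unit ball, and a point that attains
two thirds of it. *)
Lemma near_op_norm (T : V -> V) (M0 K : R) (x : V) :
    ae_linear ip T -> op_bound ip T M0 -> 0 <= K -> K * N x < N (T x) ->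
  exists M g, [/\ K <= M, op_bound ip T M, N g <= 1 & 2 / 3 * M <= N (T g)].
Proof.
move=> linT bT K0 Kx.
pose E := [set y | exists2 g, N g <= 1 & y = N (T g)].
have supE : has_sup E.
  split; first by exists (N (T 0)), 0; rewrite ?(snorm0 sip).
  exists `|M0| => _ [g g1 ->]; apply: (le_trans (bT g)).
  apply: (le_trans (ler_norm _)); rewrite normrM.
  by rewrite ler_piMr// ger0_norm ?snorm_ge0.
have bsup : op_bound ip T (sup E).
  move=> f; have [f0|f0] := eqVneq (N f) 0.
    by have := bT f; rewrite f0 !mulr0.
  have fp : 0 < N f by rewrite lt_neqAle eq_sym f0 snorm_ge0.
  rewrite -ler_pdivrMr// mulrC.
  rewrite -[(N f)^-1]ger0_norm ?invr_ge0 ?snorm_ge0// -(snormZ sip).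
  rewrite -(snorm_null sip (ae_linearZ sip linT bT _ _)).
  apply: (ub_le_sup supE.2); exists ((N f)^-1 *: f) => //.
  by rewrite (snormZ sip) ger0_norm ?invr_ge0 ?snorm_ge0// mulVf.
have KE : K < sup E.
  have xp : 0 < N x.
    rewrite lt_neqAle snorm_ge0 andbT eq_sym; apply/eqP => x0.
    by have := bT x; move: Kx; rewrite x0 !mulr0 => /lt_le_trans/[apply]; rewrite ltxx.
  by rewrite -(ltr_pM2r xp); exact: lt_le_trans (bsup x).
have E0 : 0 < sup E / 3 by rewrite divr_gt0//; exact: le_lt_trans KE.
have [_ [g g1 ->] hg] := sup_adherent E0 supE.
exists (sup E), g; split => //; first exact: ltW.
by apply: ltW; apply: le_lt_trans hg; lra.
Qed.

(** The gliding hump argument in the form of A. Sokal: moving a point by $y$ in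
one of the directions $\pm y$ makes $\|Tx\|$ at least $\|Ty\|$, so that a
geometric series of small moves reaches a point where the operators are
unbounded. *)
Lemma uniform_boundedness (T : nat -> V -> V) (M0 : nat -> R) :
    (forall n, ae_linear ip (T n)) -> (forall n, op_bound ip (T n) (M0 n)) ->
    (forall x, exists C, forall n, N (T n x) <= C) ->
  exists M, forall n, op_bound ip (T n) M.
Proof.
move=> linT bT ptw; apply: contrapT => unb.
have pick (j : nat) : exists q : nat * R * V, [/\ 3 ^+ j * j%:R <= q.1.2,
    op_bound ip (T q.1.1) q.1.2, N q.2 <= 1 & 2 / 3 * q.1.2 <= N (T q.1.1 q.2)].
  have K0 : 0 <= 3 ^+ j * j%:R :> R by rewrite mulr_ge0 ?exprn_ge0 ?ler0n.
  have : exists n x, 3 ^+ j * j%:R * N x < N (T n x).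
    apply: contrapT => h; apply: unb; exists (3 ^+ j * j%:R) => n x.
    by rewrite leNgt; apply/negP => h'; apply: h; exists n, x.
  move=> [n [x h]]; have [M [g [? ? ? ?]]] := near_op_norm (linT n) (bT n) K0 h.
  by exists (n, M, g).
have [q qP] := choice pick.
(* The moves have size at most [w j], so that all those after step [j] amount to at
   most [w j / 2], less than what the move [j] gains. *)
pose w j := (3 ^+ j)^-1 : R.
have w0 j : 0 < w j by rewrite invr_gt0 exprn_gt0.
have wS j : w j = 3 * w j.+1.
  by rewrite /w exprS invfM mulrA divff// mul1r.
pose y j := w j *: (q j).2.
pose Tq j := T (q j).1.1.
pose x := fix x j := if j is i.+1 then
  (if N (Tq i (y i)) <= N (Tq i (x i + y i)) then x i + y i else x i - y i) else 0.
have yw j : N (y j) <= w j.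
  have w0' := ltW (w0 j); rewrite (snormZ sip) ger0_norm// ler_piMr//.
  by have [] := qP j.
have xS j : N (x j.+1 - x j) <= w j.
  rewrite /=; case: ifP => _; rewrite addrAC subrr add0r// ?(snormN sip); exact: yw.
have xT j : N (Tq j (y j)) <= N (Tq j (x j.+1)).
  rewrite /=; case: ifPn => //; rewrite -ltNge => h.
  have l1 := snorm_null sip (ae_linearD (linT (q j).1.1) (x j) (y j)).
  have l2 := snorm_null sip (ae_linearB (linT (q j).1.1) (x j) (y j)).
  have := snormB sip (Tq j (x j) + Tq j (y j)) (Tq j (x j) - Tq j (y j)).
  rewrite opprD opprK addrACA subrr add0r -mulr2n -scaler_nat (snormZ sip).
  by rewrite normr_nat -l1 -l2; rewrite -/(Tq j) in h *; lra.
have xD i j : N (x (i + j)%N - x j) <= 3 / 2 * (w j - w (i + j)%N).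
  elim: i => [|i IH]; first by rewrite add0n !subrr (snorm0 sip) mulr0.
  apply: (le_trans (snorm_trans sip (x (i + j)%N) _ _)).
  by rewrite addSn; have := xS (i + j)%N; have := wS (i + j)%N; lra.
have xM m j : (j <= m)%N -> N (x m - x j) <= 3 / 2 * w j.
  by move=> jm; have := xD (m - j)%N j; rewrite subnK//; have := w0 m; lra.
have w_le j : (0 < j)%N -> w j <= j%:R^-1.
  move=> j0; rewrite /w lef_pV2 ?posrE ?exprn_gt0 ?ltr0n//.
  rewrite -natrX ler_nat; exact/ltnW/ltn_expl.
have [l lP] : exists l, forall e, 0 < e -> exists n0, forall n, (n0 <= n)%N ->
    N (x n - l) <= e.
  apply: compl => e e0.
  have [n0 n0e] : exists n0, (0 < n0)%N /\ 3 * n0%:R^-1 <= e.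
    have [n hn] := nat_above (3 / e); exists n.+1; split => //.
    move: hn; rewrite ltr_pdivrMr// => h.
    by rewrite ler_pdivrMr ?ltr0n// -natr1; nra.
  exists n0 => n m nn0 mn0.
  apply: (le_trans (snorm_trans sip (x n0) _ _)).
  rewrite (snormBC sip (x n0)).
  have := xM _ _ nn0; have := xM _ _ mn0; have := w_le _ n0e.1; lra.
have lx j : N (l - x j) <= 3 / 2 * w j.
  apply/ler_addgt0Pr => e e0; have [n0 n0P] := lP e e0.
  have h1 := n0P (maxn n0 j) (leq_maxl _ _).
  have h2 := xM (maxn n0 j) j (leq_maxr _ _).
  apply: (le_trans (snorm_trans sip (x (maxn n0 j)) _ _)).
  by rewrite (snormBC sip l); lra.
have [C CP] := ptw l.
have big j : j%:R / 6 <= C.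
  apply: le_trans (CP (q j).1.1).
  have [q1 q2 q3 q4] := qP j.
  have h1 := op_bound_dist sip (linT (q j).1.1) q2 (x j.+1) l.
  have h2 : N (Tq j (y j)) = w j * N (Tq j (q j).2).
    rewrite (snorm_null sip (ae_linearZ sip (linT (q j).1.1) q2 _ _)).
    by rewrite (snormZ sip) ger0_norm// ltW.
  have h3 := snorm_le_dist sip (Tq j (x j.+1)) (Tq j l).
  have h4 := xT j.
  have M0' : 0 <= (q j).1.2 by apply: le_trans q1; rewrite mulr_ge0 ?exprn_ge0 ?ler0n.
  have h5 : (q j).1.2 * N (x j.+1 - l) <= (q j).1.2 * (w j / 2).
    by rewrite ler_wpM2l// (snormBC sip); have := lx j.+1; have := wS j; lra.
  have h6 : w j * (2 / 3 * (q j).1.2) <= w j * N (Tq j (q j).2).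
    by rewrite ler_wpM2l// ltW.
  have h7 : w j * (3 ^+ j * j%:R) <= w j * (q j).1.2 by rewrite ler_wpM2l// ltW.
  have h8 : w j * (3 ^+ j * j%:R) = j%:R.
    by rewrite mulrA mulVf ?mul1r// expf_neq0.
  by rewrite -/(Tq j) in h1 *; lra.
have [n hn] := nat_above (6 * C); have := big n; lra.
Qed.

End banach_steinhaus.

(** * Strongly continuous semigroups *)

Section dini.
Context {R : realType}.

Definition unif_cont_on (psi : R -> R) (T : R) := forall e, 0 < e ->
  exists2 d, 0 < d & forall s t, 0 <= s -> s <= t -> t <= T -> t - s < d ->
    `|psi t - psi s| <= e.

(** The supremum of the times at which [phi] is at most its initial value is such a
time by continuity, and any time before [T] can be passed. *)
Lemma locally_nonincreasing (phi : R -> R) (T : R) : 0 <= T ->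
    unif_cont_on phi T ->
    (forall t, 0 <= t < T -> exists2 d, 0 < d &
      forall h, 0 < h < d -> t + h <= T -> phi (t + h) <= phi t) ->
  phi T <= phi 0.
Proof.
move=> T0 ucont step.
pose E := [set s | 0 <= s <= T /\ phi s <= phi 0].
have supE : has_sup E.
  split; first by exists 0; split; rewrite ?lexx.
  by exists T => s [/andP[]].
set s := sup E.
have s0 : 0 <= s by apply: (ub_le_sup supE.2); split; rewrite ?lexx.
have sT : s <= T by apply: (ge_sup supE.1) => x [/andP[]].
have sE : phi s <= phi 0.
  apply/ler_addgt0Pr => e e0; have [d d0 dP] := ucont e e0.
  have [x [/andP[x0 xT] xE] xs] := sup_adherent d0 supE.
  have xs' : x <= s by apply: (ub_le_sup supE.2); split; rewrite ?x0.
  have := dP x s x0 xs' sT; rewrite -/s in xs *.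
  by rewrite ltrBlDl -ltrBlDr => /(_ xs); rewrite ler_norml => /andP[_]; lra.
have [->//|sT'] := eqVneq T s.
have {}sT : s < T by rewrite lt_neqAle eq_sym sT'.
have [|d d0 dP] := step s; first by rewrite s0.
pose h := Num.min (d / 2) (T - s).
have h0 : 0 < h by rewrite /h lt_min subr_gt0 sT divr_gt0.
have hd : h < d by rewrite gt_min; apply/orP; left; lra.
have hT : s + h <= T by rewrite -lerBrDl ge_min lexx orbT.
have := dP h; rewrite h0 hd hT => /(_ isT isT) hh.
have : s + h <= s.
  by apply: (ub_le_sup supE.2); split; [rewrite hT addr_ge0// ltW|lra].
lra.
Qed.

(** A Dini derivative at most [L] on the right is enough for growth at rate [L], which
spares the differentiability of the orbits on the left. *)
Lemma right_growth_bound (psi : R -> R) (T L : R) : 0 <= T ->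
    unif_cont_on psi T ->
    (forall t e, 0 <= t < T -> 0 < e -> exists2 d, 0 < d &
      forall h, 0 < h < d -> t + h <= T -> psi (t + h) <= psi t + (L + e) * h) ->
  psi T <= psi 0 + L * T.
Proof.
move=> T0 ucont step; apply/ler_addgt0Pr => e e0.
pose e' := e / (T + 1); have e'0 : 0 < e' by rewrite divr_gt0//; lra.
have e'T : e' * T <= e.
  by rewrite /e' mulrAC ler_pdivrMr; nra.
suff : psi T - (L + e') * T <= psi 0 - (L + e') * 0 by lra.
apply: (@locally_nonincreasing (fun t => psi t - (L + e') * t)) => //.
- move=> c c0; have c20 : 0 < c / 2 by rewrite divr_gt0.
  have [d d0 dP] := ucont (c / 2) c20.
  have a0 : 0 < `|L + e'| + 1 by rewrite ltr_wpDl.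
  exists (Num.min d (c / 2 / (`|L + e'| + 1))).
    by rewrite lt_min d0 divr_gt0.
  move=> s t s0 st tT; rewrite lt_min => /andP[std].
  rewrite ltr_pdivlMr// => stc; have := dP s t s0 st tT std.
  have -> : psi t - (L + e') * t - (psi s - (L + e') * s) =
    (psi t - psi s) - (L + e') * (t - s) by ring.
  move=> h; apply: (le_trans (ler_normB _ _)).
  rewrite normrM (ger0_norm (_ : 0 <= t - s)) ?subr_ge0//.
  by move: stc; rewrite mulrDr mulr1 mulrC; have := normr_ge0 (L + e'); lra.
- move=> t tT; have [d d0 dP] := step t e' tT e'0.
  by exists d => // h hd hT; have := dP h hd hT; lra.
Qed.

End dini.

Definition sg_right_cvg (R : realType) (V : lmodType R) (ip : V -> V -> R)
    (u : R -> V) (l : V) :=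
  forall e, 0 < e -> exists2 d, 0 < d &
    forall h, 0 < h < d -> snorm ip (u h - l) <= e.

Record strong_semigroup (R : realType) (V : lmodType R) (ip : V -> V -> R)
    (S : R -> V -> V) : Prop := StrongSemigroup {
  sg_lin : forall t, 0 <= t -> ae_linear ip (S t);
  sg_bounded : forall t, 0 <= t -> exists M, op_bound ip (S t) M;
  sg_at0 : forall f, snorm ip (S 0 f - f) = 0;
  sg_add : forall s t f, 0 <= s -> 0 <= t ->
    snorm ip (S (s + t) f - S s (S t f)) = 0;
  sg_cvg0 : forall f, sg_right_cvg ip (S ^~ f) f }.

(** The graph of the infinitesimal generator. *)
Definition generates (R : realType) (V : lmodType R) (ip : V -> V -> R)
    (S : R -> V -> V) (f g : V) :=
  sg_right_cvg ip (fun h => h^-1 *: (S h f - f)) g.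

Section strong_semigroup_theory.
Context {R : realType} {V : lmodType R} {ip : V -> V -> R}.
Context (sip : semi_inner ip) (compl : cauchy_complete ip).
Context {S : R -> V -> V} (sg : strong_semigroup ip S).
Local Notation N := (snorm ip).
Let tri := @snorm_trans R V ip sip.

Lemma op_bound_le (T : V -> V) M M' : M <= M' -> op_bound ip T M -> op_bound ip T M'.
Proof. by move=> MM' bT f; apply: (le_trans (bT f)); rewrite ler_wpM2r ?snorm_ge0. Qed.

(** Were the norms of $S(h)$ unbounded as $h\to0$, a sequence $h_n\to0$ would
contradict the uniform boundedness principle. *)
Lemma sg_small_bound : exists d M, [/\ 0 < d, 1 <= M &
  forall h, 0 <= h <= d -> op_bound ip (S h) M].
Proof.
apply: contrapT => unb.
have pick (n : nat) : exists h, 0 <= h <= n.+1%:R^-1 /\ ~ op_bound ip (S h) n.+1%:R.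
  apply: contrapT => hn; apply: unb; exists n.+1%:R^-1, n.+1%:R; split.
  - by rewrite invr_gt0.
  - by rewrite ler1n.
  - by move=> h hh; apply: contrapT => bh; apply: hn; exists h.
have [h hP] := choice pick.
have h0 n : 0 <= h n by have [/andP[]] := hP n.
have [M0 M0P] := choice (fun n => sg_bounded sg (h0 n)).
have [M MP] : exists M, forall n, op_bound ip (S (h n)) M.
  apply: (uniform_boundedness sip compl _ M0P) => [n|x]; first exact: sg_lin.
  have [d d0 dP] := sg_cvg0 sg x (ltr01 : 0 < 1).
  have [n0 n0P] := nat_above d^-1.
  have tail n : (n0 <= n)%N -> N (S (h n) x) <= N x + 1.
    move=> nn0; apply: (le_trans (snorm_le_dist sip _ x)); rewrite lerD2l.
    have [hn|hn] := eqVneq (h n) 0; first by rewrite hn (sg_at0 sg).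
    apply: dP; rewrite lt_neqAle eq_sym hn h0/=.
    have [/andP[_ hn1] _] := hP n; apply: le_lt_trans hn1 _.
    rewrite invf_plt ?posrE//; apply: (lt_trans n0P).
    by rewrite ltr_nat ltnS.
  have head k : exists C, forall n, (n < k)%N -> N (S (h n) x) <= C.
    elim: k => [|k [C CP]]; first by exists 0.
    exists (Num.max C (N (S (h k) x))) => n; rewrite ltnS leq_eqVlt.
    by case/predU1P => [->|/CP]; rewrite le_max ?lexx ?orbT// => ->.
  have [C CP] := head n0; exists (Num.max C (N x + 1)) => n.
  by rewrite le_max; have [/CP->//|/tail->] := ltnP n n0; rewrite orbT.
have [n nM] := nat_above M; have [_] := hP n; apply.
by apply: op_bound_le (MP n); apply: ltW; apply: (lt_trans nM); rewrite ltr_nat.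
Qed.

Lemma sg_local_bound T : exists2 M, 1 <= M &
  forall t, 0 <= t <= T -> op_bound ip (S t) M.
Proof.
have [d [M [d0 M1 MP]]] := sg_small_bound.
have M0 : 0 <= M by apply: le_trans M1.
have [n nT] := nat_above (T / d).
exists (M ^+ n); first exact: exprn_ege1.
suff H k t : 0 <= t <= k%:R * d -> op_bound ip (S t) (M ^+ k).
  move=> t /andP[t0 tT]; apply: H; rewrite t0/=; apply: (le_trans tT).
  by rewrite -ler_pdivrMr// ltW.
elim: k t => [|k IH] t /andP[t0 tk].
  have -> : t = 0 by apply/le_anti; rewrite t0 andbT; move: tk; rewrite mul0r.
  by move=> f; rewrite (snorm_null sip (sg_at0 sg f)) expr0 mul1r.
have [td|td] := leP t d.
  apply: (@op_bound_le _ M); last by apply: MP; rewrite t0.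
  by rewrite exprS ler_peMr// exprn_ege1.
move=> f; have -> : t = d + (t - d) by ring.
have td0 : 0 <= t - d by rewrite subr_ge0 ltW.
rewrite (snorm_null sip (sg_add sg f (ltW d0) td0)).
apply: (le_trans (MP d _ _)); first by rewrite lexx ltW.
rewrite exprS -mulrA ler_wpM2l//; apply: IH.
by rewrite td0 lerBlDr; move: tk; rewrite -natr1 mulrDl mul1r.
Qed.

Lemma sg_increment M s r f : 0 <= s -> 0 <= r -> op_bound ip (S s) M ->
  N (S (s + r) f - S s f) <= M * N (S r f - f).
Proof.
move=> s0 r0 bM; rewrite (snorm_null_l sip _ (sg_add sg f s0 r0)).
exact: (op_bound_dist sip (sg_lin sg s0)).
Qed.

Lemma sg_unif_cont T f e : 0 < e -> exists2 d, 0 < d &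
  forall s t, 0 <= s -> s <= t -> t <= T -> t - s < d -> N (S t f - S s f) <= e.
Proof.
move=> e0; have [M M1 MP] := sg_local_bound T.
have M0 : 0 < M by apply: lt_le_trans M1.
have [d d0 dP] := sg_cvg0 sg f (divr_gt0 e0 M0).
exists d => // s t s0 st tT std; have [->|ts] := eqVneq t s.
  by rewrite subrr (snorm0 sip) ltW.
rewrite -(subrKC s t).
apply: (le_trans (sg_increment (M := M) _ _ _ _)) => //.
- by rewrite subr_ge0.
- by apply: MP; rewrite s0 (le_trans st).
- rewrite mulrC -ler_pdivlMr//; apply: dP.
  by rewrite subr_gt0 std andbT lt_neqAle eq_sym ts.
Qed.

Lemma sg_addC s t f : 0 <= s -> 0 <= t -> N (S s (S t f) - S t (S s f)) = 0.
Proof.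
move=> s0 t0; apply: snorm_eq0P.
apply: (le_trans (tri (S (s + t) f) _ _)).
rewrite (snormBC sip) (sg_add sg f s0 t0) addrC.
by rewrite (addrC s) (sg_add sg f t0 s0).
Qed.

(** The generator commutes with the semigroup. *)
Lemma generates_orbit t f g : 0 <= t -> generates ip S f g ->
  generates ip S (S t f) (S t g).
Proof.
move=> t0 fg e e0; have [M M1 MP] := sg_local_bound t.
have bt := MP t; rewrite t0 lexx in bt; have {}bt := bt isT.
have M0 : 0 < M by apply: lt_le_trans M1.
have [d d0 dP] := fg (e / M) (divr_gt0 e0 M0); exists d => // h hd.
have h0 : 0 <= h by case/andP: hd => /ltW.
have lt := sg_lin sg t0.
have E : N (h^-1 *: (S h (S t f) - S t f) - S t (h^-1 *: (S h f - f))) = 0.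
  rewrite (snorm_null_r sip _ (ae_linearZ sip lt bt _ _)) -scalerBr (snormZ sip).
  rewrite (snorm_null_r sip _ (ae_linearB lt _ _)).
  by rewrite opprB addrA subrK (sg_addC f h0 t0) mulr0.
rewrite (snorm_null_l sip _ E); apply: (le_trans (op_bound_dist sip lt bt _ _)).
by rewrite mulrC -ler_pdivlMr// dP.
Qed.

End strong_semigroup_theory.

(** * Density of the domain of the generator *)

Lemma sum_divn (V : nmodType) (F : nat -> V) (n q : nat) : (0 < q)%N ->
  \sum_(0 <= l < n * q) F (l %/ q)%N = (\sum_(0 <= j < n) F j) *+ q.
Proof.
move=> q0; elim: n => [|n IH]; first by rewrite mul0n !big_geq// mul0rn.
rewrite big_nat_recr//= mulSnr (big_cat_nat (n := n * q))//= ?leq_addr//.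
rewrite IH mulrnDl; congr (_ + _).
rewrite -{1}(add0n (n * q)%N) big_addn addKn.
rewrite (eq_big_nat _ _ (F2 := fun=> F n)); last first.
  by move=> i /andP[_ iq]; rewrite addnC divnMDl// divn_small// addn0.
by rewrite sumr_const_nat subn0.
Qed.

Section domain_density.
Context {R : realType} {V : lmodType R} {ip : V -> V -> R}.
Context (sip : semi_inner ip) (compl : cauchy_complete ip).
Context {S : R -> V -> V} (sg : strong_semigroup ip S).
Local Notation N := (snorm ip).
Let tri := @snorm_trans R V ip sip.

(** A Riemann sum of $\frac1h\int_0^hS(s)f\,ds$. *)
Definition orbit_mean (h : R) (f : V) (n : nat) : V :=
  n%:R^-1 *: \sum_(0 <= j < n) S (j%:R * (h / n%:R)) f.

Lemma snorm_mean (n : nat) (F : nat -> V) c : (0 < n)%N ->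
  (forall j, (j < n)%N -> N (F j) <= c) ->
  N (n%:R^-1 *: \sum_(0 <= j < n) F j) <= c.
Proof.
move=> n0 Fc; rewrite (snormZ sip) ger0_norm ?invr_ge0// mulrC.
rewrite ler_pdivrMr ?ltr0n//; apply: (le_trans (snorm_sum sip _ _ _)).
rewrite mulr_natr -[X in c *+ X]subn0 -sumr_const_nat.
by apply: ler_sum_nat => j /andP[_ /Fc].
Qed.

Lemma mesh_bound (h : R) n j : 0 <= h -> (j < n)%N ->
  0 <= j%:R * (h / n%:R) <= h.
Proof.
move=> h0 jn; have n0 : 0 < n%:R :> R by rewrite ltr0n (leq_ltn_trans _ jn).
rewrite !mulr_ge0 ?invr_ge0 ?ler0n//= mulrCA ler_piMr// ler_pdivrMr// mul1r.
by rewrite ler_nat ltnW.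
Qed.

Lemma orbit_mean_near h f n w : 0 <= h -> (0 < n)%N ->
  (forall s, 0 <= s <= h -> N (S s f - f) <= w) -> N (orbit_mean h f n - f) <= w.
Proof.
move=> h0 n0 hw; rewrite /orbit_mean.
have fE : f = n%:R^-1 *: \sum_(0 <= j < n) f.
  by rewrite sumr_const_nat subn0 -[f *+ n]scaler_nat scalerA mulVf ?scale1r// pnatr_eq0 -lt0n.
rewrite [X in _ - X]fE -scalerBr -sumrB; apply: snorm_mean => // j jn.
by apply: hw; exact: mesh_bound.
Qed.

(** Refining a subdivision moves each evaluation time by less than the mesh; this
makes the Riemann sums over dyadic subdivisions a Cauchy sequence. *)
Lemma orbit_mean_refine h f n q w M : 0 <= h -> (0 < n)%N -> (0 < q)%N ->
  (forall s, 0 <= s <= h -> op_bound ip (S s) M) -> 0 <= M ->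
  (forall s, 0 <= s <= h / n%:R -> N (S s f - f) <= w) ->
  N (orbit_mean h f (n * q) - orbit_mean h f n) <= M * w.
Proof.
move=> h0 n0 q0 hM M0 hw.
have nR : 0 < n%:R :> R by rewrite ltr0n.
have qR : 0 < q%:R :> R by rewrite ltr0n.
have -> : orbit_mean h f n = (n * q)%:R^-1 *:
    \sum_(0 <= l < n * q) S ((l %/ q)%:R * (h / n%:R)) f.
  rewrite (sum_divn (fun j => S (j%:R * (h / n%:R)) f))// -[_ *+ q]scaler_nat scalerA.
  by rewrite natrM invfM -mulrA mulVf ?mulr1// gt_eqF.
rewrite /orbit_mean -scalerBr -sumrB; apply: snorm_mean; first by rewrite muln_gt0 n0.
move=> l ln.
set s := (l %/ q)%:R * (h / n%:R).
pose r := (l %% q)%:R * (h / (n * q)%:R).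
have -> : l%:R * (h / (n * q)%:R) = s + r.
  rewrite /s /r [in LHS](divn_eq l q) natrD [in LHS]natrM mulrDl; congr (_ + _).
  by rewrite natrM; field; rewrite !gt_eqF.
have s0 : 0 <= s by rewrite !mulr_ge0 ?invr_ge0 ?ler0n.
have r0 : 0 <= r by rewrite !mulr_ge0 ?invr_ge0 ?ler0n.
have rn : r <= h / n%:R.
  have -> : r = (l %% q)%:R / q%:R * (h / n%:R).
    by rewrite /r natrM; field; rewrite !gt_eqF.
  rewrite ler_piMl ?divr_ge0 ?ler0n// ler_pdivrMr// mul1r ler_nat ltnW//.
  by rewrite ltn_mod.
have sh : s <= h.
  have /andP[_] : 0 <= (l %/ q)%:R * (h / n%:R) <= h; last by [].
  by apply: mesh_bound => //; rewrite ltn_divLR.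
apply: (le_trans (sg_increment sip sg _ s0 r0 (hM _ _))); first by rewrite s0.
by rewrite ler_wpM2l// hw// r0.
Qed.

(** Comparison of the Riemann sums of a shifted orbit with those of the orbit:
the two only differ by the terms at both ends. *)
Lemma orbit_mean_shift h f n p r w M : 0 < h -> (0 < n)%N -> (p <= n)%N ->
  (forall s, 0 <= s <= 2 * h -> op_bound ip (S s) M) -> 0 <= M ->
  p%:R * (h / n%:R) <= r ->
  (forall s, 0 <= s <= r -> N (S s f - f) <= w) ->
  N (S (p%:R * (h / n%:R)) (orbit_mean h f n) - orbit_mean h f n
     - (p%:R / n%:R) *: (S h f - f)) <= (r / h) * ((M + 1) * w).
Proof.
move=> h0 n0 pn hM M0 pr hw.
have nR : 0 < n%:R :> R by rewrite ltr0n.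
set d := h / n%:R; have d0 : 0 < d by rewrite divr_gt0.
pose u (j : nat) := S (j%:R * d) f.
have pd0 : 0 <= p%:R * d by rewrite mulr_ge0 ?ler0n// ltW.
have nd : n%:R * d = h by rewrite /d mulrC divfK// gt_eqF.
have lp := sg_lin sg pd0.
have bp : op_bound ip (S (p%:R * d)) M.
  apply: hM; rewrite pd0/=; apply: (@le_trans _ _ h); last lra.
  by rewrite -nd ler_wpM2r ?ler_nat// ltW.
have E : N (S (p%:R * d) (orbit_mean h f n) -
            n%:R^-1 *: \sum_(0 <= j < n) u (p + j)%N) = 0.
  rewrite /orbit_mean (snorm_null_l sip _ (ae_linearZ sip lp bp _ _)).
  rewrite -scalerBr (snormZ sip); apply/eqP; rewrite mulf_eq0; apply/orP; right.
  rewrite big_mkord (snorm_null_l sip _ (ae_linear_sum sip lp bp _)).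
  rewrite (big_mkord xpredT (fun j => u (p + j)%N)) -sumrB; apply/eqP/snorm_eq0P.
  apply: (le_trans (snorm_sum sip _ _ _)); rewrite big1// => i _.
  rewrite (snormBC sip) /u natrD mulrDl (sg_add sg)//.
  by rewrite mulr_ge0 ?ler0n// ltW.
have -> : orbit_mean h f n = n%:R^-1 *: \sum_(0 <= j < n) u j by [].
rewrite -addrA -opprD (snorm_null_l sip _ E) opprD addrA -scalerBr.
have -> : \sum_(0 <= j < n) u (p + j)%N - \sum_(0 <= j < n) u j =
    \sum_(0 <= j < p) (u (n + j)%N - u j).
  rewrite sumrB; apply/eqP; rewrite subr_eq addrAC eq_sym subr_eq; apply/eqP.
  have sh m k : \sum_(0 <= j < k) u (m + j)%N = \sum_(m <= j < m + k) u j.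
    rewrite -[in RHS](add0n m) big_addn addnC addnK.
    by apply: eq_bigr => j _; rewrite addnC.
  rewrite !sh [RHS]addrC [LHS]addrC -!big_cat_nat//= ?leq_addr//.
  by rewrite addnC.
have [->|p0] := posnP p.
  rewrite big_geq// scaler0 mul0r scale0r subrr (snorm0 sip).
  have r0 : 0 <= r by apply: le_trans pr.
  have w0 : 0 <= w.
    by apply: le_trans (hw 0 _); rewrite ?snorm_ge0 ?lexx.
  by rewrite !mulr_ge0// ?invr_ge0; lra.
have pR : 0 < p%:R :> R by rewrite ltr0n.
have -> : (p%:R / n%:R) *: (S h f - f) =
    n%:R^-1 *: \sum_(0 <= j < p) (S h f - f).
  by rewrite sumr_const_nat subn0 -[(_ - _) *+ p]scaler_nat scalerA mulrC.
have w0 : 0 <= w.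
  apply: le_trans (hw 0 _); rewrite ?snorm_ge0 ?lexx//=.
  by apply: le_trans pr.
rewrite -scalerBr -sumrB.
have -> : n%:R^-1 = (p%:R / n%:R) * p%:R^-1 :> R.
  by field; rewrite !gt_eqF.
rewrite -scalerA (snormZ sip) ger0_norm ?divr_ge0 ?ler0n//.
apply: ler_pM; [by rewrite divr_ge0 ?ler0n|exact: snorm_ge0| |].
- rewrite ler_pdivlMr//; apply: le_trans pr.
  by rewrite /d mulrA mulrAC.
- apply: snorm_mean => // j jp.
  have jr : 0 <= j%:R * d <= r.
    have d0' := ltW d0; rewrite mulr_ge0 ?ler0n//=; apply: le_trans pr.
    by rewrite ler_wpM2r// ler_nat ltnW.
  have -> : u (n + j)%N - u j - (S h f - f) = (u (n + j)%N - S h f) + (f - u j).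
    by rewrite opprB addrACA [RHS]addrACA [- S h f - _]addrC.
  apply: (le_trans (snormD sip _ _)).
  rewrite mulrDl mul1r; apply: lerD; last by rewrite (snormBC sip); exact: hw.
  rewrite /u natrD mulrDl nd.
  apply: (le_trans (sg_increment (M := M) sip sg _ (ltW h0) _ _)).
  + by case/andP: jr.
  + by apply: hM; rewrite ltW//=; lra.
  + by rewrite ler_wpM2l// hw.
Qed.

End domain_density.
Arguments orbit_mean {R V} S h f n.

Section domain_density_theorem.
Context {R : realType} {V : lmodType R} {ip : V -> V -> R}.
Context (sip : semi_inner ip) (compl : cauchy_complete ip).
Context {S : R -> V -> V} (sg : strong_semigroup ip S).
Local Notation N := (snorm ip).
Let tri := @snorm_trans R V ip sip.

Lemma sg_near0 f e : 0 < e -> exists2 d, 0 < d &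
  forall s, 0 <= s < d -> N (S s f - f) <= e.
Proof.
move=> e0; have [d d0 dP] := sg_cvg0 sg f e0; exists d => // s /andP[s0 sd].
have [->|s1] := eqVneq s 0; first by rewrite (sg_at0 sg) ltW.
by apply: dP; rewrite sd andbT lt_neqAle eq_sym s1.
Qed.

Lemma small_step (h d : R) : 0 < h -> 0 < d ->
  exists n0, forall n, (n0 <= n)%N -> h / n%:R < d /\ (0 < n)%N.
Proof.
move=> h0 d0; have [n0 n0P] := nat_above (h / d); exists n0.+1 => n nn0.
have n0' : (0 < n)%N by apply: leq_trans nn0.
split => //; rewrite ltr_pdivrMr ?ltr0n// mulrC -ltr_pdivrMr//.
by apply: (lt_le_trans n0P); rewrite ler_nat ltnW.
Qed.

(** The mean of the orbit over $[0,h]$ lies in the domain of the generator,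
which maps it to $(S(h)f-f)/h$. *)
Lemma orbit_mean_limit f h : 0 < h ->
  exists l, [/\ forall w, (forall s, 0 <= s <= h -> N (S s f - f) <= w) ->
                  N (l - f) <= w
              & generates ip S l (h^-1 *: (S h f - f))].
Proof.
move=> h0; have [M M1 MP] := sg_local_bound sip compl sg (2 * h).
have M0 : 0 < M by apply: lt_le_trans M1.
have MP' s : 0 <= s <= h -> op_bound ip (S s) M.
  by move=> /andP[s0 sh]; apply: MP; rewrite s0/=; lra.
pose a k := orbit_mean S h f (2 ^ k).
have [l lP] : exists l, forall e, 0 < e -> exists n0, forall n, (n0 <= n)%N ->
    N (a n - l) <= e.
  apply: compl => e e0; have e2 : 0 < e / 2 / M by rewrite !divr_gt0.
  have [d d0 dP] := sg_near0 f e2.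
  have [n0 n0P] := small_step h0 d0.
  have key n : (n0 <= n)%N -> N (a n - a n0) <= e / 2.
    have -> : e / 2 = M * (e / 2 / M) by rewrite [RHS]mulrC divfK ?gt_eqF.
    move=> nn0; rewrite /a -(subnKC nn0) expnD.
    apply: (orbit_mean_refine sip sg (ltW h0)) => //; rewrite ?expn_gt0// ?(ltW M0)//.
    move=> s /andP[s0 sn]; apply: dP.
    rewrite s0/=; apply: (le_lt_trans sn).
    by have [] := n0P (2 ^ n0)%N (ltnW (ltn_expl _ _)).
  exists n0 => n m nn0 mn0; apply: (le_trans (tri (a n0) _ _)).
  by have := key n nn0; have := key m mn0; rewrite (snormBC sip (a n0)); lra.
exists l; split.
  move=> w hw; apply/ler_addgt0Pr => e e0; have [n0 n0P] := lP e e0.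
  apply: (le_trans (tri (a n0) _ _)); rewrite (snormBC sip l) addrC.
  by apply: lerD; [apply: orbit_mean_near => //; rewrite ?expn_gt0// ltW|exact: n0P].
move=> e e0.
have [w [w0 wE]] : exists w, 0 < w /\ (M + 1) * w / h = e.
  by exists (e * h / (M + 1)); split;
    [rewrite divr_gt0 ?mulr_gt0//; lra|field; rewrite !gt_eqF//; lra].
have [d d0 dP] := sg_near0 f w0.
exists (Num.min d h); first by rewrite lt_min d0.
move=> r /andP[r0]; rewrite lt_min => /andP[rd rh].
have -> : r^-1 *: (S r l - l) - h^-1 *: (S h f - f) =
    r^-1 *: (S r l - l - (r / h) *: (S h f - f)).
  by rewrite [in RHS]scalerBr scalerA mulrA mulVf ?mul1r// gt_eqF.
rewrite (snormZ sip) ger0_norm ?invr_ge0 ?(ltW r0)// mulrC ler_pdivrMr//.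
apply/ler_addgt0Pr => c c0.
set G := S h f - f.
have [d2 d20 d2P] := sg_unif_cont sip compl sg h l (divr_gt0 c0 (ltr0n _ 4 : 0 < 4%:R)).
pose c' := c / 4 / (M + 1).
have c'0 : 0 < c' by rewrite !divr_gt0//; lra.
have [n1 n1P] := lP c' c'0.
pose d3 := c / 4 * h / (N G + 1).
have d30 : 0 < d3 by rewrite !(divr_gt0, mulr_gt0)// ltr_wpDl// snorm_ge0.
have [n2 n2P] := small_step h0 d20.
have [n3 n3P] := small_step h0 d30.
pose k := maxn n1 (maxn n2 n3).
have kn1 : (n1 <= k)%N by rewrite leq_maxl.
have kn2 : (n2 <= 2 ^ k)%N.
  by apply: ltnW; apply: (leq_ltn_trans _ (ltn_expl _ _)); rewrite // /k !leq_max leqnn orbT.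
have kn3 : (n3 <= 2 ^ k)%N.
  by apply: ltnW; apply: (leq_ltn_trans _ (ltn_expl _ _)); rewrite // /k !leq_max leqnn !orbT.
have [m2 np] := n2P _ kn2; have [m3 _] := n3P _ kn3.
have := n1P _ kn1; rewrite /a.
set n := (2 ^ k)%N in np m2 m3 *; set A := orbit_mean S h f n => hA.
set dl := h / n%:R in m2 m3.
have nR : 0 < n%:R :> R by rewrite ltr0n.
have dl0 : 0 < dl by rewrite divr_gt0.
pose p := Num.truncn (r / dl).
have rdl0 : 0 <= r / dl by rewrite divr_ge0 ?ltW.
have /andP[p1 p2] : p%:R <= r / dl < p.+1%:R by exact: truncn_itv.
have pr : p%:R * dl <= r by rewrite -ler_pdivlMr.
have rp : r - p%:R * dl < dl.
  by move: p2; rewrite ltr_pdivrMr// -natr1 mulrDl mul1r; lra.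
have pn : (p <= n)%N.
  rewrite -(ler_nat R); apply: (le_trans p1); rewrite ler_pdivrMr//.
  by rewrite /dl mulrC divfK ?gt_eqF// ltW.
have pd0 : 0 <= p%:R * dl by rewrite mulr_ge0 ?ler0n// ltW.
have hwr s : 0 <= s <= r -> N (S s f - f) <= w.
  by move=> /andP[s0 sr]; apply: dP; rewrite s0 (le_lt_trans sr).
have main := orbit_mean_shift sip sg h0 np pn MP (ltW M0) pr hwr.
rewrite -/dl -/A -/G in main.
have t1 : N (S r l - S (p%:R * dl) l) <= c / 4.
  by apply: d2P => //; [exact: ltW|exact: lt_trans m2].
have bp : op_bound ip (S (p%:R * dl)) M by apply: MP'; rewrite pd0/=; lra.
have t2 : N (S (p%:R * dl) l - S (p%:R * dl) A) <= M * c'.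
  apply: (le_trans (op_bound_dist sip (sg_lin sg pd0) bp _ _)).
  by rewrite ler_pM2l// (snormBC sip).
have t3 : N ((p%:R / n%:R - r / h) *: G) <= c / 4.
  have -> : p%:R / n%:R - r / h = - ((r - p%:R * dl) / h) :> R.
    by rewrite /dl; field; rewrite !gt_eqF.
  rewrite (snormZ sip) normrN ger0_norm ?divr_ge0 ?subr_ge0 ?(ltW h0)//.
  rewrite mulrAC ler_pdivrMr//; have G0 : 0 <= N G := sqrtr_ge0 _.
  have : (r - p%:R * dl) * (N G + 1) <= c / 4 * h.
    rewrite -ler_pdivlMr; last by lra.
    by apply: ltW; apply: (lt_trans rp).
  by nra.
have c'M : M * c' + c' = c / 4.
  by rewrite /c'; field; rewrite gt_eqF//; lra.
have -> : S r l - l - (r / h) *: G =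
  (S r l - S (p%:R * dl) l) + ((S (p%:R * dl) l - S (p%:R * dl) A) + ((A - l)
   + ((S (p%:R * dl) A - A - (p%:R / n%:R) *: G) + (p%:R / n%:R - r / h) *: G))).
  rewrite scalerBl; set b := S _ A; set cG := (p%:R / n%:R) *: G.
  rewrite [b - A - cG + _]addrA subrK [A - l + _]addrA [A - l + _]addrC subrKA.
  by rewrite -![_ - l - _]addrA !subrKA.
apply: (le_trans (snormD sip _ _)); apply: (@le_trans _ _ (c / 4 + (M * c' + (c' + (r / h * ((M + 1) * w) + c / 4))))).
  apply: lerD => //; apply: (le_trans (snormD sip _ _)); apply: lerD => //.
  apply: (le_trans (snormD sip _ _)); apply: lerD => //.
  by apply: (le_trans (snormD sip _ _)); apply: lerD.
have -> : r / h * ((M + 1) * w) = e * r by rewrite -wE; ring.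
lra.
Qed.

Lemma domain_dense f e : 0 < e ->
  exists l g, N (l - f) <= e /\ generates ip S l g.
Proof.
move=> e0; have [d d0 dP] := sg_near0 f e0.
have d2 : 0 < d / 2 by rewrite divr_gt0.
have [l [lf gl]] := orbit_mean_limit f d2.
exists l, ((d / 2)^-1 *: (S (d / 2) f - f)); split => //.
by apply: lf => s /andP[s0 sd]; apply: dP; rewrite s0/=; lra.
Qed.

End domain_density_theorem.

(** * Decay from a Lyapunov functional *)

Definition seq_cvg (R : realType) (V : lmodType R) (ip : V -> V -> R)
    (u : nat -> V) (l : V) :=
  forall e, 0 < e -> exists n0, forall n, (n0 <= n)%N -> snorm ip (u n - l) <= e.

Record bounded_bilinear (R : realType) (V : lmodType R) (ip : V -> V -> R)
    (G : V -> V -> R) (K : R) : Prop := BoundedBilinear {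
  bbDl : forall u v w, G (u + v) w = G u w + G v w;
  bbZl : forall a u w, G (a *: u) w = a * G u w;
  bbDr : forall u v w, G u (v + w) = G u v + G u w;
  bbZr : forall a u w, G u (a *: w) = a * G u w;
  bb_le : forall u w, `|G u w| <= K * (snorm ip u * snorm ip w) }.

Record bounded_linear_form (R : realType) (V : lmodType R) (ip : V -> V -> R)
    (m : V -> R) (K : R) : Prop := BoundedLinearForm {
  blD : forall u v, m (u + v) = m u + m v;
  blZ : forall a u, m (a *: u) = a * m u;
  bl_le : forall u, `|m u| <= K * snorm ip u }.

Section lyapunov.
Context {R : realType} {V : lmodType R} {ip : V -> V -> R}.
Context (sip : semi_inner ip) (compl : cauchy_complete ip).
Local Notation N := (snorm ip).

Section bounded_forms.
Context {G : V -> V -> R} {KG : R} (bG : bounded_bilinear ip G KG).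
Context {m : V -> R} {Km : R} (bm : bounded_linear_form ip m Km).

Lemma bbBl u v w : G (u - v) w = G u w - G v w.
Proof. by rewrite -scaleN1r (bbDl bG) (bbZl bG) mulN1r. Qed.

Lemma bbBr u v w : G w (u - v) = G w u - G w v.
Proof. by rewrite -scaleN1r (bbDr bG) (bbZr bG) mulN1r. Qed.

Lemma blB u v : m (u - v) = m u - m v.
Proof. by rewrite -scaleN1r (blD bm) (blZ bm) mulN1r. Qed.

(** The quadratic error is absorbed in a linear one for [e <= 1]. *)
Lemma bounded_bilinear_dist u v u' v' e : 0 <= KG -> N (u - u') <= e ->
    N (v - v') <= e -> e <= 1 ->
  `|G u v - G u' v'| <= KG * (N u' + N v' + 1) * e.
Proof.
move=> K0 hu hv e1; have e0 : 0 <= e by apply: le_trans hu; exact: sqrtr_ge0.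
have -> : G u v - G u' v' = G (u - u') v + G u' (v - v').
  by rewrite bbBl bbBr; ring.
apply: (le_trans (ler_normD _ _)).
have h1 := bb_le bG (u - u') v; have h2 := bb_le bG u' (v - v').
have v1 : N v <= N v' + 1.
  by apply: (le_trans (snorm_le_dist sip v v')); rewrite lerD2l (le_trans hv).
have u0 : 0 <= N u' := sqrtr_ge0 _; have v0 : 0 <= N v := sqrtr_ge0 _.
have uu0 : 0 <= N (u - u') := sqrtr_ge0 _.
have vv0 : 0 <= N (v - v') := sqrtr_ge0 _.
have h3 : N (u - u') * N v <= e * (N v' + 1) by exact: ler_pM.
have h4 : N u' * N (v - v') <= N u' * e by rewrite ler_wpM2l.
have : KG * (N (u - u') * N v) + KG * (N u' * N (v - v')) <=
   KG * (e * (N v' + 1)) + KG * (N u' * e).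
  by apply: lerD; rewrite ler_wpM2l.
by lra.
Qed.

Lemma bounded_linear_dist u v : `|m u - m v| <= Km * N (u - v).
Proof. by rewrite -blB; exact: bl_le. Qed.

End bounded_forms.

(** [G] plays the role of a scalar product equivalent to that of the space, for
which minus the generator is coercive up to the conserved mass [m]. The estimates on
the core [A] pass to the generator by density of the graph, and the resulting
decay from the domain to the whole space by density of the domain. *)
Theorem lyapunov_decay (S : R -> V -> V) (A : V -> V -> Prop)
    (G : V -> V -> R) (m : V -> R) (Km lam C : R) :
    strong_semigroup ip S ->
    (forall f g, generates ip S f g -> exists u v,
       [/\ forall n : nat, A (u n) (v n), seq_cvg ip u f & seq_cvg ip v (- g)]) ->
    bounded_bilinear ip G 1 -> (forall u, 4^-1 * N u ^+ 2 <= G u u) ->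
    bounded_linear_form ip m Km -> 0 <= Km -> 0 <= lam -> 0 <= C ->
    (forall u w, A u w -> m w = 0) ->
    (forall u w, A u w -> lam * N u ^+ 2 - C * m u ^+ 2 <= G w u + G u w) ->
  forall f t, 0 <= t -> m f = 0 ->
    N (S t f) <= 2 * expR (- (lam / 2) * t) * N f.
Proof.
move=> sg gen bG Gpos bm Km0 lam0 C0 mA dA.
have Gdist := bounded_bilinear_dist bG.
(* The estimates on the core persist on its closure, which contains the graph of
   minus the generator: approximate within [d] and let [d] tend to 0. *)
have close f g : generates ip S f g ->
    m g = 0 /\ G g f + G f g <= - lam * N f ^+ 2 + C * m f ^+ 2.
  move=> /gen[u [v [uv uf vg]]].
  have appr e : 0 < e -> exists n, N (u n - f) <= e /\ N (v n + g) <= e.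
    move=> e0; have [n1 n1P] := uf e e0; have [n2 n2P] := vg e e0.
    exists (maxn n1 n2); split; first by apply: n1P; exact: leq_maxl.
    by have := n2P (maxn n1 n2) (leq_maxr _ _); rewrite opprK.
  split.
    apply/eqP; rewrite -normr_eq0 eq_le normr_ge0 andbT.
    apply/ler_addgt0Pr => e e0; rewrite add0r.
    have e'0 : 0 < e / (Km + 1) by rewrite divr_gt0//; lra.
    have [n [_ h]] := appr _ e'0.
    have := bounded_linear_dist bm (v n) (- g); rewrite opprK (mA _ _ (uv n)).
    rewrite sub0r normrN -scaleN1r (blZ bm) normrM normrN1 mul1r => h'.
    apply: (le_trans h'); apply: (@le_trans _ _ (Km * (e / (Km + 1)))).
      by rewrite ler_wpM2l.
    by rewrite mulrCA ler_piMr ?(ltW e0)// ler_pdivrMr; lra.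
  apply/ler_addgt0Pr => e e0.
  (* [K * d] bounds the sum of the errors made in the three terms. *)
  pose K := 2 * (N f + N g + 1) + lam * (N f + N f + 1) + C * (2 * (Km * N f) + Km) * Km + 1.
  have Nf0 : 0 <= N f := sqrtr_ge0 _. have Ng0 : 0 <= N g := sqrtr_ge0 _.
  have K0 : 0 < K.
    by rewrite ltr_wpDl// !addr_ge0// !mulr_ge0// ?addr_ge0// ?mulr_ge0.
  have d0 : 0 < Num.min 1 (e / K) by rewrite lt_min ltr01 divr_gt0.
  set d := Num.min _ _ in d0.
  have d1 : d <= 1 by rewrite ge_min lexx.
  have dK : d * K <= e by rewrite -ler_pdivlMr// ge_min lexx orbT.
  have [n [h1 h2]] := appr d d0.
  have h2' : N (v n - - g) <= d by rewrite opprK.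
  have := dA _ _ (uv n).
  have ng : N (- g) = N g by rewrite (snormN sip).
  have GN x : G x (- g) = - G x g by rewrite -scaleN1r (bbZr bG) mulN1r.
  have GNl x : G (- g) x = - G g x by rewrite -scaleN1r (bbZl bG) mulN1r.
  have := Gdist (u n) (v n) f (- g) d ler01 h1 h2' d1.
  have := Gdist (v n) (u n) (- g) f d ler01 h2' h1 d1.
  rewrite ng GN GNl !mul1r !ler_norml => /andP[_ b1] /andP[_ b2] b3.
  have b4 : N f ^+ 2 - N (u n) ^+ 2 <= (N f + N f + 1) * d.
    have n1 := snorm_le_dist sip (u n) f; have n2 := snorm_le_dist sip f (u n).
    rewrite (snormBC sip f) in n2.
    have q0 : 0 <= N (u n) := sqrtr_ge0 _.
    have -> : N f ^+ 2 - N (u n) ^+ 2 = (N f - N (u n)) * (N f + N (u n)) by ring.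
    have [z|z] := leP (N f) (N (u n)).
      apply: (@le_trans _ _ 0); first by rewrite mulr_le0_ge0 ?addr_ge0//; lra.
      by rewrite mulr_ge0//; [lra|exact: ltW].
    by rewrite mulrC; apply: ler_pM; lra.
  have b5 : m (u n) ^+ 2 - m f ^+ 2 <= (2 * (Km * N f) + Km) * Km * d.
    have e1 := bounded_linear_dist bm (u n) f.
    have e2 := bl_le bm f.
    have e3 : Km * N (u n - f) <= Km * d by rewrite ler_wpM2l.
    have -> : m (u n) ^+ 2 - m f ^+ 2 = (m (u n) - m f) * (m (u n) - m f + 2 * m f) by ring.
    apply: (le_trans (ler_norm _)); rewrite normrM mulrC -mulrA.
    apply: ler_pM => //; last exact: le_trans e3.
    apply: (le_trans (ler_normD _ _)); rewrite normrM (ger0_norm (ler0n _ 2)).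
    have : Km * d <= Km by rewrite ler_piMr.
    by lra.
  have b4' : lam * (N f ^+ 2 - N (u n) ^+ 2) <= lam * ((N f + N f + 1) * d).
    by rewrite ler_wpM2l.
  have b5' : C * (m (u n) ^+ 2 - m f ^+ 2) <= C * ((2 * (Km * N f) + Km) * Km * d).
    by rewrite ler_wpM2l.
  have : d * K = 2 * (N f + N g + 1) * d + lam * ((N f + N f + 1) * d)
     + C * ((2 * (Km * N f) + Km) * Km * d) + d by rewrite /K; ring.
  by lra.
have Gup u : G u u <= N u ^+ 2.
  by have := bb_le bG u u; rewrite mul1r -expr2; exact: le_trans (ler_norm _).
(* An element of the domain close to [f] need not have mass zero; its mass only
   contributes a term that grows linearly in time. *)
have decay f g T : generates ip S f g -> 0 <= T ->
    N (S T f) ^+ 2 <= 4 * (expR (- lam * T) * N f ^+ 2 + C * m f ^+ 2 * T).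
  move=> fg T0.
  have Sgen t : 0 <= t -> generates ip S (S t f) (S t g).
    by move=> t0; exact: (generates_orbit sip compl sg).
  have incr t e : 0 <= t -> 0 < e -> exists2 d, 0 < d & forall h, 0 < h < d ->
      N (S (t + h) f - (S t f + h *: S t g)) <= h * e.
    move=> t0 e0; have [d d0 dP] := Sgen t t0 e e0; exists d => // h hd.
    have h0 : 0 < h by case/andP: hd.
    have := dP h hd; rewrite -(ler_pM2l h0); apply: le_trans.
    rewrite -[X in _ <= X * N _](ger0_norm (ltW h0)) -(snormZ sip) scalerBr scalerA divff ?gt_eqF//.
    rewrite scale1r (addrC t) (snorm_null_l sip _ (sg_add sg f (ltW h0) t0)).
    by rewrite opprD addrA.
  have bdd (T' : R) : exists2 B, 0 <= B &
      forall t, 0 <= t <= T' -> N (S t f) <= B /\ N (S t g) <= B.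
    have [M M1 MP] := sg_local_bound sip compl sg T'.
    have M0 : 0 <= M by apply: le_trans M1.
    have Nf0 : 0 <= N f := sqrtr_ge0 _. have Ng0 : 0 <= N g := sqrtr_ge0 _.
    exists (M * N f + M * N g); first by rewrite addr_ge0// mulr_ge0.
    move=> t tT; have := MP t tT f; have := MP t tT g.
    have := mulr_ge0 M0 Nf0; have := mulr_ge0 M0 Ng0.
    by move=> *; split; lra.
  have mcont (c T' : R) : `|c| <= 1 -> unif_cont_on (fun t => c * m (S t f)) T'.
    move=> c1 e e0; have e'0 : 0 < e / (Km + 1) by rewrite divr_gt0//; lra.
    have [d d0 dP] := sg_unif_cont sip compl sg T' f e'0.
    exists d => // s t s0 st tT std; rewrite -mulrBr normrM.
    apply: (@le_trans _ _ (1 * (Km * (e / (Km + 1))))).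
      apply: ler_pM => //; apply: (le_trans (bounded_linear_dist bm _ _)).
      by rewrite ler_wpM2l// dP.
    by rewrite mul1r mulrCA ler_piMr ?(ltW e0)// ler_pdivrMr; lra.
  have mstep (c T' : R) : `|c| <= 1 -> 0 <= T' ->
      c * m (S T' f) <= c * m (S 0 f) + 0 * T'.
    move=> c1 T'0; apply: (@right_growth_bound _ (fun t => c * m (S t f))) => //.
      exact: mcont.
    move=> t e /andP[t0 tT] e0.
    have e'0 : 0 < e / (Km + 1) by rewrite divr_gt0//; lra.
    have [d d0 dP] := incr t _ t0 e'0; exists d => // h hd _.
    have h0 : 0 < h by case/andP: hd.
    have := bounded_linear_dist bm (S (t + h) f) (S t f + h *: S t g).
    rewrite (blD bm) (blZ bm) (close _ _ (Sgen t t0)).1 mulr0 addr0 => h1.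
    have h2 : `|c * (m (S (t + h) f) - m (S t f))| <= 1 * (Km * (h * (e / (Km + 1)))).
      rewrite normrM; apply: ler_pM => //; apply: (le_trans h1).
      by rewrite ler_wpM2l// dP.
    have h3 : Km * (h * (e / (Km + 1))) <= h * e.
      rewrite mulrCA ler_pM2l// mulrCA ler_piMr ?(ltW e0)//.
      by rewrite ler_pdivrMr; lra.
    move: h2; rewrite ler_norml => /andP[_]; lra.
  have mconst t : 0 <= t -> m (S t f) = m f.
    move=> t0; have n1 : `|-1 : R| <= 1 by rewrite normrN1.
    have n2 : `|1 : R| <= 1 by rewrite normr1.
    have := mstep (-1) t n1 t0; have := mstep 1 t n2 t0.
    have := bounded_linear_dist bm (S 0 f) f; rewrite (sg_at0 sg) mulr0.
    by rewrite normr_le0 subr_eq0 => /eqP ->; lra.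
  have [B B0 BP] := bdd T.
  set ET := expR (lam * T); have ET0 : 0 < ET := expR_gt0 _.
  have Ele t : t <= T -> expR (lam * t) <= ET.
    by move=> tT; rewrite ler_expR ler_wpM2l.
  have GB t : 0 <= t <= T -> G (S t f) (S t f) <= B ^+ 2.
    move=> tT; apply: (le_trans (Gup _)); rewrite ler_pXn2r ?nnegrE ?sqrtr_ge0//.
    by have [] := BP t tT.
  have G0 u : 0 <= G u u.
    by apply: le_trans (Gpos u); rewrite mulr_ge0// sqr_ge0.
  (* Gronwall: the derivative of [psi] is at most [ET * (C * m f ^+ 2)]. *)
  pose psi t := expR (lam * t) * G (S t f) (S t f).
  have pcont : unif_cont_on psi T.
    move=> e e0; have e2 : 0 < e / 2 by rewrite divr_gt0.
    pose e1 := Num.min 1 (e / 2 / (ET * (B + B + 1))).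
    have k0 : 0 < ET * (B + B + 1) by rewrite mulr_gt0//; lra.
    have e10 : 0 < e1 by rewrite lt_min ltr01 divr_gt0.
    have e11 : e1 <= 1 by rewrite ge_min lexx.
    have e12 : ET * (B + B + 1) * e1 <= e / 2.
      by rewrite mulrC -ler_pdivlMr// ge_min lexx orbT.
    have [d d0 dP] := sg_unif_cont sip compl sg T f e10.
    have k1 : 0 < ET * lam * B ^+ 2 + 1.
      by rewrite ltr_wpDl// !mulr_ge0// ?sqr_ge0// ltW.
    exists (Num.min d (e / 2 / (ET * lam * B ^+ 2 + 1))).
      by rewrite lt_min d0 divr_gt0.
    move=> s t s0 st tT; rewrite lt_min => /andP[std].
    rewrite ltr_pdivlMr// => std2.
    have t0 : 0 <= t by apply: le_trans st.
    have sT : s <= T by apply: le_trans tT.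
    have hs := dP s t s0 st tT std.
    have sI : 0 <= s <= T by rewrite s0.
    have [Bs _] := BP s sI.
    have hG := Gdist (S t f) (S t f) (S s f) (S s f) e1 ler01 hs hs e11.
    have hG' : `|G (S t f) (S t f) - G (S s f) (S s f)| <= (B + B + 1) * e1.
      by apply: (le_trans hG); rewrite mul1r ler_wpM2r ?(ltW e10)//; lra.
    have hE : `|expR (lam * t) - expR (lam * s)| <= ET * lam * (t - s).
      have hst : lam * s <= lam * t by rewrite ler_wpM2l.
      rewrite ger0_norm ?subr_ge0 ?ler_expR//.
      have -> : expR (lam * s) = expR (lam * t) * expR (- (lam * (t - s))).
        by rewrite -expRD; congr expR; ring.
      have := expR_ge1Dx (- (lam * (t - s))).
      have := Ele t tT; have := expR_gt0 (lam * t).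
      have : 0 <= lam * (t - s) by rewrite mulr_ge0// subr_ge0.
      move=> a1 a2 a3 a4; rewrite -[leRHS]mulrA.
      apply: (@le_trans _ _ (expR (lam * t) * (lam * (t - s)))); last by rewrite ler_wpM2r.
      by rewrite -{1}[expR (lam * t)]mulr1 -mulrBr ler_pM2l//; lra.
    have -> : psi t - psi s = expR (lam * t) * (G (S t f) (S t f) - G (S s f) (S s f))
        + (expR (lam * t) - expR (lam * s)) * G (S s f) (S s f).
      by rewrite /psi; ring.
    apply: (le_trans (ler_normD _ _)); rewrite !normrM.
    rewrite (ger0_norm (expR_ge0 _)) (ger0_norm (G0 _)).
    have GBs := GB s sI.
    have h1 : expR (lam * t) * `|G (S t f) (S t f) - G (S s f) (S s f)|
         <= ET * ((B + B + 1) * e1).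
      by apply: ler_pM => //; exact: Ele.
    have h2 : `|expR (lam * t) - expR (lam * s)| * G (S s f) (S s f)
        <= ET * lam * (t - s) * B ^+ 2 by apply: ler_pM.
    have ts0 : 0 <= t - s by rewrite subr_ge0.
    have : ET * lam * (t - s) * B ^+ 2 <= e / 2 by lra.
    by lra.
  have pgrow t e : 0 <= t < T -> 0 < e -> exists2 d, 0 < d &
      forall h, 0 < h < d -> t + h <= T ->
        psi (t + h) <= psi t + (ET * (C * m f ^+ 2) + e) * h.
    move=> /andP[t0 tT] e0.
    pose e2 := e / ET; have e20 : 0 < e2 by rewrite divr_gt0.
    have k0 : 0 < 2 * (4 * B + 1) by rewrite mulr_gt0//; lra.
    pose e1 := Num.min 1 (e2 / (2 * (4 * B + 1))).
    have e10 : 0 < e1 by rewrite lt_min ltr01 divr_gt0.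
    have e11 : e1 <= 1 by rewrite ge_min lexx.
    have e12 : e1 * (2 * (4 * B + 1)) <= e2.
      by rewrite -ler_pdivlMr// ge_min lexx orbT.
    have [d d0 dP] := incr t e1 t0 e10.
    have k1 : 0 < 2 * (B ^+ 2 + 1) by rewrite mulr_gt0// ltr_wpDl// sqr_ge0.
    exists (Num.min d (Num.min 1 (e2 / (2 * (B ^+ 2 + 1))))).
      by rewrite !lt_min d0 ltr01 divr_gt0.
    move=> h /andP[h0]; rewrite !lt_min => /andP[hd /andP[h1]].
    rewrite ltr_pdivlMr// => hB thT.
    have := dP h; rewrite h0 hd => /(_ isT).
    set u := S t f; set w := S t g; set u' := S (t + h) f => hu.
    have tT' : 0 <= t <= T by rewrite t0 ltW.
    have [Bu Bw] := BP t tT'; rewrite -/u -/w in Bu Bw.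
    have he : h * e1 <= 1 by rewrite mulr_ile1// ltW.
    have hG := Gdist u' u' (u + h *: w) (u + h *: w) (h * e1) ler01 hu hu he.
    have nuw : N (u + h *: w) <= B + B.
      apply: (le_trans (snormD sip _ _)); apply: lerD => //.
      rewrite (snormZ sip) gtr0_norm//; apply: le_trans Bw.
      by rewrite ler_piMl ?sqrtr_ge0// ltW.
    have hG' : G u' u' <= G (u + h *: w) (u + h *: w) + (4 * B + 1) * (h * e1).
      move: hG; rewrite ler_norml mul1r => /andP[_ hG].
      have : (N (u + h *: w) + N (u + h *: w) + 1) * (h * e1) <= (4 * B + 1) * (h * e1).
        by rewrite ler_wpM2r ?mulr_ge0 ?(ltW h0) ?(ltW e10)//; lra.
      by lra.
    have expand : G (u + h *: w) (u + h *: w) =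
        G u u + h * (G w u + G u w) + h * (h * G w w).
      by rewrite !(bbDl bG, bbDr bG, bbZl bG, bbZr bG); ring.
    have [_ hdis] := close _ _ (Sgen t t0); rewrite -/u -/w (mconst t t0) in hdis.
    have hw : G w w <= B ^+ 2.
      by apply: (le_trans (Gup _)); rewrite ler_pXn2r ?nnegrE ?sqrtr_ge0.
    have hdis2 : h * (G w u + G u w) <= h * (- lam * G u u + C * m f ^+ 2).
      rewrite ler_pM2l//; apply: (le_trans hdis); rewrite lerD2r !mulNr lerN2.
      by rewrite ler_wpM2l.
    have hww : h * (h * G w w) <= h * (e2 / 2).
      rewrite ler_pM2l//; apply: (@le_trans _ _ (h * B ^+ 2)).
        by rewrite ler_pM2l.
      by lra.
    have he1 : (4 * B + 1) * (h * e1) <= h * (e2 / 2).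
      by rewrite mulrCA ler_pM2l//; lra.
    have bound : G u' u' <= (1 - lam * h) * G u u + h * (C * m f ^+ 2 + e2) by lra.
    rewrite /psi -/u -/u' mulrDr expRD.
    have E1 : expR (lam * h) * (1 - lam * h) <= 1.
      have := expR_ge1Dx (- (lam * h)); rewrite expRN.
      by rewrite -[X in _ <= X -> _]mul1r ler_pdivlMr ?expR_gt0// mulrC; apply.
    have E2 : expR (lam * t) * expR (lam * h) <= ET.
      by rewrite -expRD -mulrDr Ele.
    have Et0 := expR_gt0 (lam * t); have Eh0 := expR_gt0 (lam * h).
    apply: (@le_trans _ _ (expR (lam * t) * expR (lam * h) *
       ((1 - lam * h) * G u u + h * (C * m f ^+ 2 + e2)))).
      by rewrite ler_pM2l// mulr_gt0.
    rewrite mulrDr; apply: lerD.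
      rewrite -mulrA ler_pM2l// mulrA ler_piMl//.
    have -> : (ET * (C * m f ^+ 2) + e) * h = ET * (h * (C * m f ^+ 2 + e2)).
      by rewrite /e2; field; rewrite gt_eqF.
    rewrite ler_wpM2r// mulr_ge0 ?(ltW h0)// addr_ge0 ?(ltW e20)//.
    by rewrite mulr_ge0// sqr_ge0.
  have := right_growth_bound T0 pcont pgrow.
  rewrite /psi mulr0 expR0 mul1r -/ET => fin.
  have f0 := snorm_null sip (sg_at0 sg f).
  have fin2 : ET * G (S T f) (S T f) <= N f ^+ 2 + ET * (C * m f ^+ 2) * T.
    by apply: (le_trans fin); rewrite lerD2r -f0.
  have fin3 : G (S T f) (S T f) <= expR (- lam * T) * N f ^+ 2 + C * m f ^+ 2 * T.
    rewrite -(ler_pM2l ET0); apply: (le_trans fin2).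
    have ee : ET * expR (- lam * T) = 1 by rewrite /ET -expRD mulNr subrr expR0.
    rewrite [leRHS](_ : _ = ET * expR (- lam * T) * N f ^+ 2 + ET * (C * m f ^+ 2) * T).
      by rewrite ee mul1r.
    by ring.
  by have := Gpos (S T f); lra.
move=> f t t0 mf0.
apply/ler_addgt0Pr => e e0.
have [M bM] := sg_bounded sg t0.
set E := expR (- (lam / 2) * t); have E0 : 0 < E := expR_gt0 _.
pose K := 2 * E + 2 * (Num.sqrt (C * t) * Km) + `|M| + 1.
have q0 : 0 <= Num.sqrt (C * t) * Km by rewrite mulr_ge0 ?sqrtr_ge0.
have K0 : 0 < K by have := normr_ge0 M; rewrite /K; lra.
have d0 : 0 < e / K by rewrite divr_gt0.
set d := e / K in d0; have dK : d * K = e by rewrite /d divfK ?gt_eqF.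
(* [K * d = e] bounds the error made by replacing [f] by [l]. *)
have [l [g [lf lg]]] := domain_dense sip compl sg f d0.
have hl := decay l g t lg t0.
have Nf0 : 0 <= N f := sqrtr_ge0 _. have Nl0 : 0 <= N l := sqrtr_ge0 _.
have Nl : N l <= N f + d.
  by apply: (le_trans (snorm_le_dist sip l f)); rewrite lerD2l.
have ml : `|m l| <= Km * d.
  have := bounded_linear_dist bm l f; rewrite mf0 subr0 => /le_trans; apply.
  by rewrite ler_wpM2l.
have EE : expR (- lam * t) = E ^+ 2.
  by rewrite /E -expRM_natl; congr expR; field.
have ml2 : m l ^+ 2 <= (Km * d) ^+ 2.
  rewrite -real_normK ?num_real// ler_pXn2r ?nnegrE//.
  by rewrite mulr_ge0// ltW.
have St : N (S t l) <= 2 * (E * (N f + d) + Num.sqrt (C * t) * Km * d).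
  rewrite -(@ler_pXn2r _ 2)// ?nnegrE ?sqrtr_ge0//; last first.
    by rewrite mulr_ge0// addr_ge0// mulr_ge0// ?addr_ge0// ltW.
  apply: (le_trans hl); rewrite EE exprMn.
  have e1 : E ^+ 2 * N l ^+ 2 <= (E * (N f + d)) ^+ 2.
    by rewrite exprMn ler_wpM2l ?sqr_ge0// ler_pXn2r ?nnegrE// addr_ge0// ltW.
  have e2 : C * m l ^+ 2 * t <= (Num.sqrt (C * t) * Km * d) ^+ 2.
    by rewrite -[in leRHS]mulrA exprMn sqr_sqrtr ?mulr_ge0// mulrAC ler_wpM2l ?mulr_ge0.
  have e3 : 0 <= E * (N f + d) by rewrite mulr_ge0// ?addr_ge0// ltW.
  have e4 : 0 <= Num.sqrt (C * t) * Km * d by rewrite mulr_ge0// ltW.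
  have := mulr_ge0 e3 e4.
  move: e1 e2; set a := E * (N f + d); set b := _ * Km * d.
  by rewrite (sqrrD a b) => e1 e2 e5; lra.
apply: (le_trans (snorm_le_dist sip _ (S t l))).
have hM : N (S t f - S t l) <= `|M| * d.
  apply: (le_trans (op_bound_dist sip (sg_lin sg t0) bM _ _)).
  apply: (@le_trans _ _ (`|M| * N (f - l))).
    by rewrite ler_wpM2r ?sqrtr_ge0// ler_norm.
  by rewrite ler_wpM2l// (snormBC sip).
rewrite -dK /K; lra.
Qed.
End lyapunov.

Section perturbed_energy.
Context {R : realType} {V : lmodType R} {ip : V -> V -> R} (sip : semi_inner ip).
Context {b : V -> V -> R} {C eps : R}.
Hypotheses (bb : bounded_bilinear ip b C) (eps0 : 0 <= eps) (epsC : eps * C <= 4^-1).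
Local Notation N := (snorm ip).

(** The smallness of [eps] keeps this form between one quarter of the squared norm
and the squared norm. *)
Definition modified_energy (u w : V) : R := 2^-1 * ip u w + eps * b u w.

Let small u w : eps * `|b u w| <= 4^-1 * (N u * N w).
Proof.
apply: (@le_trans _ _ (eps * (C * (N u * N w)))); first by rewrite ler_wpM2l// (bb_le bb).
by rewrite mulrA ler_wpM2r// mulr_ge0// sqrtr_ge0.
Qed.

Lemma modified_energy_bounded : bounded_bilinear ip modified_energy 1.
Proof.
split; rewrite /modified_energy.
- by move=> u v w; rewrite (sipDl sip) (bbDl bb); ring.
- by move=> a u w; rewrite (sipZl sip) (bbZl bb); ring.
- by move=> u v w; rewrite (sipDr sip) (bbDr bb); ring.
- by move=> a u w; rewrite (sipZr sip) (bbZr bb); ring.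
move=> u w; have h1 := cauchy_schwarz sip u w; have h2 := small u w.
have n0 : 0 <= N u * N w by rewrite mulr_ge0 ?sqrtr_ge0.
apply: (le_trans (ler_normD _ _)); rewrite !normrM (ger0_norm eps0) ger0_norm//.
by lra.
Qed.

Lemma modified_energy_ge u : 4^-1 * N u ^+ 2 <= modified_energy u u.
Proof.
have h := small u u; have h' : - (eps * `|b u u|) <= eps * b u u.
  by rewrite -mulrN ler_wpM2l// lerNl -normrN ler_norm.
by move: h; rewrite /modified_energy -(snorm_sqr sip) -expr2; lra.
Qed.

Lemma modified_energy_coercive u w (d loss V0 m : R) : ip w u = d -> 0 <= d ->
    eps * loss <= 1 ->
    2^-1 * V0 * ip u u - 2^-1 * m ^+ 2 - loss * d <= b w u + b u w ->
  2^-1 * eps * V0 * N u ^+ 2 - 2^-1 * eps * m ^+ 2 <=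
    modified_energy w u + modified_energy u w.
Proof.
move=> wu d0 el h; rewrite /modified_energy (sipC sip u w) wu (snorm_sqr sip).
have h1 := ler_wpM2l eps0 h.
have h2 : eps * loss * d <= 1 * d by rewrite ler_wpM2r.
by lra.
Qed.

End perturbed_energy.

(** * Square-integrable functions *)

Section L2_inner.
Context d {T : measurableType d} {R : realType} (mu : {measure set T -> \bar R}).
Local Notation L2T := (LfunType mu (@le1_2 R)).
Implicit Types f g h : L2T.

Definition ip2 f g : R := \int[mu]_x (f x * g x).

Lemma L2_measurable f : measurable_fun setT (f : T -> R).
Proof. by have := LfunP f; rewrite inE => /andP[/[!inE]]. Qed.

Lemma L2_mul_integrable f g : mu.-integrable setT (fun x => (f x * g x)%:E).
Proof. by apply/Lfun1_integrable; exact: Lfun2_mul_Lfun1 (LfunP f) (LfunP g). Qed.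

Lemma semi_inner_ip2 : semi_inner ip2.
Proof.
split.
- by move=> u w; apply: eq_Rintegral => x _; rewrite mulrC.
- move=> u v w; rewrite /ip2 -RintegralD//; try exact: L2_mul_integrable.
  by apply: eq_Rintegral => x _; rewrite /= mulrDl.
- move=> a u w; rewrite /ip2 -RintegralZl//; last exact: L2_mul_integrable.
  by apply: eq_Rintegral => x _; rewrite /= mulrA.
- by move=> u; apply: Rintegral_ge0 => x _; rewrite -expr2 sqr_ge0.
Qed.

Lemma ip2E f g : ((ip2 f g)%:E = \int[mu]_x (f x * g x)%:E)%E.
Proof. by rewrite /ip2 fineK//; apply: integrable_fin_num => //; exact: L2_mul_integrable. Qed.

(** This links the library norm, an extended real, to the semi-definite product. *)
Lemma Lnorm2E f : ('N[mu]_(2%:E)[EFin \o f] = (snorm ip2 f)%:E)%E.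
Proof.
have h : ('N[mu]_(2%:E)[EFin \o f] `^ 2 = (ip2 f f)%:E)%E.
  rewrite powR_Lnorm ?pnatr_eq0// ip2E; apply: eq_integral => x _.
  by rewrite /= powR_mulrn ?normr_ge0// real_normK ?num_real// expr2.
have := Lnorm_ge0 mu (2%:E) (EFin \o f).
have : finite_norm mu 2%:E f by have := LfunP f; rewrite inE => /andP[_ /[!inE]].
rewrite /finite_norm.
move: h; case: ('N[mu]_(2%:E)[EFin \o f])%E => [r||]//= + _.
move=> -[h]; rewrite lee_fin => r0.
by rewrite /snorm -h powR_mulrn// sqrtr_sqr ger0_norm.
Qed.

Lemma eq_ae_ip2 f f' g : f = f' %[ae mu] -> ip2 f g = ip2 f' g.
Proof.
move=> ff'; rewrite /ip2 /Rintegral; congr fine; apply: ae_eq_integral => //.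
- exact: measurable_int (L2_mul_integrable f g).
- exact: measurable_int (L2_mul_integrable f' g).
- by apply: filterS ff' => x h _; rewrite h.
Qed.

Lemma eq_ae_snorm f g : f = g %[ae mu] -> snorm ip2 (f - g) = 0.
Proof.
move=> fg; rewrite /snorm (@eq_ae_ip2 _ 0); last first.
  by apply: filterS fg => x h _; rewrite [LHS](_ : _ = f x - g x)// h// subrr.
by rewrite (sip0l semi_inner_ip2) sqrtr0.
Qed.

End L2_inner.

Section L2_complete.
Context d {T : measurableType d} {R : realType} (mu : {measure set T -> \bar R}).
Hypothesis muT : (mu [set: T] < +oo)%E.
Local Notation L2T := (LfunType mu (@le1_2 R)).
Local Notation N := (snorm (@ip2 _ _ _ mu)).

Lemma Lfun2P (f : T -> R) : measurable_fun setT f ->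
  (\int[mu]_x (f x ^+ 2)%:E < +oo)%E -> f \in Lfun mu 2%:E.
Proof.
move=> mf fin; rewrite inE; apply/andP; split; rewrite inE//=.
rewrite /finite_norm unlock; apply: poweR_lty.
rewrite (eq_integral (fun x => (f x ^+ 2)%:E))// => x _ /=.
by rewrite powR_mulrn ?normr_ge0// real_normK ?num_real.
Qed.

Lemma ip2_sqr (f : L2T) : (\int[mu]_x (f x ^+ 2)%:E = (N f ^+ 2)%:E)%E.
Proof.
rewrite (snorm_sqr (semi_inner_ip2 mu)) ip2E.
by apply: eq_integral => x _; rewrite expr2.
Qed.

(** A sequence of bounded variation converges. *)
Lemma cvg_abs_increments (u : R^nat) (B : R) :
  (forall n, \sum_(0 <= k < n) `|u k.+1 - u k| <= B) -> cvgn u.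
Proof.
move=> bd; have h : cvgn (series (telescope u)).
  apply: normed_cvg; apply: nondecreasing_is_cvgn.
    by apply: nondecreasing_series => n _ _; exact: normr_ge0.
  by exists B => _ [n _ <-]; rewrite /= /series/= bd.
rewrite (_ : u = cst (u 0%N) + series (telescope u)).
  by apply: is_cvgD => //; exact: is_cvg_cst.
by apply/funext => n; rewrite [LHS]eq_sum_telescope.
Qed.

Lemma limn_einf_le (a : (\bar R)^nat) (c : \bar R) :
  (forall n, a n <= c)%E -> (limn_einf a <= c)%E.
Proof.
move=> ac; rewrite limn_einf_lim; apply: lime_le; first exact: is_cvg_einfs.
apply: nearW => n; apply: le_trans (ac n); apply: ereal_inf_lbound.
by exists n => //=.
Qed.

(** $2|h|\le c\,h^2+c^{-1}$; with $c$ the inverse of the expected norm, the bound is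
of the order of that norm. *)
Lemma L2_abs_integral (h : L2T) (c : R) : 0 < c ->
  (\int[mu]_x (`|h x|)%:E <= ((c * N h ^+ 2 + c^-1 * fine (mu setT)) / 2)%:E)%E.
Proof.
move=> c0; have mh : measurable_fun setT (h : T -> R) by exact: L2_measurable.
have mh2 : measurable_fun setT (fun x => (h x ^+ 2)%:E).
  by apply/measurable_EFinP; exact: measurable_funX.
have muE : mu setT = (fine (mu setT))%:E by rewrite fineK// ge0_fin_numE.
apply: (@le_trans _ _ (\int[mu]_x ((c / 2)%:E * (h x ^+ 2)%:E + (c^-1 / 2)%:E))%E).
  apply: ge0_le_integral => //.
  - by apply/measurable_EFinP; exact: measurableT_comp.
  - by apply: emeasurable_funD => //; exact: measurable_funeM.
  move=> x _; rewrite -EFinM -EFinD lee_fin.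
  rewrite -(real_normK (num_real (h x))); set y := `|h x|.
  have : 0 <= c^-1 * (c * y - 1) ^+ 2 by rewrite mulr_ge0 ?sqr_ge0// invr_ge0 ltW.
  have -> : c^-1 * (c * y - 1) ^+ 2 = c * y ^+ 2 - 2 * y + c^-1.
    by field; rewrite gt_eqF.
  by lra.
rewrite ge0_integralD//; last 3 first.
- by move=> x _; rewrite -EFinM lee_fin mulr_ge0 ?sqr_ge0// divr_ge0// ltW.
- exact: measurable_funeM.
- by move=> x _; rewrite lee_fin divr_ge0// invr_ge0 ltW.
rewrite ge0_integralZl//; last 2 first.
- by move=> x _; rewrite lee_fin sqr_ge0.
- by rewrite lee_fin divr_ge0// ltW.
rewrite ip2_sqr integral_cst// muE -!EFinM -EFinD lee_fin; lra.
Qed.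

(** The increments are summable at almost every point because the sum of their
absolute values is integrable, and Fatou's lemma controls the distance to the
pointwise limit. *)
Lemma L2_fast_complete (u : nat -> L2T) :
    (forall n, N (u n.+1 - u n) <= (2 ^+ n)^-1) ->
  exists l, forall n, N (u n - l) <= 2 * (2 ^+ n)^-1.
Proof.
move=> fast.
have sip := semi_inner_ip2 mu.
pose w n : R := (2 ^+ n)^-1.
have w0 n : 0 < w n by rewrite invr_gt0 exprn_gt0.
have wS n : w n = 2 * w n.+1 by rewrite /w exprS invfM mulrA divff// mul1r.
pose g x := (\sum_(0 <= n <oo) (`|u n.+1 x - u n x|)%:E)%E.
have mu_ n : measurable_fun setT (u n : T -> R) by exact: L2_measurable.
have md n : measurable_fun setT (fun x => (`|u n.+1 x - u n x|)%:E).
  apply/measurable_EFinP; apply: measurableT_comp => //.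
  exact: measurable_funB.
have mg : measurable_fun setT g.
  by apply: ge0_emeasurable_sum => // n x _ _; rewrite lee_fin.
have g0 x : (0 <= g x)%E by apply: nneseries_ge0 => n _ _; rewrite lee_fin.
set W := fine (mu setT); have W0 : 0 <= W by rewrite fine_ge0.
have g_int : mu.-integrable setT g.
  apply/integrableP; split => //.
  rewrite (eq_integral g); last by move=> x _; rewrite gee0_abs.
  rewrite integral_nneseries//.
  apply: (@le_lt_trans _ _ (1 + W)%:E); last exact: ltry.
  apply: lime_le; first by apply: is_cvg_nneseries => n _ _; exact: integral_ge0.
  apply: nearW => n.
  apply: (@le_trans _ _ (\sum_(0 <= k < n) (w k * ((1 + W) / 2))%:E)%E).
    apply: lee_sum => k _.
    have wk0 : 0 < (w k)^-1 by rewrite invr_gt0.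
    apply: (le_trans (L2_abs_integral (u k.+1 - u k) wk0)).
    rewrite lee_fin invrK -/W.
    have : N (u k.+1 - u k) ^+ 2 <= w k ^+ 2.
      by rewrite ler_pXn2r ?nnegrE ?sqrtr_ge0 ?(ltW (w0 k)).
    rewrite -(ler_pM2l wk0) (_ : (w k)^-1 * w k ^+ 2 = w k); last first.
      by rewrite expr2 mulrA mulVf ?mul1r// gt_eqF.
    by lra.
  rewrite sumEFin lee_fin -mulr_suml.
  have sw : \sum_(0 <= k < n) w k = 2 * (1 - w n).
    elim: n => [|n IH]; first by rewrite big_geq// /w expr0 invr1 subrr mulr0.
    by rewrite big_nat_recr//= IH; have := wS n; lra.
  by rewrite sw; have := w0 n; nra.
have cv_ae : {ae mu, forall x, cvgn (fun n => u n x)}.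
  have := integrable_ae measurableT g_int; apply: filterS => x /(_ I) gx.
  apply: (@cvg_abs_increments _ (fine (g x))) => n.
  rewrite -lee_fin fineK// -sumEFin.
  by apply: nneseries_lim_ge => k _ _; rewrite lee_fin.
pose l x := fine (limn_esup (fun n => (u n x)%:E)).
have ml : measurable_fun setT l.
  apply: (measurableT_comp (fine_measurable _)) => //.
  by apply: measurable_fun_limn_esup => n; apply/measurable_EFinP.
have l_ae : {ae mu, forall x, (fun n => u n x) @ \oo --> l x}.
  apply: filterS cv_ae => x cx; rewrite /l.
  have /cvg_ex[y cy] := cx.
  have cy' : (fun n => (u n x)%:E) @ \oo --> y%:E.
    by apply: cvg_EFin => //; exact: nearW.
  rewrite is_cvg_limn_esupE; last by apply/cvg_ex; exists y%:E.
  by rewrite (cvg_lim _ cy').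
have dist n m : N (u (n + m)%N - u n) <= 2 * (w n - w (n + m)%N).
  elim: m => [|m IH]; first by rewrite addn0 !subrr (snorm0 sip) mulr0.
  apply: (le_trans (snorm_trans sip (u (n + m)%N) _ _)).
  by rewrite addnS; have := fast (n + m)%N; have := wS (n + m)%N; rewrite -/(w _); lra.
have key n : (\int[mu]_x ((u n x - l x) ^+ 2)%:E <= ((2 * w n) ^+ 2)%:E)%E.
  have mf m : measurable_fun setT (fun x => ((u n x - u (n + m)%N x) ^+ 2)%:E).
    by apply/measurable_EFinP; apply: measurable_funX; exact: measurable_funB.
  have mf0 m x : [set: T] x -> (0 <= ((u n x - u (n + m)%N x) ^+ 2)%:E)%E.
    by move=> _; rewrite lee_fin sqr_ge0.
  have := fatou mu measurableT mf mf0.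
  rewrite (ae_eq_integral (fun x => ((u n x - l x) ^+ 2)%:E))//; last 3 first.
  - rewrite (_ : (fun _ => _) = fun x =>
        (- limn_esup (fun m => - ((u n x - u (n + m)%N x) ^+ 2)%:E))%E).
      apply: measurableT_comp => //; apply: measurable_fun_limn_esup => m.
      by apply: measurableT_comp => //; exact: mf.
    apply/funext => x; rewrite -limn_einfN; congr limn_einf.
    by apply/funext => m; rewrite /= opprK.
  - by apply/measurable_EFinP; apply: measurable_funX; exact: measurable_funB.
  - apply: filterS l_ae => x ux _.
    have cx : (fun m => ((u n x - u (n + m)%N x) ^+ 2)%:E) @ \oo -->
        ((u n x - l x) ^+ 2)%:E.
      apply: cvg_EFin; first exact: nearW.
      have ux' : (fun m => u (n + m)%N x) @ \oo --> l x.
        rewrite (_ : (fun m => _) = [sequence (u ^~ x) (m + n)%N]_m).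
          by move: ux; rewrite -(cvg_shiftn n).
        by apply/funext => m; rewrite addnC.
      have uB : (fun m => u n x - u (n + m)%N x) @ \oo --> u n x - l x.
        by apply: cvgB => //; exact: cvg_cst.
      rewrite expr2 (_ : fine \o _ = (fun m => u n x - u (n + m)%N x) \*
        (fun m => u n x - u (n + m)%N x)); first exact: cvgM.
      by apply/funext => m; rewrite /= expr2.
    by rewrite is_cvg_limn_einfE; [exact/cvg_lim|apply/cvg_ex; exists ((u n x - l x) ^+ 2)%:E].
  move=> /le_trans; apply; apply: limn_einf_le => m.
  have := ip2_sqr (u n - u (n + m)%N).
  rewrite (eq_integral (fun x => ((u n x - u (n + m)%N x) ^+ 2)%:E))// => ->.
  rewrite lee_fin ler_pXn2r ?nnegrE ?sqrtr_ge0//; last by rewrite mulr_ge0 ?(ltW (w0 n)).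
  by rewrite (snormBC sip) (le_trans (dist n m))//; have := w0 (n + m)%N; lra.
have l2 : l \in Lfun mu 2%:E.
  rewrite (_ : l = (u 0%N : T -> R) - (fun x => u 0%N x - l x)); last first.
    by apply/funext => x; rewrite [RHS](_ : _ = u 0%N x - (u 0%N x - l x))// subKr.
  apply: rpredB => [|?|?]; [exact: le1_2|exact: LfunP|].
  apply: Lfun2P; first exact: measurable_funB.
  by apply: le_lt_trans (key 0%N) _; rewrite ltry.
exists (Lfun_Sub (@le1_2 R) l2) => n.
apply: (snorm_le sip); first by rewrite mulr_ge0 ?(ltW (w0 n)).
by rewrite -lee_fin -(snorm_sqr sip) -ip2_sqr; exact: key.
Qed.

(** A Cauchy sequence has a subsequence whose increments decay geometrically. *)
Lemma L2_cauchy_complete : cauchy_complete (@ip2 _ _ _ mu).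
Proof.
move=> u cau; have sip := semi_inner_ip2 mu.
have pick (k : nat) : exists n0, forall n m, (n0 <= n)%N -> (n0 <= m)%N ->
    N (u n - u m) <= (2 ^+ k)^-1.
  by apply: cau; rewrite invr_gt0 exprn_gt0.
have [p pP] := choice pick.
pose q := fix q k := if k is k'.+1 then maxn (q k') (p k) else p 0%N.
have qp k : (p k <= q k)%N by case: k => //= k; exact: leq_maxr.
have qS k : (q k <= q k.+1)%N by exact: leq_maxl.
have [l lP] := @L2_fast_complete (fun k => u (q k)) (fun k =>
  pP k (q k.+1) (q k) (leq_trans (qp k) (qS k)) (qp k)).
exists l => e e0; have [k kP] := nat_above (3 / e).
have k0 : 0 < k%:R :> R by apply: lt_trans kP; rewrite divr_gt0.
have w_le : 3 * (2 ^+ k)^-1 <= e.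
  have : k%:R <= 2 ^+ k :> R by rewrite -natrX ler_nat; exact/ltnW/ltn_expl.
  move: kP; rewrite ltr_pdivrMr// => h1 h2.
  by rewrite ler_pdivrMr ?exprn_gt0//; nra.
exists (p k) => n pn; apply: (le_trans (snorm_trans sip (u (q k)) _ _)).
by have := pP k n (q k) pn (qp k); have := lP k; lra.
Qed.

End L2_complete.

(** * Product structure of the measures *)

Section cube_measure.
Context {R : realType} (m : {finite_measure set (measurableTypeR R) -> \bar R}).
Local Notation MR := (measurableTypeR R).

Definition square_measure : set (MR * MR)%type -> \bar R := (m \x m)%E.

HB.instance Definition _ := Measure.on square_measure.

Lemma square_measure_fin : fin_num_fun square_measure.
Proof.
apply: lty_fin_num_fun; rewrite /= /square_measure -setXTT product_measure1E//.
by rewrite lte_mul_pinfty// ?fin_num_fun_lty//; exact: fin_num_measure.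
Qed.

HB.instance Definition _ :=
  Measure_isFinite.Build _ _ _ square_measure square_measure_fin.

Definition cube_measure : set (R3 R) -> \bar R := (square_measure \x m)%E.

HB.instance Definition _ := Measure.on cube_measure.

Lemma cube_measure_fin : fin_num_fun cube_measure.
Proof.
apply: lty_fin_num_fun; rewrite /= /cube_measure -setXTT product_measure1E//.
by rewrite lte_mul_pinfty// ?fin_num_fun_lty//; exact: fin_num_measure.
Qed.

HB.instance Definition _ :=
  Measure_isFinite.Build _ _ _ cube_measure cube_measure_fin.

End cube_measure.

Section circle_measure.
Context {R : realType}.

Definition circle_measure : set (measurableTypeR R) -> \bar R :=
  mrestr (@lebesgue_measure R) (measurable_itv `[0, 2 * pi]).

HB.instance Definition _ := Measure.on circle_measure.

Lemma circle_measureT : circle_measure setT = (2 * pi)%:E.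
Proof.
rewrite /circle_measure /mrestr setTI /= lebesgue_measure_itv/= lte_fin.
by rewrite mulr_gt0 ?pi_gt0// -EFinB subr0.
Qed.

Lemma circle_measure_fin : fin_num_fun circle_measure.
Proof. by apply: lty_fin_num_fun; rewrite /= circle_measureT ltry. Qed.

HB.instance Definition _ :=
  Measure_isFinite.Build _ _ _ circle_measure circle_measure_fin.

(** The restriction to the cell of the product of Lebesgue measures is the product
of the restrictions, which are finite: iterated integrals become available. *)
Lemma torus_measureE (A : set (R3 R)) : measurable A ->
  torus_measure A = cube_measure circle_measure A.
Proof.
have mI : measurable (`[0, 2 * pi]%classic : set (measurableTypeR R)) by [].
have mII : measurable ((`[0, 2 * pi]%classic `*` `[0, 2 * pi]%classic)
  : set (measurableTypeR R * measurableTypeR R)) by exact: measurableX.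
move=> mA; apply/esym; apply: product_measure_unique => // B C mB mC.
rewrite /= /torus_measure /mrestr /torus_cell -setXI /lebesgue3.
rewrite product_measure1E//; [|exact: measurableI|exact: measurableI].
congr (_ * _)%E.
apply/esym; rewrite /square_measure.
rewrite (product_measure_unique (m' := mrestr (@lebesgue2 R) mII))// => D E mD mE.
rewrite /= /mrestr -setXI /lebesgue2 product_measure1E//; exact: measurableI.
Qed.

Lemma torus_measure_fin : fin_num_fun (@torus_measure R).
Proof.
by move=> A mA; rewrite torus_measureE//; exact: fin_num_measure.
Qed.

HB.instance Definition _ :=
  Measure_isFinite.Build _ _ _ (@torus_measure R) torus_measure_fin.

End circle_measure.

Section normal_integral.
Context {R : realType}.
Local Notation gam := (@normal_prob R 0 1).
Local Notation pdf := (@normal_pdf R 0 1).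

(** The normal law is given as a measure; its Radon-Nikodym derivative agrees almost
everywhere with the density that defines it. *)
Lemma ge0_integral_normal (f : measurableTypeR R -> \bar R) :
  measurable_fun setT f -> (forall x, 0 <= f x)%E ->
  (\int[gam]_x f x = \int[lebesgue_measure]_x (f x * (pdf x)%:E))%E.
Proof.
move=> mf f0; have dom := @normal_prob_dominates R 0 1.
rewrite -(Radon_Nikodym_SigmaFinite.change_of_variables dom)//.
have mpdf : measurable_fun setT (EFin \o pdf).
  by apply/measurable_EFinP; exact: measurable_normal_pdf.
have mrn := Radon_Nikodym_SigmaFinite.f_integrable dom.
have mrn' := measurable_int _ mrn.
apply: ae_eq_integral => //.
- exact: emeasurable_funM.
- exact: emeasurable_funM.
- apply: ae_eqe_mul2l; apply: integral_ae_eq => //.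
  by move=> A _ mA; rewrite -Radon_Nikodym_SigmaFinite.f_integral.
Qed.

Lemma integral_normal (f : measurableTypeR R -> R) : measurable_fun setT f ->
  (\int[gam]_x (f x)%:E = \int[lebesgue_measure]_x ((f x * pdf x)%:E))%E.
Proof.
move=> mf; have mf' : measurable_fun setT (EFin \o f) by exact/measurable_EFinP.
rewrite integralE [RHS]integralE.
rewrite !ge0_integral_normal//; [|exact: measurable_funeneg|exact: measurable_funepos].
congr (_ - _)%E; apply: eq_integral => x _.
  have p0 : 0 <= pdf x := normal_pdf_ge0 _ _ _.
  by rewrite !funeposE -!EFin_max -EFinM maxr_pMl// mul0r.
have p0 : 0 <= pdf x := normal_pdf_ge0 _ _ _.
by rewrite !funenegE -!EFinN -!EFin_max -EFinM maxr_pMl// mul0r mulNr.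
Qed.

End normal_integral.

Section gaussian_cube.
Context {R : realType}.
Local Notation MR := (measurableTypeR R).
Local Notation gam := (@normal_prob R 0 1).
Local Notation pdf := (@normal_pdf R 0 1).
Local Notation leb := (@lebesgue_measure R).

Lemma normal_probE (A : set MR) : measurable A ->
  (gam A = \int[leb]_x ((\1_A x * pdf x)%:E))%E.
Proof.
move=> mA; rewrite /normal_prob [LHS]integral_mkcond; apply: eq_integral => x _.
by rewrite patchE indicE; case: (x \in A); rewrite ?mul1r ?mul0r.
Qed.

Let pdf0 (x : R) : 0 <= pdf x := normal_pdf_ge0 0 1 x.
Let mpdf : measurable_fun setT (pdf : MR -> R).
Proof. exact: measurable_normal_pdf. Qed.

Lemma integral_prodM d1 d2 (T1 : measurableType d1) (T2 : measurableType d2)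
    (m1 : {sigma_finite_measure set T1 -> \bar R})
    (m2 : {sigma_finite_measure set T2 -> \bar R}) (f : T1 -> R) (g : T2 -> R) :
  measurable_fun setT f -> measurable_fun setT g ->
  (forall x, 0 <= f x) -> (forall x, 0 <= g x) ->
  (\int[m1 \x m2]_p (f p.1 * g p.2)%:E =
   (\int[m1]_x (f x)%:E) * \int[m2]_x (g x)%:E)%E.
Proof.
move=> mf mg f0 g0; rewrite fubini_tonelli1/=; last 2 first.
- apply/measurable_EFinP; apply: measurable_funM.
    by apply: (measurableT_comp mf); exact: measurable_fst.
  by apply: (measurableT_comp mg); exact: measurable_snd.
- by move=> x; rewrite lee_fin mulr_ge0.
rewrite /fubini_F/=.
have mgE : measurable_fun setT (EFin \o g) by exact/measurable_EFinP.
have mfE : measurable_fun setT (EFin \o f) by exact/measurable_EFinP.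
under eq_integral => x _.
  under eq_integral do rewrite EFinM.
  rewrite ge0_integralZl//; [|by move=> y _; rewrite lee_fin|by rewrite lee_fin].
  over.
rewrite ge0_integralZr//; first by move=> x _; rewrite lee_fin.
by apply: integral_ge0 => x _; rewrite lee_fin.
Qed.

Let pdf2 (p : MR * MR) : R := pdf p.1 * pdf p.2.

Let mpdf2 : measurable_fun setT pdf2.
Proof.
by apply: measurable_funM; apply: (measurableT_comp mpdf);
  [exact: measurable_fst|exact: measurable_snd].
Qed.

Let gaussian_rect (A : set (MR * MR)) (B : set MR) :
  measurable A -> measurable B ->
  (gaussian (A `*` B) = (\int[lebesgue2]_p ((\1_A p * pdf2 p)%:E)) * gam B)%E.
Proof.
move=> mA mB; rewrite normal_probE// -integral_prodM//; last 4 first.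
- by apply: measurable_funM => //; exact: measurable_indic.
- by apply: measurable_funM => //; exact: measurable_indic.
- by move=> x; rewrite !mulr_ge0.
- by move=> x; rewrite mulr_ge0.
rewrite /gaussian [LHS]integral_mkcond; apply: eq_integral => -[x y] _.
rewrite patchE maxwellianE !indicE in_setX/= /pdf2.
by case: (x \in A) => /=; case: (y \in B); rewrite /= ?mul1r ?mul0r ?mulr0.
Qed.

(** The density of the Gaussian measure is a product, so the two measures agree on
rectangles. *)
Lemma gaussianE (A : set (R3 R)) : measurable A ->
  gaussian A = cube_measure gam A.
Proof.
move=> mA; apply/esym; apply: product_measure_unique => // B C mB mC.
rewrite [LHS](gaussian_rect mB mC); congr (_ * _)%E.
pose m2 := pushforward (@gaussian R) (fst : R3 R -> MR * MR).
have m2E D : m2 D = gaussian (D `*` setT).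
  by congr gaussian; apply/seteqP; split => -[x y]/=; [|case].
have -> : (\int[lebesgue2]_p (\1_B p * pdf2 p)%:E)%E = m2 B.
  by rewrite m2E (gaussian_rect mB measurableT) probability_setT mule1.
apply/esym; apply: product_measure_unique => // D E mD mE.
rewrite [LHS]m2E (gaussian_rect (measurableX mD mE) measurableT).
rewrite probability_setT mule1.
transitivity ((\int[leb]_x ((\1_D x * pdf x)%:E)) *
              \int[leb]_x ((\1_E x * pdf x)%:E))%E; last first.
  by congr (_ * _)%E; apply/esym; exact: normal_probE.
rewrite -integral_prodM//; last 4 first.
- by apply: measurable_funM => //; exact: measurable_indic.
- by apply: measurable_funM => //; exact: measurable_indic.
- by move=> x; rewrite mulr_ge0.
- by move=> x; rewrite mulr_ge0.
apply: eq_integral => -[x y] _; rewrite !indicE in_setX/= /pdf2.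
by case: (x \in D); case: (y \in E); rewrite /= ?mul1r ?mul0r ?mulr0.
Qed.

End gaussian_cube.

(** The sets measurable for a product are not defined as the Borel sets of the product
topology. A countable base of measurable sets makes the open sets measurable, and
it passes to products. *)
Definition countable_measurable_base d (T : measurableType d)
    (nb : T -> set_system T) :=
  exists (I : countType) (B : I -> set T), (forall i, measurable (B i)) /\
    forall x U, nb x U -> exists i, B i x /\ B i `<=` U.

Lemma base_measurable_fun d (T : measurableType d) (nb : T -> set_system T)
    (R : realType) (f : T -> R) :
  countable_measurable_base nb ->
  (forall x (a : R), a < f x -> nb x [set y | a < f y]) ->
  measurable_fun setT f.
Proof.
move=> [I [B [mB BP]]] fop; apply: (measurability _ (RGenOInfty.measurableE R)).
move=> _ [_ [a ->] <-]; rewrite setTI.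
have -> : f @^-1` `]a, +oo[%classic =
   \bigcup_(i in [set i | B i `<=` [set y | a < f y]]) B i.
  apply/seteqP; split => x /=.
    rewrite in_itv/= andbT => ax; have [i [Bx Bs]] := BP x _ (fop x a ax).
    by exists i.
  by move=> [i /= Bs Bx]; rewrite in_itv/= andbT; exact: Bs.
rewrite bigcup_mkcond; apply: countable_bigcupT_measurable => [|i].
  exact: countableP.
by case: ifP.
Qed.

Lemma base_real (R : realType) :
  @countable_measurable_base _ (measurableTypeR R) (fun x : R => nbhs x).
Proof.
exists (rat * rat)%type, (fun pq => `]ratr pq.1, ratr pq.2[%classic); split => //.
move=> x U [e /= e0 eU].
have xl : x - e < x by rewrite ltrBlDr ltrDl.
have xr : x < x + e by rewrite ltrDl.
have [p] := rat_in_itvoo xl; rewrite in_itv/= => /andP[p1 p2].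
have [q] := rat_in_itvoo xr; rewrite in_itv/= => /andP[q1 q2].
exists (p, q); split; first by rewrite /= in_itv/= p2.
move=> y /=; rewrite in_itv/= => /andP[y1 y2]; apply: eU.
by rewrite /= ltr_norml; apply/andP; split; lra.
Qed.

Lemma base_prod d1 d2 (T1 : measurableType d1) (T2 : measurableType d2)
    (nb1 : T1 -> set_system T1) (nb2 : T2 -> set_system T2) :
  countable_measurable_base nb1 -> countable_measurable_base nb2 ->
  countable_measurable_base (fun p : T1 * T2 => filter_prod (nb1 p.1) (nb2 p.2)).
Proof.
move=> [I [B [mB BP]]] [J [C [mC CP]]].
exists (I * J)%type, (fun ij => B ij.1 `*` C ij.2); split.
  by move=> [i j]; exact: measurableX.
move=> [x y] U [[V W]/= [Vx Wy] VWU].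
have [i [Bx BV]] := BP x V Vx; have [j [Cy CW]] := CP y W Wy.
exists (i, j); split => // -[a b]/= [Ba Cb]; apply: VWU.
by split => /=; [exact: BV|exact: CW].
Qed.

Section continuous_measurable.
Context {R : realType}.

Lemma base_R3 : @countable_measurable_base _ (R3 R) (fun x : R3 R => nbhs x).
Proof. by apply: base_prod; [apply: base_prod|]; exact: base_real. Qed.

Lemma continuous_measurable3 (f : R3 R -> R) : continuous f -> measurable_fun setT f.
Proof.
move=> cf; apply: (base_measurable_fun base_R3) => x a ax.
exact: (cvgr_gt (f x) (cf x) a ax).
Qed.

Lemma continuous_measurable6 (f : R3 R * R3 R -> R) :
  continuous f -> measurable_fun setT f.
Proof.
move=> cf; apply: (base_measurable_fun (base_prod base_R3 base_R3)) => x a ax.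
exact: (cvgr_gt (f x) (cf x) a ax).
Qed.

End continuous_measurable.

(** * Integrals of derivatives on the line and on the circle *)

Section one_dimensional.
Context {R : realType}.
Local Notation MR := (measurableTypeR R).
Local Notation gam := (@normal_prob R 0 1).
Local Notation pdf := (@normal_pdf R 0 1).

Lemma integral_circle (f : MR -> \bar R) : measurable_fun setT f ->
  (\int[@circle_measure R]_s f s =
   \int[@lebesgue_measure R]_(s in `[0%R, (2 * pi)%R]) f s)%E.
Proof.
move=> mf; have mI : measurable (`[0, 2 * pi]%classic : set MR) by [].
have -> : (\int[@circle_measure R]_s f s =
    \int[@circle_measure R]_(s in `[0%R, (2 * pi)%R]) f s)%E.
  rewrite integralE [RHS]integralE.
  have aux g : measurable_fun setT g -> (forall x, 0 <= g x)%E ->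
    (\int[@circle_measure R]_(s in ~` `[0%R, (2 * pi)%R]) g s = 0)%E ->
    (\int[@circle_measure R]_s g s =
     \int[@circle_measure R]_(s in `[0%R, (2 * pi)%R]) g s)%E.
    move=> mg g0 z; rewrite -(setvU `[0%R, (2 * pi)%R]%classic) ge0_integral_setU//=.
    + by rewrite z add0e.
    + exact: measurableC.
    + exact: measurable_funTS.
    + by apply/disj_setPS => x [].
  have nul g : measurable_fun setT g ->
     (\int[@circle_measure R]_(s in ~` `[0%R, (2 * pi)%R]) g s = 0)%E.
    move=> mg; apply: null_set_integral => //; [exact: measurableC|exact: measurable_funTS|].
    by rewrite /= /circle_measure /mrestr setICl measure0.
  by rewrite !aux//; try exact: nul; try exact: measurable_funepos;
    try exact: measurable_funeneg; apply: nul;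
    [exact: measurable_funeneg|exact: measurable_funepos].
apply: eq_measure_integral => A mA AI.
by rewrite /= /circle_measure /mrestr setIidl.
Qed.

Lemma FTC_derive_in (g g' : R -> R) (a b : R) : a < b ->
    (forall s : R, a <= s <= b -> is_derive s 1 g (g' s)) ->
    {in `[a, b], continuous g'} ->
  (\int[@lebesgue_measure R]_(s in `[a, b]) (g' s)%:E = (g b - g a)%:E)%E.
Proof.
move=> ab dg cg'.
have cg s : a <= s <= b -> {for s, continuous g}.
  by move=> /dg ds; apply/differentiable_continuous/derivable1_diffP; case: ds.
have ab' := ltW ab; rewrite (@continuous_FTC2 _ g' g)//.
- by apply: continuous_in_subspaceT => s; rewrite inE => sab; exact: cg'.
- split.
  + move=> s; rewrite in_itv/= => /andP[a_s sb].
    by have [] := dg s; rewrite ?(ltW a_s) ?(ltW sb).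
  + by apply: cvg_at_right_filter; apply: cg; rewrite lexx.
  + by apply: cvg_at_left_filter; apply: cg; rewrite lexx andbT.
- move=> s; rewrite in_itv/= => /andP[a_s sb]; rewrite derive1E.
  have ds : is_derive s 1 g (g' s) by apply: dg; rewrite (ltW a_s) (ltW sb).
  exact: derive_val.
Qed.

Lemma FTC_derive (g g' : R -> R) (a b : R) : a < b ->
    (forall s : R, is_derive s 1 g (g' s)) -> continuous g' ->
  (\int[@lebesgue_measure R]_(s in `[a, b]) (g' s)%:E = (g b - g a)%:E)%E.
Proof. by move=> ab dg cg'; apply: FTC_derive_in. Qed.

(** The values of a periodic function at both ends of the period cancel. *)
Lemma circle_derive0 (g g' : R -> R) :
    (forall s : R, is_derive s 1 g (g' s)) -> continuous g' -> g (2 * pi) = g 0 ->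
  (\int[@circle_measure R]_s (g' s)%:E = 0)%E.
Proof.
move=> dg cg' per; rewrite integral_circle; last first.
  by apply/measurable_EFinP; exact: continuous_measurable_fun.
by rewrite (FTC_derive _ dg)// ?mulr_gt0 ?pi_gt0// per subrr.
Qed.

Lemma is_derive_normal_pdf (s : R) : is_derive s 1 pdf (- s * pdf s).
Proof.
rewrite normal_pdfE ?oner_neq0//=.
have d1 : is_derive s 1 (fun x : R => - (x - 0) ^+ 2 / (1 ^+ 2 *+ 2)) (- s).
  rewrite (_ : (fun x : R => _) = (- 2^-1) \*: (fun x : R => x ^+ 2)); last first.
    by apply/funext => x; rewrite /= subr0 expr1n /GRing.scale/=; lra.
  apply: is_derive_eq.
  by rewrite /GRing.scale/=; lra.
have d2 : is_derive s 1 (normal_fun 0 1) (- s * normal_fun 0 1 s).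
  by rewrite /normal_fun; apply: is_derive_eq; rewrite mulrC.
rewrite (_ : (fun x => _) = normal_peak 1 \*: (normal_fun 0 1 : R -> R))//.
by apply: is_derive_eq; rewrite /GRing.scale/=; ring.
Qed.

(** The integrand times the Gaussian density is the derivative of [g] times that
density, which vanishes far away. *)
Lemma normal_derive0 (g g' : R -> R) (r : R) :
    (forall s : R, is_derive s 1 g (g' s)) -> continuous g' ->
    (forall s, r < `|s| -> g s = 0) -> (forall s, r < `|s| -> g' s = 0) ->
  (\int[gam]_s (g' s - s * g s)%:E = 0)%E.
Proof.
move=> dg cg' g0 g'0.
have cg : continuous g.
  by move=> s; apply/differentiable_continuous/derivable1_diffP; case: (dg s).
have ch : continuous (fun s => g' s - s * g s).
  by move=> s; apply: cvgB; [exact: cg'|apply: cvgM; [exact: cvg_id|exact: cg]].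
rewrite integral_normal; last exact: continuous_measurable_fun.
pose b := `|r| + 1; have b0 : 0 < b by rewrite ltr_wpDl.
have rb : r < b by rewrite (le_lt_trans (ler_norm r))// ltrDl.
have cH : continuous (fun s => (g' s - s * g s) * pdf s).
  by move=> s; apply: cvgM; [exact: ch|exact: continuous_normal_pdf].
transitivity (\int[@lebesgue_measure R]_(s in `[(- b)%R, b])
    ((g' s - s * g s) * pdf s)%R%:E)%E.
  rewrite [RHS]integral_mkcond; apply: eq_integral => s _; rewrite patchE.
  case: ifPn => //; rewrite notin_setE/= in_itv/= -ler_norml => /negP.
  by rewrite -ltNge => bs; rewrite g0 ?g'0 ?mulr0 ?subr0 ?mul0r// (lt_trans rb).
have dG (s : R) : is_derive s 1 (fun s => g s * pdf s) ((g' s - s * g s) * pdf s).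
  have := is_deriveM (dg s) (is_derive_normal_pdf s).
  by move=> h; apply: (is_derive_eq h); rewrite /GRing.scale/=; ring.
rewrite (FTC_derive _ dG cH); last by lra.
have bN : r < `|b| by rewrite gtr0_norm.
by rewrite (g0 b bN) (g0 (- b)) ?normrN// !mul0r subrr.
Qed.

End one_dimensional.

(** * Functions and means on the phase space *)

Section phase_functions.
Context {R : realType}.
Local Notation P := (R3 R * R3 R)%type.
Implicit Types f g h : P -> R.

Definition bounded_measurable f :=
  measurable_fun setT f /\ exists M, forall p, `|f p| <= M.

Definition continuous_periodic f :=
  continuous f /\ forall v, torus_periodic (fun x => f (x, v)).

Definition v_compact f :=
  exists r : R, forall x v : R3 R, r < `|v| -> f (x, v) = 0.

(** Enough regularity for all means below to be finite and for integrations by parts,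
and stable under multiplication by polynomials in the velocity, by modes and by the
magnetic field. *)
Definition tame f := continuous_periodic f /\ v_compact f.

Lemma cpM f g : continuous_periodic f -> continuous_periodic g ->
  continuous_periodic (fun p => f p * g p).
Proof.
move=> [cf pf] [cg pg]; split; first by move=> p; apply: cvgM; [exact: cf|exact: cg].
by move=> v x i; rewrite pf pg.
Qed.

Lemma cpD f g : continuous_periodic f -> continuous_periodic g ->
  continuous_periodic (fun p => f p + g p).
Proof.
move=> [cf pf] [cg pg]; split; first by move=> p; apply: cvgD; [exact: cf|exact: cg].
by move=> v x i; rewrite pf pg.
Qed.

Lemma cpN f : continuous_periodic f -> continuous_periodic (fun p => - f p).
Proof.
move=> [cf pf]; split; first by move=> p; apply: cvgN; exact: cf.
by move=> v x i; rewrite pf.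
Qed.

Lemma cp_cst (a : R) : continuous_periodic (fun=> a).
Proof. by split => // p; exact: cvg_cst. Qed.

Lemma tameM f g : tame f -> continuous_periodic g -> tame (fun p => f p * g p).
Proof.
move=> [cf [r rf]] cg; split; first exact: cpM.
by exists r => x v rv; rewrite rf// mul0r.
Qed.

Lemma tameD f g : tame f -> tame g -> tame (fun p => f p + g p).
Proof.
move=> [cf [r rf]] [cg [s sg]]; split; first exact: cpD.
exists (Num.max r s) => x v; rewrite gt_max => /andP[rv sv].
by rewrite rf// sg// addr0.
Qed.

Lemma tameN f : tame f -> tame (fun p => - f p).
Proof.
move=> [cf [r rf]]; split; first exact: cpN.
by exists r => x v rv; rewrite rf// oppr0.
Qed.

Lemma bmD f g : bounded_measurable f -> bounded_measurable g ->
  bounded_measurable (fun p => f p + g p).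
Proof.
move=> [mf [M fM]] [mg [N gN]]; split; first exact: measurable_funD.
by exists (M + N) => p; rewrite (le_trans (ler_normD _ _))// lerD.
Qed.

Lemma bmM f g : bounded_measurable f -> bounded_measurable g ->
  bounded_measurable (fun p => f p * g p).
Proof.
move=> [mf [M fM]] [mg [N gN]]; split; first exact: measurable_funM.
by exists (M * N) => p; rewrite normrM ler_pM.
Qed.

Lemma bm_cst (a : R) : bounded_measurable (fun=> a).
Proof. by split => //; exists `|a|. Qed.

Lemma bmZ (a : R) f : bounded_measurable f -> bounded_measurable (fun p => a * f p).
Proof. by move=> bf; apply: bmM => //; exact: bm_cst. Qed.

Lemma bmN f : bounded_measurable f -> bounded_measurable (fun p => - f p).
Proof.
move=> [mf [M fM]]; split; first exact: measurableT_comp.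
by exists M => p; rewrite normrN.
Qed.

Lemma bm_sum (I : Type) (r : seq I) (Q : pred I) (F : I -> P -> R) :
  (forall i, bounded_measurable (F i)) ->
  bounded_measurable (fun p => \sum_(i <- r | Q i) F i p).
Proof.
move=> bF; elim: r => [|i r IH].
  by under eq_fun do rewrite big_nil; exact: bm_cst.
under eq_fun do rewrite big_cons.
by case: (Q i) => //; exact: bmD.
Qed.

Lemma periodic_int (T : Type) (f : R3 R -> T) (n : int) x i : torus_periodic f ->
  f (x + ((2 * pi) *~ n) *: basis3 i) = f x.
Proof.
move=> pf.
have nat_per (k : nat) y : f (y + ((2 * pi) *+ k) *: basis3 i) = f y.
  elim: k y => [|k IH] y; first by rewrite mulr0n scale0r addr0.
  by rewrite mulrS scalerDl addrA IH pf.
case: n => n; first by rewrite pmulrn nat_per.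
rewrite NegzE mulrNz -pmulrn -[RHS](nat_per n.+1 _) scaleNr.
by rewrite -(nat_per n.+1) subrK nat_per.
Qed.

Lemma torus_reduction (T : Type) (f : R3 R -> T) x : torus_periodic f ->
  exists2 y, torus_cell y & f y = f x.
Proof.
move=> pf.
have pi2 : 0 < 2 * pi :> R by rewrite mulr_gt0 ?pi_gt0.
have red (a : R) : exists n : int, 0 <= a + (2 * pi) *~ n <= 2 * pi.
  exists (- Num.floor (a / (2 * pi))).
  have := floor_le (a / (2 * pi)).
  have := lt_succ_floor (a / (2 * pi)).
  rewrite ler_pdivlMr// ltr_pdivrMr// mulrNz -[_ *~ _]mulrzr intrD mulrDl mul1r.
  by move=> *; lra.
case: x => [[x1 x2] x3].
have [n1 h1] := red x1; have [n2 h2] := red x2; have [n3 h3] := red x3.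
exists (x1 + (2 * pi) *~ n1, x2 + (2 * pi) *~ n2, x3 + (2 * pi) *~ n3).
  by rewrite /torus_cell; do !split; rewrite /= in_itv/=.
rewrite -[RHS](periodic_int n1 _ 0 pf) -[RHS](periodic_int n2 _ 1 pf).
rewrite -[RHS](periodic_int n3 _ (inord 2) pf).
congr f; rewrite /basis3 inordK//=.
by congr (_, _, _); rewrite /= /GRing.scale/= ?mulr0 ?mulr1 ?addr0.
Qed.

(** By periodicity, only the values over a compact box matter. *)
Lemma tame_bounded f : tame f -> exists M, forall p, `|f p| <= M.
Proof.
move=> [[cf pf] [r rf]].
pose K : set P := torus_cell `*` ((`[- r, r] `*` `[- r, r]) `*` `[- r, r])%classic.
have cK : compact K.
  by apply: compact_setX; apply: compact_setX;
    [apply: compact_setX| |apply: compact_setX|]; exact: segment_compact.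
have : compact (f @` K).
  by apply: continuous_compact => //; exact: continuous_subspaceT.
move=> /compact_bounded[M [_ MP]]; exists (Num.max 0 (M + 1)) => -[x v].
have [y yc <-] := torus_reduction x (pf v).
have [rv|rv] := ltP r `|v|; first by rewrite rf// normr0 le_max lexx.
rewrite le_max; apply/orP; right; apply: (MP (M + 1)); first by rewrite ltrDl.
exists (y, v) => //; split => //=.
case: v rv {yc} => [[v1 v2] v3].
rewrite !prod_normE/= !ge_max => /andP[/andP[h1 h2] h3].
by do !split; rewrite /= in_itv/= -ler_norml.
Qed.

Lemma tame_bm f : tame f -> bounded_measurable f.
Proof.
move=> tf; split; last exact: tame_bounded.
by apply: continuous_measurable6; case: tf => -[].
Qed.

End phase_functions.

Section phase_mean.
Context {R : realType}.
Local Notation P := (R3 R * R3 R)%type.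
Local Notation gam := (@normal_prob R 0 1).
Implicit Types f g h : P -> R.

Lemma phase_measure_fin : fin_num_fun (@phase_measure R).
Proof.
apply: lty_fin_num_fun; rewrite /= /phase_measure -setXTT product_measure1E//.
by rewrite lte_mul_pinfty// ?fin_num_fun_lty//; exact: fin_num_measure.
Qed.

HB.instance Definition _ :=
  Measure_isFinite.Build _ _ _ (@phase_measure R) phase_measure_fin.

Lemma phase_measure_lty : (@phase_measure R setT < +oo)%E.
Proof. by rewrite fin_num_fun_lty//; exact: fin_num_measure. Qed.

(** The integral against $dx\,d\mu$; it is not normalised, the mean of 1 is the
volume of the torus. *)
Definition mean f : R := \int[@phase_measure R]_p f p.

Lemma bm_integrable_on d (T : measurableType d) (m : {finite_measure set T -> \bar R})
  (f : T -> R) M : measurable_fun setT f -> (forall p, `|f p| <= M) ->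
  m.-integrable setT (EFin \o f).
Proof.
move=> mf fM; apply: measurable_bounded_integrable => //.
  by rewrite fin_num_fun_lty//; exact: fin_num_measure.
exists M; split; first exact: num_real.
by move=> y My x _ /=; rewrite (le_trans (fM x))// ltW.
Qed.

Lemma bm_integrable f : bounded_measurable f ->
  (@phase_measure R).-integrable setT (EFin \o f).
Proof. by move=> [mf [M fM]]; exact: (@bm_integrable_on _ _ (@phase_measure R) f M mf fM). Qed.

Lemma meanE f : bounded_measurable f ->
  ((mean f)%:E = \int[@phase_measure R]_p (f p)%:E)%E.
Proof. by move=> bf; rewrite /mean fineK//; exact: integrable_fin_num (bm_integrable bf). Qed.

Lemma meanD f g : bounded_measurable f -> bounded_measurable g ->
  mean (fun p => f p + g p) = mean f + mean g.
Proof. by move=> bf bg; rewrite /mean -RintegralD//; exact: bm_integrable. Qed.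

Lemma meanB f g : bounded_measurable f -> bounded_measurable g ->
  mean (fun p => f p - g p) = mean f - mean g.
Proof. by move=> bf bg; rewrite /mean -RintegralB//; exact: bm_integrable. Qed.

Lemma meanZ (a : R) f : bounded_measurable f -> mean (fun p => a * f p) = a * mean f.
Proof. by move=> bf; rewrite /mean -RintegralZl//; exact: bm_integrable. Qed.

Lemma meanN f : bounded_measurable f -> mean (fun p => - f p) = - mean f.
Proof.
move=> bf; rewrite -mulN1r -meanZ//; apply: eq_Rintegral => p _.
by rewrite mulN1r.
Qed.

Lemma mean0 : mean (fun=> 0) = 0.
Proof. by rewrite /mean /Rintegral integral0. Qed.

Lemma mean_sum (I : Type) (r : seq I) (Q : pred I) (F : I -> P -> R) :
  (forall i, bounded_measurable (F i)) ->
  mean (fun p => \sum_(i <- r | Q i) F i p) = \sum_(i <- r | Q i) mean (F i).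
Proof.
move=> bF; elim: r => [|i r IH].
  by rewrite big_nil -[RHS]mean0; congr mean; apply/funext => p; rewrite big_nil.
rewrite big_cons -IH; case: ifPn => Qi; last first.
  by congr mean; apply/funext => p; rewrite big_cons (negbTE Qi).
rewrite -meanD//; last exact: bm_sum.
by congr mean; apply/funext => p; rewrite big_cons Qi.
Qed.

Lemma mean_ge0 f : (forall p, 0 <= f p) -> 0 <= mean f.
Proof. by move=> f0; apply: Rintegral_ge0. Qed.

Lemma le_mean f g : bounded_measurable f -> bounded_measurable g ->
  (forall p, f p <= g p) -> mean f <= mean g.
Proof. by move=> bf bg fg; apply: le_Rintegral => //; exact: bm_integrable. Qed.

Lemma eq_mean f g : f =1 g -> mean f = mean g.
Proof. by move=> /funext ->. Qed.

Definition shift_coord (x : R3 R) (i : 'I_3) (s : R) : R3 R :=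
  x + (s - coord3 x i) *: basis3 i.

(** By Fubini's theorem the coordinate [i] can be integrated first. *)
Lemma cube_zero (m : {finite_measure set (measurableTypeR R) -> \bar R})
  (i : 'I_3) (F : R3 R -> R) M : measurable_fun setT F -> (forall x, `|F x| <= M) ->
  (forall x, \int[m]_s (F (shift_coord x i s))%:E = 0)%E ->
  (\int[cube_measure m]_x (F x)%:E = 0)%E.
Proof.
move=> mF FM z; have intF := @bm_integrable_on _ _ (cube_measure m) _ _ mF FM.
rewrite /cube_measure.
have slice y : (square_measure m).-integrable setT (fun x => (F (x, y))%:E).
  apply: (@bm_integrable_on _ _ (square_measure m) (fun x => F (x, y)) M) => //.
  exact: measurableT_comp.
have [E|[E|E]] : i = ord0 \/ i = inord 1 \/ i = inord 2.
  by case: i {z} => -[|[|[|//]]] p; [left|right; left|right; right];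
    apply/val_inj; rewrite /= ?inordK.
- rewrite -integral21_prod_meas1//= /fubini_G.
  rewrite (eq_integral (cst 0%E)) ?integral0// => y _.
  rewrite /square_measure -integral21_prod_meas1//= ?/fubini_G.
  rewrite (eq_integral (cst 0%E)) ?integral0// => x2 _.
  rewrite -[RHS](z (0, x2, y)); apply: eq_integral => s _; congr (F _)%:E.
  rewrite /shift_coord E /basis3/=.
  by congr (_, _, _); rewrite /= /GRing.scale/= ?mulr0 ?mulr1 /coord3 ?subr0 ?add0r ?addr0.
- rewrite -integral21_prod_meas1//= /fubini_G.
  rewrite (eq_integral (cst 0%E)) ?integral0// => y _.
  rewrite /square_measure -integral12_prod_meas1//= ?/fubini_F.
  rewrite (eq_integral (cst 0%E)) ?integral0// => x1 _.
  rewrite -[RHS](z (x1, 0, y)); apply: eq_integral => s _; congr (F _)%:E.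
  rewrite /shift_coord E /basis3 inordK//=.
  by congr (_, _, _); rewrite /= /GRing.scale/= ?mulr0 ?mulr1 /coord3
    ?(tnth_nth 0) ?inordK//= ?subr0 ?add0r ?addr0.
- rewrite -integral12_prod_meas1//= /fubini_F.
  rewrite (eq_integral (cst 0%E)) ?integral0// => -[x1 x2] _.
  rewrite -[RHS](z (x1, x2, 0)); apply: eq_integral => s _; congr (F _)%:E.
  rewrite /shift_coord E /basis3 inordK//=.
  by congr (_, _, _); rewrite /= /GRing.scale/= ?mulr0 ?mulr1 /coord3
    ?(tnth_nth 0) ?inordK//= ?subr0 ?add0r ?addr0.
Qed.

Lemma phase_integral_x (F : P -> R) : bounded_measurable F ->
  (forall v, \int[cube_measure (@circle_measure R)]_x (F (x, v))%:E = 0)%E ->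
  mean F = 0.
Proof.
move=> bF z; apply: EFin_inj; rewrite meanE// /phase_measure.
rewrite -integral21_prod_meas1; last exact: bm_integrable.
rewrite (eq_integral (cst 0%E)) ?integral0// => v _ /=.
rewrite -[RHS](z v) /fubini_G/=; apply: eq_measure_integral => A mA _.
exact: torus_measureE.
Qed.

Lemma phase_integral_v (F : P -> R) : bounded_measurable F ->
  (forall x, \int[cube_measure gam]_v (F (x, v))%:E = 0)%E ->
  mean F = 0.
Proof.
move=> bF z; apply: EFin_inj; rewrite meanE// /phase_measure.
rewrite -integral12_prod_meas1; last exact: bm_integrable.
rewrite (eq_integral (cst 0%E)) ?integral0// => x _ /=.
rewrite -[RHS](z x) /fubini_F/=; apply: eq_measure_integral => A mA _.
exact: gaussianE.
Qed.

End phase_mean.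

(** * Integration by parts *)

Section integration_by_parts.
Context {R : realType}.
Local Notation P := (R3 R * R3 R)%type.
Local Notation gam := (@normal_prob R 0 1).
Implicit Types f g h : P -> R.

Definition xdir (i : 'I_3) : P := (basis3 i, 0).
Definition vdir (i : 'I_3) : P := (0, basis3 i).

Definition has_partial (e : P) h h' := forall p : P, is_derive p e h (h' p).

(** Directional derivatives reduce to one real variable along a line. *)
Lemma is_derive_line (V W : normedModType R) (h h' : V -> W) (e : V) :
    (forall p, is_derive p e h (h' p)) ->
  forall (q : V) (a s : R), is_derive s 1 (fun s : R => h (q + (s - a) *: e))
    (h' (q + (s - a) *: e)).
Proof.
move=> dh q a s; set p := q + (s - a) *: e.
have E : (fun k : R => k^-1 *: (((fun s : R => h (q + (s - a) *: e)) \o shift s)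
      (k *: 1) - h p)) = (fun k : R => k^-1 *: ((h \o shift p) (k *: e) - h p)).
  apply/funext => k /=; congr (_ *: (h _ - _)); rewrite /p.
  by rewrite [k *: 1]mulr1 addrCA -scalerDl addrA.
by case: (dh p) => dp <-; split; rewrite /derivable /derive E.
Qed.

Lemma continuous_line (V W : normedModType R) (h : V -> W) (e q : V) (a : R) :
  continuous h -> continuous (fun s : R => h (q + (s - a) *: e)).
Proof.
move=> ch s; apply: continuous_comp; last exact: ch.
apply: cvgD; first exact: cvg_cst.
by apply: cvgZr_tmp; apply: cvgB; [exact: cvg_id|exact: cvg_cst].
Qed.

Lemma coord3_shift (x : R3 R) i (s : R) : coord3 (shift_coord x i s) i = s.
Proof.
case: x => [[x1 x2] x3].
by case: i => -[|[|[|//]]] p; rewrite /shift_coord /coord3 !(tnth_nth 0)/=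
  /GRing.scale/= mulr1 subrKC.
Qed.

Lemma coord3_norm (x : R3 R) i : `|coord3 x i| <= `|x|.
Proof.
case: x => [[x1 x2] x3]; rewrite prod_normE/= prod_normE/=.
by case: i => -[|[|[|//]]] p; rewrite /coord3 (tnth_nth 0)/= !le_max lexx ?orbT.
Qed.

Lemma continuous_coord3 i : continuous (fun x : R3 R => coord3 x i).
Proof.
have c1 : continuous (fun x : R3 R => x.1.1).
  by move=> x; apply: continuous_comp; [exact: cvg_fst|exact: cvg_fst].
have c2 : continuous (fun x : R3 R => x.1.2).
  by move=> x; apply: continuous_comp; [exact: cvg_fst|exact: cvg_snd].
have c3 : continuous (fun x : R3 R => x.2) by move=> x; exact: cvg_snd.
by case: i => -[|[|[|//]]] p; under eq_fun do rewrite /coord3 (tnth_nth 0)/=.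
Qed.

Lemma cp_v i : continuous_periodic (fun p : P => coord3 p.2 i).
Proof.
split => //.
move=> p; apply: (@continuous_comp _ _ _ (snd : P -> R3 R) (fun x => coord3 x i)).
  exact: cvg_snd.
exact: continuous_coord3.
Qed.

Lemma mean_dx0 i h h' : continuous_periodic h -> continuous h' ->
  bounded_measurable h' -> has_partial (xdir i) h h' -> mean h' = 0.
Proof.
move=> [ch ph] ch' bh' dh; apply: phase_integral_x => // v.
have [mh' [M hM]] := bh'.
apply: (@cube_zero _ _ i _ M) => //.
  exact: measurableT_comp.
move=> x; pose a := coord3 x i.
have lineE s : (shift_coord x i s, v) = (x, v) + (s - a) *: xdir i :> P.
  by rewrite /xdir /shift_coord; congr (_, _); rewrite /= scaler0 addr0.
apply: (@circle_derive0 _ (fun s : R => h (shift_coord x i s, v))).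
- move=> s; under eq_fun do rewrite lineE.
  rewrite lineE; exact: is_derive_line.
- under eq_fun do rewrite lineE; exact: continuous_line.
- have := ph v (shift_coord x i 0) i; rewrite /= => <-.
  congr (h (_, _)); rewrite /shift_coord -addrA -scalerDl; congr (_ + _ *: _).
  by rewrite sub0r addrC.
Qed.

(** The derivative in $v_i$ of [h] times the Gaussian density. *)
Lemma mean_dv0 i h h' : tame h -> tame h' -> has_partial (vdir i) h h' ->
  mean (fun p => h' p - coord3 p.2 i * h p) = 0.
Proof.
move=> th th' dh.
have tv : tame (fun p : P => coord3 p.2 i * h p).
  under eq_fun do rewrite mulrC.
  by apply: tameM => //; exact: cp_v.
have tF : tame (fun p => h' p - coord3 p.2 i * h p).
  by apply: tameD => //; exact: tameN.
apply: phase_integral_v; first exact: tame_bm.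
move=> x; have [mF [M FM]] := tame_bm tF.
apply: (@cube_zero _ _ i (fun v => h' (x, v) - coord3 v i * h (x, v)) M).
- by apply: (measurableT_comp mF); exact: measurable_pair1.
- by move=> v; exact: FM (x, v).
move=> v; pose a := coord3 v i.
have lineE s : (x, shift_coord v i s) = (x, v) + (s - a) *: vdir i :> P.
  by rewrite /vdir /shift_coord; congr (_, _); rewrite /= scaler0 addr0.
have [[ch' _] [r' rh']] := th'; have [[ch _] [r rh]] := th.
pose q := Num.max r r'.
have far s : q < `|s| -> q < `|shift_coord v i s|.
  by move=> qs; rewrite (lt_le_trans qs)// -{1}(coord3_shift v i s) coord3_norm.
under eq_integral do rewrite coord3_shift.
apply: (@normal_derive0 _ (fun s => h (x, shift_coord v i s))
  (fun s => h' (x, shift_coord v i s)) q).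
- move=> s; under eq_fun do rewrite lineE.
  rewrite lineE; exact: is_derive_line.
- under eq_fun do rewrite lineE; exact: continuous_line.
- move=> s /far qs; apply: rh; apply: le_lt_trans qs.
  by rewrite le_max lexx.
- move=> s /far qs; apply: rh'; apply: le_lt_trans qs.
  by rewrite le_max lexx orbT.
Qed.

Lemma has_partialM e f f' g g' : has_partial e f f' -> has_partial e g g' ->
  has_partial e (fun p => f p * g p) (fun p => f' p * g p + f p * g' p).
Proof.
move=> df dg p; have h := is_deriveM (df p) (dg p).
by apply: (is_derive_eq h); rewrite /GRing.scale/=; ring.
Qed.

Lemma mean_ibp_x i h h' g g' : tame h -> tame h' ->
    continuous_periodic g -> continuous_periodic g' ->
    has_partial (xdir i) h h' -> has_partial (xdir i) g g' ->
  mean (fun p => h' p * g p) = - mean (fun p => h p * g' p).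
Proof.
move=> th th' cg cg' dh dg.
have t1 := tameM th' cg; have t2 := tameM th cg'.
apply/eqP; rewrite -addr_eq0 -meanD; [|exact: tame_bm|exact: tame_bm].
apply/eqP; apply: (mean_dx0 (i := i) (h := fun p => h p * g p)).
- by apply: cpM => //; case: th.
- by case: (tameD t1 t2) => -[].
- exact/tame_bm/tameD.
- exact: has_partialM.
Qed.

(** The first term on the right comes from the Gaussian weight. *)
Lemma mean_ibp_v i h h' g g' : tame h -> tame h' ->
    continuous_periodic g -> continuous_periodic g' ->
    has_partial (vdir i) h h' -> has_partial (vdir i) g g' ->
  mean (fun p => h' p * g p) =
  mean (fun p => coord3 p.2 i * h p * g p) - mean (fun p => h p * g' p).
Proof.
move=> th th' cg cg' dh dg.
have t1 := tameM th' cg; have t2 := tameM th cg'.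
have t3 : tame (fun p : P => coord3 p.2 i * h p * g p).
  under eq_fun do rewrite [coord3 _ _ * _]mulrC.
  by apply: tameM => //; apply: tameM => //; exact: cp_v.
apply/eqP; rewrite -subr_eq0 opprB addrA -meanD; [|exact: tame_bm|exact: tame_bm].
rewrite -meanB; [|exact/tame_bm/tameD|exact: tame_bm].
apply/eqP; rewrite -(mean_dv0 (tameM th cg) (tameD t1 t2) (has_partialM dh dg)).
by apply: eq_mean => p; rewrite mulrA.
Qed.

End integration_by_parts.

Section test_functions.
Context {R : realType}.
Local Notation P := (R3 R * R3 R)%type.
Implicit Types f g h : P -> R.

Lemma smooth_continuous (V W : normedModType R) (f : V -> W) : smooth f -> continuous f.
Proof. by move=> /(_ 0%N)[]. Qed.

Lemma smooth_derive (V W : normedModType R) (f : V -> W) w : smooth f -> smooth ('D_w f).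
Proof. by move=> sf n; have [_ /(_ w)[]] := sf n.+1. Qed.

Lemma smooth_is_derive (V W : normedModType R) (f : V -> W) w p :
  smooth f -> is_derive p w f ('D_w f p).
Proof. by move=> sf; apply: derivableP; have [_ /(_ w)[]] := sf 1%N. Qed.

Lemma test_tame h : test_function h -> tame h.
Proof. by move=> [sh ph ch]; split => //; split => //; exact: smooth_continuous. Qed.

(** The support in the velocity does not grow because a derivative at a point depends
only on the function nearby. *)
Lemma test_derive h (w : P) : test_function h -> test_function ('D_w h).
Proof.
move=> [sh ph [r rh]]; split; first exact: smooth_derive.
- move=> v x i; set T := (2 * pi) *: basis3 i.
  have E : (fun k : R => k^-1 *: ((h \o shift (x + T, v)) (k *: w) - h (x + T, v)))
      = (fun k : R => k^-1 *: ((h \o shift (x, v)) (k *: w) - h (x, v))).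
    apply/funext => k /=; rewrite ph; congr (_ *: (_ - _)).
    have S y : k *: w + (y, v) = (y + k *: w.1, k *: w.2 + v) :> P.
      by case: w => w1 w2; congr (_, _); rewrite /= addrC.
    by rewrite !S addrAC ph.
  by rewrite /derive E.
- exists r => x v rv; have N0 : \forall p \near (x, v), h p = 0.
    have : \forall p \near (x, v), r < `|p.2|.
      have c2 : (fun p : P => `|p.2|) @ (x, v) --> `|v|.
        apply: (@continuous_comp _ _ _ (snd : P -> R3 R) (fun u => `|u|) (x, v)).
          exact: cvg_snd.
        exact: norm_continuous.
      exact: (cvgr_gt _ c2).
    by apply: filterS => -[y u] /= ru; exact: rh.
  rewrite -(@derive_cst R P R 0 (x, v) w).
  by apply: near_eq_derive.
Qed.

Lemma test_partial_x h i : test_function h -> has_partial (xdir i) h (dx i h).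
Proof. by move=> [sh _ _] p; exact: smooth_is_derive. Qed.

Lemma test_partial_v h i : test_function h -> has_partial (vdir i) h (dv i h).
Proof. by move=> [sh _ _] p; exact: smooth_is_derive. Qed.

Lemma test_dx h i : test_function h -> test_function (dx i h).
Proof. exact: test_derive. Qed.

Lemma test_dv h i : test_function h -> test_function (dv i h).
Proof. exact: test_derive. Qed.

End test_functions.

(** * Fourier modes on the torus *)

Section modes.
Context {R : realType}.
Local Notation P := (R3 R * R3 R)%type.
Local Notation Z3 := (int * int * int)%type.
Implicit Types k l : Z3.

Definition freq k (i : 'I_3) : int := tnth [tuple k.1.1; k.1.2; k.2] i.

Definition wave k (x : R3 R) : R := \sum_(i < 3) (freq k i)%:~R * coord3 x i.

(** The Hartley functions $\cos+\sin$: unlike the cosines and sines they form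
one real orthogonal family indexed by $\mathbb Z^3$, and differentiation maps the
mode $k$ to a multiple of the mode $-k$. *)
Definition mode k (p : P) : R := cos (wave k p.1) + sin (wave k p.1).

Lemma freqN k i : freq (- k) i = - freq k i.
Proof. by case: k => [[a b] c]; case: i => -[|[|[|//]]] p; rewrite /freq !(tnth_nth 0). Qed.

Lemma freqD k l i : freq (k + l) i = freq k i + freq l i.
Proof.
by case: k => [[a b] c]; case: l => [[a' b'] c']; case: i => -[|[|[|//]]] p;
  rewrite /freq !(tnth_nth 0).
Qed.

Lemma freq_eq0 k : (forall i, freq k i = 0) -> k = 0.
Proof.
case: k => [[a b] c] h; have := h (inord 0); have := h (inord 1); have := h (inord 2).
by rewrite /freq !(tnth_nth 0) !inordK//= => -> -> ->.
Qed.

Lemma waveN k x : wave (- k) x = - wave k x.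
Proof.
by rewrite /wave -sumrN; apply: eq_bigr => i _; rewrite freqN rmorphN/= mulNr.
Qed.

Lemma waveD k l x : wave (k + l) x = wave k x + wave l x.
Proof.
by rewrite /wave -big_split/=; apply: eq_bigr => i _; rewrite freqD rmorphD/= mulrDl.
Qed.

Lemma coord3D (x y : R3 R) i : coord3 (x + y) i = coord3 x i + coord3 y i.
Proof.
by case: x => [[? ?] ?]; case: y => [[? ?] ?]; case: i => -[|[|[|//]]] p;
  rewrite /coord3 !(tnth_nth 0).
Qed.

Lemma coord3Z (a : R) (x : R3 R) i : coord3 (a *: x) i = a * coord3 x i.
Proof.
by case: x => [[? ?] ?]; case: i => -[|[|[|//]]] p; rewrite /coord3 !(tnth_nth 0).
Qed.

Lemma coord3_basis i j : coord3 (basis3 i : R3 R) j = (i == j)%:R.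
Proof.
by case: i => -[|[|[|//]]] p; case: j => -[|[|[|//]]] q;
  rewrite /coord3 !(tnth_nth 0).
Qed.

Lemma wave_shift k (x : R3 R) (a : R) i :
  wave k (x + a *: basis3 i) = wave k x + (freq k i)%:~R * a.
Proof.
rewrite /wave; under eq_bigr do rewrite coord3D mulrDr.
rewrite big_split/=; congr (_ + _); rewrite (bigD1 i)//= big1 ?addr0; last first.
  by move=> j ji; rewrite coord3Z coord3_basis eq_sym (negbTE ji) !mulr0.
by rewrite coord3Z coord3_basis eqxx mulr1.
Qed.

Lemma wave0 x : wave 0 x = 0.
Proof.
rewrite /wave big1// => i _.
by case: i => -[|[|[|//]]] p; rewrite /freq (tnth_nth 0)/= mul0r.
Qed.

Lemma continuous_wave k : continuous (wave k).
Proof.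
have c i : continuous (fun x : R3 R => (freq k i)%:~R * coord3 x i).
  by move=> x; apply: cvgM; [exact: cvg_cst|exact: continuous_coord3].
move=> x; rewrite /wave; under eq_fun do rewrite !big_ord_recl big_ord0.
by apply: cvgD; [exact: c|apply: cvgD; [exact: c|apply: cvgD; [exact: c|exact: cvg_cst]]].
Qed.

Lemma periodic_2pi_int (f : R -> R) (n : int) (a : R) : periodic f (pi *+ 2) ->
  f (a + n%:~R * (2 * pi)) = f a.
Proof.
move=> pf; rewrite mulrzl mulr_natl.
case: n => n; first by rewrite -pmulrn periodicn.
by rewrite NegzE mulrNz -pmulrn -(periodicn pf n.+1 (_ - _)) subrK.
Qed.

Lemma cp_of_x (f : R3 R -> R) : continuous f -> torus_periodic f ->
  continuous_periodic (fun p : P => f p.1).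
Proof.
move=> cf pf; split; last by move=> v x i /=; rewrite pf.
move=> p; apply: (@continuous_comp _ _ _ (fst : P -> R3 R) f); first exact: cvg_fst.
exact: cf.
Qed.

Lemma cp_cos_wave k : continuous_periodic (fun p : P => cos (wave k p.1)).
Proof.
apply: (@cp_of_x (fun x => cos (wave k x))).
  move=> x; apply: (@continuous_comp _ _ _ (wave k) cos); first exact: continuous_wave.
  exact: continuous_cos.
by move=> x i; rewrite wave_shift periodic_2pi_int//; exact: cosD2pi.
Qed.

Lemma cp_sin_wave k : continuous_periodic (fun p : P => sin (wave k p.1)).
Proof.
apply: (@cp_of_x (fun x => sin (wave k x))).
  move=> x; apply: (@continuous_comp _ _ _ (wave k) sin); first exact: continuous_wave.
  exact: continuous_sin.
by move=> x i; rewrite wave_shift periodic_2pi_int//; exact: sinD2pi.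
Qed.

Lemma cp_mode k : continuous_periodic (mode k).
Proof. by apply: cpD; [exact: cp_cos_wave|exact: cp_sin_wave]. Qed.

Lemma modeN k p : mode (- k) p = cos (wave k p.1) - sin (wave k p.1).
Proof. by rewrite /mode waveN cosN sinN. Qed.

Lemma mode_le2 k p : `|mode k p| <= 2.
Proof.
rewrite /mode (le_trans (ler_normD _ _))// -[2]/(1 + 1) lerD//.
  by rewrite ler_norml cos_geN1 cos_le1.
by rewrite ler_norml sin_geN1 sin_le1.
Qed.

Lemma bm_mode k : bounded_measurable (mode k).
Proof.
split; last by exists 2; exact: mode_le2.
by apply: continuous_measurable6; case: (cp_mode k).
Qed.

Lemma mode0 p : mode 0 p = 1.
Proof. by rewrite /mode wave0 cos0 sin0 addr0. Qed.

(** The converse of [is_derive_line]. *)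
Lemma is_derive_of_line (V W : normedModType R) (h : V -> W) (e p : V) (d : W) :
  is_derive (0 : R) 1 (fun s : R => h (p + s *: e)) d -> is_derive p e h d.
Proof.
have E : (fun k : R => k^-1 *: (((fun s : R => h (p + s *: e)) \o shift 0) (k *: 1)
      - h (p + 0 *: e))) = (fun k : R => k^-1 *: ((h \o shift p) (k *: e) - h p)).
  apply/funext => k /=; congr (_ *: (h _ - h _)).
    by rewrite addr0 [k *: 1]mulr1 addrC.
  by rewrite scale0r addr0.
by case=> + <-; rewrite /derivable /derive E.
Qed.

Lemma mode_partial_x k i :
  has_partial (xdir i) (mode k) (fun p => (freq k i)%:~R * mode (- k) p).
Proof.
move=> p; apply: is_derive_of_line.
have E : (fun s : R => mode k (p + s *: xdir i)) =
    (fun s : R => cos (wave k p.1 + (freq k i)%:~R * s)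
                + sin (wave k p.1 + (freq k i)%:~R * s)).
  by apply/funext => s; rewrite /mode /= wave_shift.
rewrite E; set c : R := (freq k i)%:~R; set a := wave k p.1.
have dl (s : R) : is_derive s 1 (fun s : R => a + c * s) c.
  rewrite (_ : (fun s : R => _) = cst a + c \*: (id : R -> R))//.
  by apply: is_derive_eq; rewrite add0r /GRing.scale/= mulr1.
have d1 : is_derive (0 : R) 1 (cos \o (fun s : R => a + c * s)) (- sin (a + c * 0) * c).
  exact: is_derive1_comp.
have d2 : is_derive (0 : R) 1 (sin \o (fun s : R => a + c * s)) (cos (a + c * 0) * c).
  exact: is_derive1_comp.
apply: (is_derive_eq (is_deriveD d1 d2)).
by rewrite modeN mulr0 addr0; ring.
Qed.

Lemma x_partial_v (f : R3 R -> R) i :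
  has_partial (vdir i) (fun p : P => f p.1) (fun=> 0).
Proof.
move=> p; apply: is_derive_of_line.
rewrite (_ : (fun s : R => _) = cst (f p.1)); first exact: is_derive_cst.
by apply/funext => s /=; rewrite scaler0 addr0.
Qed.

Lemma mode_partial_v k i : has_partial (vdir i) (mode k) (fun=> 0).
Proof. exact: (@x_partial_v (fun x => cos (wave k x) + sin (wave k x))). Qed.

Lemma v_partial_x i j : has_partial (xdir i) (fun p : P => coord3 p.2 j) (fun=> 0).
Proof.
move=> p; apply: is_derive_of_line.
rewrite (_ : (fun s : R => _) = cst (coord3 p.2 j)); first exact: is_derive_cst.
by apply/funext => s /=; rewrite scaler0 addr0.
Qed.

Lemma v_partial_v i j :
  has_partial (vdir i) (fun p : P => coord3 p.2 j) (fun=> (i == j)%:R).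
Proof.
move=> p; apply: is_derive_of_line.
rewrite (_ : (fun s : R => _) =
    cst (coord3 p.2 j) + (i == j)%:R \*: (id : R -> R)); last first.
  apply/funext => s /=; rewrite coord3D coord3Z coord3_basis.
  by rewrite [s * _]mulrC.
by apply: is_derive_eq; rewrite add0r /GRing.scale/= mulr1.
Qed.

(** A nonconstant mode is a multiple of a derivative. *)
Lemma mean_mode k : k != 0 -> mean (mode k) = 0.
Proof.
move=> k0; have [i ki] : exists i, freq k i != 0.
  apply: contrapT => h; move/eqP : k0; apply; apply: freq_eq0 => i.
  by apply/eqP/negPn/negP => hi; apply: h; exists i.
have := mode_partial_x (- k) i; rewrite opprK freqN => hp.
have : mean (fun p => (- freq k i)%:~R * mode k p) = 0.
  apply: (mean_dx0 (cp_mode (- k)) _ _ hp).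
    by case: (cpM (cp_cst (- freq k i)%:~R) (cp_mode k)).
  by apply: bmZ; exact: bm_mode.
rewrite meanZ; last exact: bm_mode.
by move/eqP; rewrite mulf_eq0 intr_eq0 oppr_eq0 (negbTE ki)/= => /eqP.
Qed.

Definition volume : R := mean (fun=> 1).

Lemma volume_gt0 : 0 < volume.
Proof.
have pi2 : 0 < 2 * pi :> R by rewrite mulr_gt0 ?pi_gt0.
have -> : volume = 2 * pi * (2 * pi) * (2 * pi).
  apply: EFin_inj; rewrite /volume meanE; last exact: bm_cst.
  rewrite integral_cst// mul1e.
  transitivity (torus_measure setT * gaussian (@setT (R3 R)))%E.
    by rewrite /= /phase_measure -setXTT product_measure1E.
  rewrite (_ : gaussian setT = 1%E) ?mule1; last exact: probability_setT.
  rewrite torus_measureE// /cube_measure -setXTT product_measure1E//.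
  rewrite !EFinM; congr (_ * _)%E; last exact: circle_measureT.
  rewrite /= /square_measure -setXTT product_measure1E//.
  by congr (_ * _)%E; exact: circle_measureT.
by rewrite !mulr_gt0 ?pi_gt0.
Qed.

Lemma cos_wave k p : cos (wave k p.1) = (mode k p + mode (- k) p) / 2.
Proof. by rewrite modeN /mode; field. Qed.

Lemma sin_wave k p : sin (wave k p.1) = (mode k p - mode (- k) p) / 2.
Proof. by rewrite modeN /mode; field. Qed.

Lemma modeM k l p : mode k p * mode l p =
  cos (wave (k - l) p.1) + sin (wave (k + l) p.1).
Proof.
rewrite /mode !waveD waveN cosD sinD cosN sinN.
set a := wave k _; set b := wave l _; ring.
Qed.

Lemma mean_mode_delta k : mean (mode k) = (k == 0)%:R * volume.
Proof.
have [->|k0] := eqVneq k 0; last by rewrite mean_mode// mul0r.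
by rewrite mul1r; apply: eq_mean => p; exact: mode0.
Qed.

Lemma mean_cos_wave k : mean (fun p => cos (wave k p.1)) = (k == 0)%:R * volume.
Proof.
rewrite (@eq_mean _ _ (fun p => 2^-1 * (mode k p + mode (- k) p))); last first.
  by move=> p; rewrite cos_wave mulrC.
rewrite meanZ; last by apply: bmD; exact: bm_mode.
rewrite meanD; [|exact: bm_mode|exact: bm_mode].
by rewrite !mean_mode_delta oppr_eq0; field.
Qed.

Lemma mean_sin_wave k : mean (fun p => sin (wave k p.1)) = 0.
Proof.
rewrite (@eq_mean _ _ (fun p => 2^-1 * (mode k p - mode (- k) p))); last first.
  by move=> p; rewrite sin_wave mulrC.
rewrite meanZ; last by apply: bmD; [exact: bm_mode|exact/bmN/bm_mode].
rewrite meanB; [|exact: bm_mode|exact: bm_mode].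
by rewrite !mean_mode_delta oppr_eq0 subrr mulr0.
Qed.

Lemma bm_cos_wave k : bounded_measurable (fun p : P => cos (wave k p.1)).
Proof.
split; last by exists 1 => p; exact: cos_max.
by apply: continuous_measurable6; case: (cp_cos_wave k).
Qed.

Lemma bm_sin_wave k : bounded_measurable (fun p : P => sin (wave k p.1)).
Proof.
split; last by exists 1 => p; exact: sin_max.
by apply: continuous_measurable6; case: (cp_sin_wave k).
Qed.

(** The modes are orthogonal because their products are sums of a cosine wave and a
sine wave. *)
Lemma mean_modeM k l : mean (fun p => mode k p * mode l p) = (k == l)%:R * volume.
Proof.
rewrite (eq_mean (modeM k l)) meanD; [|exact: bm_cos_wave|exact: bm_sin_wave].
by rewrite mean_cos_wave mean_sin_wave addr0 subr_eq0.
Qed.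

End modes.

(** * Gaussian moments *)

Section moments.
Context {R : realType}.
Local Notation P := (R3 R * R3 R)%type.
Local Notation MR := (measurableTypeR R).
Local Notation gam := (@normal_prob R 0 1).

(** $x^2e^{-x^2/4}\le4$, and what remains is the density of variance 2. *)
Lemma normal_second_moment : (\int[gam]_s (s ^+ 2)%:E < +oo)%E.
Proof.
have m2 : measurable_fun setT (fun s : MR => (s ^+ 2)%:E).
  by apply/measurable_EFinP; exact: measurable_funX.
rewrite ge0_integral_normal//; last by move=> x; rewrite lee_fin sqr_ge0.
pose sg : R := Num.sqrt 2.
have sg0 : sg != 0 by rewrite gt_eqF// sqrtr_gt0.
have sg2 : sg ^+ 2 = 2 by rewrite sqr_sqrtr.
have p0 : 0 < normal_peak sg by exact: normal_peak_gt0.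
pose C := 4 * normal_peak 1 / normal_peak sg.
have C0 : 0 <= C by rewrite /C !mulr_ge0 ?normal_peak_ge0// invr_ge0 ltW.
apply: (@le_lt_trans _ _ (\int[lebesgue_measure]_x (C%:E * (normal_pdf 0 sg x)%:E))%E).
  apply: ge0_le_integral => //.
  - by move=> x _; rewrite mule_ge0// lee_fin ?sqr_ge0 ?normal_pdf_ge0.
  - apply: emeasurable_funM => //; apply/measurable_EFinP.
    exact: measurable_normal_pdf.
  - by apply: measurable_funeM; apply/measurable_EFinP; exact: measurable_normal_pdf.
  move=> x _; rewrite -!EFinM lee_fin (normal_pdfE _ sg0)/= normal_pdfE ?oner_neq0//=.
  rewrite /normal_fun !subr0 expr1n sg2 /C.
  have -> : - x ^+ 2 / (1 *+ 2) = - x ^+ 2 / (2 *+ 2) + - x ^+ 2 / (2 *+ 2) by field.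
  rewrite expRD; set e := expR _.
  have e0 : 0 < e := expR_gt0 _.
  have key : x ^+ 2 * e <= 4.
    have ee : e * expR (x ^+ 2 / (2 *+ 2)) = 1.
      by rewrite -expRD mulNr addNr expR0.
    have := expR_ge1Dx (x ^+ 2 / (2 *+ 2)); rewrite -(ler_pM2l e0) ee.
    by rewrite mulrDr mulr1; lra.
  have q0 := normal_peak_ge0 (1 : R).
  have -> : 4 * normal_peak 1 / normal_peak sg * (normal_peak sg * e) = 4 * (normal_peak 1 * e).
    by field; rewrite gt_eqF.
  rewrite (_ : x ^+ 2 * (normal_peak 1 * (e * e)) = x ^+ 2 * e * (normal_peak 1 * e)); last by ring.
  by rewrite ler_wpM2r// mulr_ge0// ltW.
rewrite ge0_integralZl//; last 2 first.
- by apply/measurable_EFinP; exact: measurable_normal_pdf.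
- by move=> x _; rewrite lee_fin normal_pdf_ge0.
by rewrite integral_normal_pdf mule1 ltry.
Qed.

(** The other two velocity components integrate to 1. *)
Lemma gaussian_second_moment i : (\int[@gaussian R]_v (coord3 v i ^+ 2)%:E < +oo)%E.
Proof.
have h2 := normal_second_moment.
have mu1 : (\int[gam]_s 1%:E = 1)%E by rewrite integral_cst// mul1e; exact: probability_setT.
have m2 : measurable_fun setT (fun s : MR => s ^+ 2) by exact: measurable_funX.
have sq (s : R) : 0 <= s ^+ 2 := sqr_ge0 s.
rewrite (eq_measure_integral (cube_measure gam)); last by move=> A mA _; exact: gaussianE.
rewrite /cube_measure.
have [E|[E|E]] : i = ord0 \/ i = inord 1 \/ i = inord 2.
  by case: i => -[|[|[|//]]] p; [left|right; left|right; right];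
    apply/val_inj; rewrite /= ?inordK.
- rewrite (eq_integral (fun v : R3 R => (v.1.1 ^+ 2 * 1)%:E)); last first.
    by move=> v _; rewrite E mulr1.
  rewrite (@integral_prodM _ _ _ _ _ _ _ (fun q : MR * MR => q.1 ^+ 2) (fun=> 1))//; last first.
    by apply: (measurableT_comp m2); exact: measurable_fst.
  rewrite mu1 mule1 /square_measure.
  rewrite (eq_integral (fun v : MR * MR => (v.1 ^+ 2 * 1)%:E)); last first.
    by move=> v _; rewrite mulr1.
  by rewrite (@integral_prodM _ _ _ _ _ _ _ (fun q : MR => q ^+ 2) (fun=> 1))// mu1 mule1.
- rewrite (eq_integral (fun v : R3 R => (v.1.2 ^+ 2 * 1)%:E)); last first.
    by move=> v _; rewrite E mulr1 /coord3 (tnth_nth 0) inordK.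
  rewrite (@integral_prodM _ _ _ _ _ _ _ (fun q : MR * MR => q.2 ^+ 2) (fun=> 1))//; last first.
    by apply: (measurableT_comp m2); exact: measurable_snd.
  rewrite mu1 mule1 /square_measure.
  rewrite (eq_integral (fun v : MR * MR => (1 * v.2 ^+ 2)%:E)); last first.
    by move=> v _; rewrite mul1r.
  by rewrite (@integral_prodM _ _ _ _ _ _ _ (fun=> 1) (fun q : MR => q ^+ 2))// mu1 mul1e.
- rewrite (eq_integral (fun v : R3 R => (1 * v.2 ^+ 2)%:E)); last first.
    by move=> v _; rewrite E mul1r /coord3 (tnth_nth 0) inordK.
  rewrite (@integral_prodM _ _ _ _ _ _ _ (fun=> 1) (fun q : MR => q ^+ 2))//.
  rewrite lte_mul_pinfty//; first exact: integral_ge0.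
  rewrite (integral_cst (square_measure gam) measurableT 1) mul1e ge0_fin_numE//.
  by rewrite fin_num_fun_lty//; exact: square_measure_fin.
Qed.

(** The factor [F] has a sign of its own, hence the boundedness assumption, while [G]
may be unbounded, as for the square of a velocity. *)
Lemma mean_separated (F G : R3 R -> R) (M : R) :
    measurable_fun setT F -> (forall x, `|F x| <= M) ->
    measurable_fun setT G -> (forall v, 0 <= G v) ->
    (\int[@gaussian R]_v (G v)%:E < +oo)%E ->
  mean (fun p : P => F p.1 * G p.2) =
    mean (fun p : P => F p.1) * fine (\int[@gaussian R]_v (G v)%:E)%E.
Proof.
move=> mF FM.
suff H (G' : R3 R -> R) : measurable_fun setT G' -> (forall v, 0 <= G' v) ->
    (\int[@gaussian R]_v (G' v)%:E < +oo)%E ->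
  mean (fun p : P => F p.1 * G' p.2) =
    fine (\int[@torus_measure R]_x (F x)%:E)%E * fine (\int[@gaussian R]_v (G' v)%:E)%E.
  move=> mG G0 Gfin; rewrite H//; congr (_ * _).
  rewrite (@eq_mean _ _ (fun p : P => F p.1 * 1)); last by move=> p; rewrite mulr1.
  have g1 : (\int[@gaussian R]_v 1%:E = 1)%E.
    by rewrite integral_cst// mul1e; exact: probability_setT.
  by rewrite (H (fun=> 1))// ?g1 ?ltry// mulr1.
move=> mG G0 Gfin.
have M0 : 0 <= M by apply: le_trans (FM (0 : R3 R)).
have iF := @bm_integrable_on _ _ _ (@torus_measure R) F M mF FM.
have iG : (@gaussian R).-integrable setT (EFin \o G').
  apply/integrableP; split; first exact/measurable_EFinP.
  by under eq_integral do rewrite /= ger0_norm//.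
have GfinE : (\int[@gaussian R]_v (G' v)%:E)%E \is a fin_num.
  exact: integrable_fin_num iG.
have mFG : measurable_fun setT (fun p : P => (F p.1 * G' p.2)%:E).
  apply/measurable_EFinP; apply: measurable_funM.
    by apply: (measurableT_comp mF); exact: measurable_fst.
  by apply: (measurableT_comp mG); exact: measurable_snd.
have iFG : (@phase_measure R).-integrable setT (fun p : P => (F p.1 * G' p.2)%:E).
  apply/integrableP; split => //.
  apply: (@le_lt_trans _ _ (\int[@phase_measure R]_p (M * G' p.2)%:E)%E).
    apply: ge0_le_integral => //.
    - exact: measurableT_comp.
    - apply/measurable_EFinP; apply: measurable_funM => //.
      by apply: (measurableT_comp mG); exact: measurable_snd.
    - by move=> p _; rewrite lee_fin normrM (ger0_norm (G0 _)) ler_wpM2r.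
  rewrite /phase_measure (@integral_prodM _ _ _ _ _ _ _ (fun=> M) G')//.
  rewrite lte_mul_pinfty//; first by apply: integral_ge0 => x _; rewrite lee_fin.
  by rewrite integral_cst// fin_numM//; exact: fin_num_measure.
rewrite /mean /Rintegral /phase_measure -integral21_prod_meas1//= /fubini_G/=.
rewrite -fineM//; last exact: integrable_fin_num iF.
congr fine.
set I := (\int[@torus_measure R]_x (F x)%:E)%E.
have IE : I = (fine I)%:E by rewrite fineK//; exact: integrable_fin_num iF.
rewrite (eq_integral (fun v => (fine I)%:E * (G' v)%:E)%E).
  by rewrite integralZl// -IE.
move=> v _; rewrite -IE.
by under eq_integral do rewrite EFinM; rewrite integralZr.
Qed.

End moments.

(** * The Gaussian Poincare inequality *)

Section oscillation.
Context {R : realType}.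
Local Notation MR := (measurableTypeR R).
Local Notation gam := (@normal_prob R 0 1).
Local Notation pdf := (@normal_pdf R 0 1).

(** Twice the variance of [g] when [m] is a probability. *)
Definition oscillation d (T : measurableType d) (m : {measure set T -> \bar R})
    (g : T -> R) : \bar R :=
  (\int[m]_x \int[m]_y ((g x - g y) ^+ 2)%:E)%E.

Section tensor.
Context d1 d2 (T1 : measurableType d1) (T2 : measurableType d2).
Context (m1 : {finite_measure set T1 -> \bar R}) (m1T : m1 setT = 1%E).
Context (m2 : {finite_measure set T2 -> \bar R}) (m2T : m2 setT = 1%E).
Context (M : {finite_measure set (T1 * T2)%type -> \bar R}).
Context (ME : forall A, measurable A -> M A = (m1 \x m2)%E A).
Context (f : T1 * T2 -> R) (mf : measurable_fun setT f).

Let sq0 (a b : R) : (0 <= ((a - b) ^+ 2)%:E)%E.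
Proof. by rewrite lee_fin sqr_ge0. Qed.

Let msq d (T : measurableType d) (a b : T -> R) : measurable_fun setT a ->
  measurable_fun setT b -> measurable_fun setT (fun x => ((a x - b x) ^+ 2)%:E).
Proof.
by move=> ma mb; apply/measurable_EFinP/measurable_funX; exact: measurable_funB.
Qed.

Let mcomp d (T : measurableType d) (a : T -> T1) (b : T -> T2) :
  measurable_fun setT a -> measurable_fun setT b ->
  measurable_fun setT (fun x => f (a x, b x)).
Proof. by move=> ma mb; apply: (measurableT_comp mf); exact: measurable_fun_pair. Qed.

(** Changing one coordinate at a time costs a factor 2 by convexity of the square. *)
Lemma oscillation_prod :
  (oscillation M f <=
   2%:E * (\int[m2]_b oscillation m1 (fun a => f (a, b)))
   + 2%:E * (\int[m1]_a oscillation m2 (fun b => f (a, b))))%E.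
Proof.
pose A (p : T1 * T2) := (\int[m1]_y ((f p - f (y, p.2)) ^+ 2)%:E)%E.
pose B (b : T2) := (\int[m1]_y \int[m2]_z ((f (y, b) - f (y, z)) ^+ 2)%:E)%E.
have mA : measurable_fun setT A.
  apply: (measurable_fun_fubini_tonelli_F (fun q : (T1 * T2) * T1 =>
     ((f q.1 - f (q.2, q.1.2)) ^+ 2)%:E)) => //.
  apply: msq; first by apply: (measurableT_comp mf); exact: measurable_fst.
  apply: mcomp; first exact: measurable_snd.
  by apply: (measurableT_comp measurable_snd); exact: measurable_fst.
have mB' : measurable_fun setT (fun q : T2 * T1 =>
    (\int[m2]_z ((f (q.2, q.1) - f (q.2, z)) ^+ 2)%:E)%E).
  apply: (measurable_fun_fubini_tonelli_F (fun q : (T2 * T1) * T2 =>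
     ((f (q.1.2, q.1.1) - f (q.1.2, q.2)) ^+ 2)%:E)) => //.
  have m12 : measurable_fun setT (fun q : (T2 * T1) * T2 => q.1.2).
    by apply: (measurableT_comp measurable_snd); exact: measurable_fst.
  apply: msq; apply: mcomp => //.
  by apply: (measurableT_comp measurable_fst); exact: measurable_fst.
have mB : measurable_fun setT B.
  apply: (measurable_fun_fubini_tonelli_F (fun q : T2 * T1 =>
    (\int[m2]_z ((f (q.2, q.1) - f (q.2, z)) ^+ 2)%:E)%E)) => //.
  by move=> q; exact: integral_ge0.
have A0 p : (0 <= A p)%E by exact: integral_ge0.
have B0 b : (0 <= B b)%E by apply: integral_ge0 => y _; exact: integral_ge0.
have ME' g : (\int[M]_p g p = \int[m1 \x m2]_p g p)%E.
  by apply: eq_measure_integral => D mD _; exact: ME.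
have step p : (\int[M]_q ((f p - f q) ^+ 2)%:E <= 2%:E * A p + 2%:E * B p.2)%E.
  rewrite ME'.
  have ma : measurable_fun setT (fun q : T1 * T2 => ((f p - f (q.1, p.2)) ^+ 2)%:E).
    by apply: msq => //; apply: mcomp => //; exact: measurable_fst.
  have mb : measurable_fun setT (fun q : T1 * T2 => ((f (q.1, p.2) - f q) ^+ 2)%:E).
    by apply: msq => //; apply: mcomp => //; exact: measurable_fst.
  apply: (@le_trans _ _ (\int[m1 \x m2]_q (2%:E * ((f p - f (q.1, p.2)) ^+ 2)%:E
     + 2%:E * ((f (q.1, p.2) - f q) ^+ 2)%:E))%E).
    apply: ge0_le_integral => //.
    - by apply: msq.
    - by apply: emeasurable_funD; exact: measurable_funeM.
    - move=> q _; rewrite -!EFinM -EFinD lee_fin.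
      have := sqr_ge0 ((f p - f (q.1, p.2)) - (f (q.1, p.2) - f q)).
      by nra.
  have ma' := measurable_funeM 2%:E ma; have mb' := measurable_funeM 2%:E mb.
  rewrite ge0_integralD//; last 2 first.
  - by move=> q _; rewrite mule_ge0.
  - by move=> q _; rewrite mule_ge0.
  rewrite !ge0_integralZl//.
  apply: leeD; apply: lee_wpmul2l => //; rewrite fubini_tonelli1//=.
  rewrite le_eqVlt; apply/orP; left; apply/eqP; apply: eq_integral => y _.
  by rewrite /fubini_F/= integral_cst// -[RHS]mule1; congr (_ * _)%E; exact: m2T.
apply: (@le_trans _ _ (\int[M]_p (2%:E * A p + 2%:E * B p.2)%E)%E).
  apply: ge0_le_integral => //.
  - by move=> p _; exact: integral_ge0.
  - apply: (measurable_fun_fubini_tonelli_F (fun q : (T1 * T2) * (T1 * T2) =>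
      ((f q.1 - f q.2) ^+ 2)%:E)) => //.
    apply: msq; apply: (measurableT_comp mf); [exact: measurable_fst|exact: measurable_snd].
  - apply: emeasurable_funD; apply: measurable_funeM => //.
    by apply: (measurableT_comp mB); exact: measurable_snd.
have mB2 : measurable_fun setT (fun p : T1 * T2 => B p.2).
  by apply: (measurableT_comp mB); exact: measurable_snd.
have mA' := measurable_funeM 2%:E mA; have mB2' := measurable_funeM 2%:E mB2.
rewrite ME' ge0_integralD//; last 2 first.
- by move=> q _; rewrite mule_ge0.
- by move=> q _; rewrite mule_ge0.
rewrite !ge0_integralZl//.
apply: leeD; apply: lee_wpmul2l => //.
- by rewrite fubini_tonelli2.
- rewrite fubini_tonelli2//=.
  rewrite (eq_integral B); last first.
    move=> b _; rewrite /fubini_G/= integral_cst// -[RHS]mule1; congr (_ * _)%E; exact: m1T.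
  rewrite /B (fubini_tonelli (fun q : T2 * T1 =>
    (\int[m2]_z ((f (q.2, q.1) - f (q.2, z)) ^+ 2)%:E)%E))//=.
  by move=> q; exact: integral_ge0.
Qed.

Lemma measurable_oscillation1 :
  measurable_fun setT (fun b => oscillation m1 (fun a => f (a, b))).
Proof.
have m' : measurable_fun setT (fun q : T2 * T1 =>
    (\int[m1]_y ((f (q.2, q.1) - f (y, q.1)) ^+ 2)%:E)%E).
  apply: (measurable_fun_fubini_tonelli_F (fun q : (T2 * T1) * T1 =>
     ((f (q.1.2, q.1.1) - f (q.2, q.1.1)) ^+ 2)%:E)) => //.
  have m11 : measurable_fun setT (fun q : (T2 * T1) * T1 => q.1.1).
    by apply: (measurableT_comp measurable_fst); exact: measurable_fst.
  apply: msq; apply: mcomp => //.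
  by apply: (measurableT_comp measurable_snd); exact: measurable_fst.
apply: (measurable_fun_fubini_tonelli_F (fun q : T2 * T1 =>
    (\int[m1]_y ((f (q.2, q.1) - f (y, q.1)) ^+ 2)%:E)%E)) => //.
by move=> q; exact: integral_ge0.
Qed.

Lemma measurable_oscillation2 :
  measurable_fun setT (fun a => oscillation m2 (fun b => f (a, b))).
Proof.
have m' : measurable_fun setT (fun q : T1 * T2 =>
    (\int[m2]_y ((f (q.1, q.2) - f (q.1, y)) ^+ 2)%:E)%E).
  apply: (measurable_fun_fubini_tonelli_F (fun q : (T1 * T2) * T2 =>
     ((f (q.1.1, q.1.2) - f (q.1.1, q.2)) ^+ 2)%:E)) => //.
  have m11 : measurable_fun setT (fun q : (T1 * T2) * T2 => q.1.1).
    by apply: (measurableT_comp measurable_fst); exact: measurable_fst.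
  apply: msq; apply: mcomp => //.
  by apply: (measurableT_comp measurable_snd); exact: measurable_fst.
apply: (measurable_fun_fubini_tonelli_F (fun q : T1 * T2 =>
    (\int[m2]_y ((f (q.1, q.2) - f (q.1, y)) ^+ 2)%:E)%E)) => //.
by move=> q; exact: integral_ge0.
Qed.

Lemma poincare_tensor (C : R) (D1 D2 : T1 * T2 -> \bar R) : 0 <= C ->
    measurable_fun setT D1 -> measurable_fun setT D2 ->
    (forall p, 0 <= D1 p)%E -> (forall p, 0 <= D2 p)%E ->
    (forall b, oscillation m1 (fun a => f (a, b)) <= C%:E * \int[m1]_a D1 (a, b))%E ->
    (forall a, oscillation m2 (fun b => f (a, b)) <= C%:E * \int[m2]_b D2 (a, b))%E ->
  (oscillation M f <= (2 * C)%R%:E * \int[M]_p (D1 p + D2 p))%E.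
Proof.
move=> C0 mD1 mD2 D10 D20 h1 h2; apply: (le_trans oscillation_prod).
have ME' g : (\int[M]_p g p = \int[m1 \x m2]_p g p)%E.
  by apply: eq_measure_integral => D mD _; exact: ME.
rewrite ME'.
have -> : (\int[m1 \x m2]_p (D1 p + D2 p) =
    \int[m1 \x m2]_p D1 p + \int[m1 \x m2]_p D2 p)%E by rewrite ge0_integralD.
set I1 := (\int[m1 \x m2]_p D1 p)%E; set I2 := (\int[m1 \x m2]_p D2 p)%E.
have I10 : (0 <= I1)%E by exact: integral_ge0.
have I20 : (0 <= I2)%E by exact: integral_ge0.
have -> : ((2 * C)%R%:E * (I1 + I2) = 2%:E * (C%:E * I1) + 2%:E * (C%:E * I2))%E.
  by rewrite !muleA -!EFinM ge0_muleDr.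
have osc0 d (T : measurableType d) (m : {measure set T -> \bar R}) (g : T -> R) :
    (0 <= oscillation m g)%E.
  by apply: integral_ge0 => x _; exact: integral_ge0.
apply: leeD; apply: lee_wpmul2l => //.
- rewrite /I1 fubini_tonelli2//=.
  have mG := measurable_fun_fubini_tonelli_G (m1 := m1) D1 mD1 D10.
  rewrite -ge0_integralZl//; last by move=> b _; exact: integral_ge0.
  apply: ge0_le_integral => //; first exact: measurable_oscillation1.
  exact: measurable_funeM.
- rewrite /I2 fubini_tonelli1//=.
  have mF := measurable_fun_fubini_tonelli_F (m2 := m2) D2 mD2 D20.
  rewrite -ge0_integralZl//; last by move=> b _; exact: integral_ge0.
  apply: ge0_le_integral => //; first exact: measurable_oscillation2.
  exact: measurable_funeM.
Qed.

End tensor.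
End oscillation.

Section poincare.
Context {R : realType}.
Local Notation MR := (measurableTypeR R).
Local Notation gam := (@normal_prob R 0 1).
Local Notation pdf := (@normal_pdf R 0 1).
Local Notation leb := (@lebesgue_measure R).

Let pdf0 (s : R) : 0 <= pdf s := normal_pdf_ge0 0 1 s.

(** Hardy's trick: with $w=u-u(0)$ and $\varphi=1/(1+|s|)$, the derivative of
$w^2\varphi\gamma$ is at most $(2w'^2-\frac12w^2)\gamma$ on the half-line, and the
boundary terms have the right sign because $w$ vanishes at the origin. The sign [e]
tells the half-line. *)
Lemma poincare_half (e a c : R) (u u' : R -> R) : a < c -> e * e = 1 ->
    (forall s, a <= s <= c -> 0 <= e * s) ->
    e * ((u a - u 0) ^+ 2) <= 0 -> 0 <= e * ((u c - u 0) ^+ 2) ->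
    (forall s : R, is_derive s 1 u (u' s)) -> continuous u' ->
  (\int[leb]_(s in `[a, c]) ((u s - u 0) ^+ 2 * pdf s)%:E <=
   4%:E * \int[leb]_(s in `[a, c]) (u' s ^+ 2 * pdf s)%:E)%E.
Proof.
move=> ac ee es0 ea ecc du cu'.
have cu : continuous u.
  by move=> s; apply/differentiable_continuous/derivable1_diffP; case: (du s).
pose w s := u s - u 0.
have dw (s : R) : is_derive s 1 w (u' s).
  rewrite (_ : w = u + cst (- u 0))//.
  by apply: (is_derive_eq (is_deriveD (du s) (is_derive_cst _ _ _))); rewrite addr0.
have cw : continuous w by move=> s; apply: cvgB; [exact: cu|exact: cvg_cst].
have cpdf : continuous pdf by apply: continuous_normal_pdf; exact: oner_neq0.
pose F s := e * (w s ^+ 2 * pdf s / (1 + e * s)).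
pose F' s := e * ((2 * w s * u' s * pdf s - w s ^+ 2 * s * pdf s) / (1 + e * s)
   - w s ^+ 2 * pdf s * e / (1 + e * s) ^+ 2).
have pos s : a <= s <= c -> 0 < 1 + e * s by move=> /es0; lra.
have dF (s : R) : a <= s <= c -> is_derive s 1 F (F' s).
  move=> /pos s1; have n0 : 1 + e * s != 0 by rewrite gt_eqF.
  have d1 : is_derive s 1 (fun s => 1 + e * s) e.
    rewrite (_ : (fun s => _) = cst 1 + e \*: (id : R -> R))//.
    by apply: is_derive_eq; rewrite add0r /GRing.scale/= mulr1.
  pose q := fun s : R => 1 + e * s.
  have d2 := @is_deriveV _ q s e 1 n0 d1.
  have d3 := is_deriveM (is_deriveM (dw s) (dw s)) (is_derive_normal_pdf s).
  have d4 := is_deriveZ e (is_deriveM d3 d2).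
  rewrite (_ : F = e \*: (w * w * pdf * (fun s => (q s)^-1))); last first.
    by apply/funext => x; rewrite /F expr2.
  apply: (is_derive_eq d4); rewrite /F' /GRing.scale/=.
  rewrite !fctE/= /q; field.
  by rewrite n0.
have cinv s : a <= s <= c -> {for s, continuous (fun s => (1 + e * s)^-1)}.
  move=> /pos s1; apply: cvgV; first by rewrite gt_eqF.
  apply: cvgD; first exact: cvg_cst.
  by apply: cvgM; [exact: cvg_cst|exact: cvg_id].
have csq (f : R -> R) s : f x @[x --> s] --> f s -> f x ^+ 2 @[x --> s] --> f s ^+ 2.
  move=> cf; rewrite expr2 (_ : (fun x => f x ^+ 2) = (fun x => f x * f x)).
    exact: cvgM.
  by apply/funext => x; rewrite expr2.
have cF' : {in `[a, c], continuous F'}.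
  move=> s; rewrite in_itv/= => sac; rewrite /F'.
  have c1 := cinv s sac; have c2 := csq _ s (cw s).
  apply: cvgM; first exact: cvg_cst.
  apply: cvgB.
    apply: cvgM => //; apply: cvgB.
      do 2 (apply: cvgM; last by [exact: cpdf|exact: cu']).
      by apply: cvgM; [exact: cvg_cst|exact: cw].
    by apply: cvgM; [apply: cvgM; [exact: c2|exact: cvg_id]|exact: cpdf].
  apply: cvgM; first by apply: cvgM; [apply: cvgM; [exact: c2|exact: cpdf]|exact: cvg_cst].
  rewrite (_ : (fun x : R => _) = (fun s => ((1 + e * s)^-1) ^+ 2)); last first.
    by apply/funext => x; rewrite exprVn.
  by rewrite -exprVn; exact: csq.
have ftc := FTC_derive_in ac dF cF'.
have F0 : 0 <= F c - F a.
  have ac' := ltW ac.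
  have p1 := pos a; rewrite lexx ac' in p1; have {}p1 := p1 isT.
  have p2 := pos c; rewrite lexx ac' in p2; have {}p2 := p2 isT.
  rewrite subr_ge0; apply: (@le_trans _ _ 0).
    rewrite /F mulrA mulrA mulr_le0_ge0// ?invr_ge0 ?(ltW p1)//.
    by rewrite mulr_le0_ge0.
  rewrite /F mulrA mulrA mulr_ge0 ?invr_ge0 ?(ltW p2)//.
  by rewrite mulr_ge0.
pose A s := u' s ^+ 2 * pdf s; pose B s := w s ^+ 2 * pdf s.
have cA : continuous A by move=> s; apply: cvgM; [apply: csq; exact: cu'|exact: cpdf].
have cB : continuous B by move=> s; apply: cvgM; [apply: csq; exact: cw|exact: cpdf].
have int (f : R -> R) : continuous f -> leb.-integrable `[a, c] (EFin \o f).
  move=> cf; apply: continuous_compact_integrable; first exact: segment_compact.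
  exact: continuous_subspaceT.
have intF' : leb.-integrable `[a, c] (EFin \o F').
  apply: continuous_compact_integrable; first exact: segment_compact.
  by apply: continuous_in_subspaceT => s; rewrite inE => sac; exact: cF'.
have iA := int A cA; have iB := int B cB.
have fA : (\int[leb]_(s in `[a, c]) (A s)%:E)%E \is a fin_num by exact: integrable_fin_num iA.
have fB : (\int[leb]_(s in `[a, c]) (B s)%:E)%E \is a fin_num by exact: integrable_fin_num iB.
have key : (\int[leb]_(s in `[a, c]) (F' s)%:E <=
   \int[leb]_(s in `[a, c]) (2%:E * (A s)%:E - 2^-1%:E * (B s)%:E))%E.
  apply: le_integral => //.
    by apply: integrableB => //; apply: integrableZl.
  move=> s; rewrite inE/= in_itv/= => sac.
  rewrite -!EFinM -EFinB lee_fin /F' /A /B.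
  have := es0 s sac; have := pos s sac; set q := 1 + e * s => q0 s0.
  have sE : s = e * (q - 1) by rewrite /q addrAC subrr add0r mulrA ee mul1r.
  have q1 : 1 <= q by rewrite /q; lra.
  rewrite -subr_ge0.
  have -> : 2 * (u' s ^+ 2 * pdf s) - 2^-1 * (w s ^+ 2 * pdf s) -
     e * ((2 * w s * u' s * pdf s - w s ^+ 2 * s * pdf s) / q - w s ^+ 2 * pdf s * e / q ^+ 2)
    = pdf s * (2 * u' s ^+ 2 - 2^-1 * w s ^+ 2 - 2 * w s * (e * u' s) / q
        + w s ^+ 2 * (e * s) / q + w s ^+ 2 * (e * e) / q ^+ 2).
    by field; rewrite gt_eqF.
  apply: mulr_ge0 => //.
  have -> : e * s = q - 1 by rewrite /q; ring.
  rewrite ee mulr1.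
  have -> : 2 * u' s ^+ 2 - 2^-1 * w s ^+ 2 - 2 * w s * (e * u' s) / q
        + w s ^+ 2 * (q - 1) / q + w s ^+ 2 / q ^+ 2
     = 2 * (u' s ^+ 2) - 2 * (w s / q) * (e * u' s) + (w s / q) ^+ 2 * (2^-1 * q ^+ 2 - q + 1).
    by field; rewrite gt_eqF.
  have -> : u' s ^+ 2 = (e * u' s) ^+ 2 by rewrite exprMn (expr2 e) ee mul1r.
  set x := e * u' s; set y := w s / q.
  have := sqr_ge0 (2 * x - y); have := sqr_ge0 y; have := sqr_ge0 (q - 1).
  move=> h1 h2 h3; have := mulr_ge0 h1 h2; nra.
move: key; rewrite ftc integralB//; [|exact: integrableZl|exact: integrableZl].
rewrite !integralZl//.
rewrite -(fineK fA) -(fineK fB) -!EFinM -EFinB !lee_fin => h.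
by lra.
Qed.

End poincare.

Section gaussian_poincare.
Context {R : realType}.
Local Notation MR := (measurableTypeR R).
Local Notation gam := (@normal_prob R 0 1).
Local Notation pdf := (@normal_pdf R 0 1).
Local Notation leb := (@lebesgue_measure R).

Let pdf0 (s : R) : 0 <= pdf s := normal_pdf_ge0 0 1 s.

Lemma ge0_le_integral_expand (f : MR -> \bar R) (C : \bar R) :
    measurable_fun setT f -> (forall s, 0 <= f s)%E ->
    (forall b : R, 0 < b -> (\int[leb]_(s in `[(- b)%R, b]) f s <= C)%E) ->
  (\int[leb]_s f s <= C)%E.
Proof.
move=> mf f0 bd.
pose F (n : nat) : set MR := `[- n.+1%:R, n.+1%:R]%classic.
have FT : \bigcup_i F i = setT.
  apply/seteqP; split => // x _; have [n xn] := nat_above `|x|.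
  exists n => //; rewrite /F/= in_itv/= -ler_norml ltW// (lt_le_trans xn)//.
  by rewrite ler_nat.
rewrite -FT.
have ndF : nondecreasing_seq F.
  move=> m n mn; apply/subsetPset => x; rewrite /F/= !in_itv/= -!ler_norml => h.
  by rewrite (le_trans h)// ler_nat.
have cv := @ge0_nondecreasing_set_cvg_integral _ MR R F f leb ndF
  (fun i => measurable_itv _) (fun i => measurable_funTS mf) (fun i x _ => f0 x).
rewrite -(cvg_lim _ cv)//; apply: lime_le; first by apply/cvg_ex; exists (\int[leb]_(x in \bigcup_i F i) f x)%E.
by apply: nearW => n; apply: bd; rewrite ltr0n.
Qed.

(** Comparison with the value at the origin instead of the mean: [poincare_half] on
both half-lines. *)
Lemma poincare_origin (u u' : R -> R) :
    (forall s : R, is_derive s 1 u (u' s)) -> continuous u' ->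
  (\int[gam]_s ((u s - u 0) ^+ 2)%:E <= 4%:E * \int[gam]_s (u' s ^+ 2)%:E)%E.
Proof.
move=> du cu'.
have cu : continuous u.
  by move=> s; apply/differentiable_continuous/derivable1_diffP; case: (du s).
have mu_ : measurable_fun setT (u : MR -> R) by exact: continuous_measurable_fun.
have mu' : measurable_fun setT (u' : MR -> R) by exact: continuous_measurable_fun.
have mw : measurable_fun setT (fun s : MR => ((u s - u 0) ^+ 2)).
  by apply: measurable_funX; apply: measurable_funB.
have mu2 : measurable_fun setT (fun s : MR => u' s ^+ 2) by exact: measurable_funX.
have mpdf : measurable_fun setT (pdf : MR -> R) by exact: measurable_normal_pdf.
rewrite !ge0_integral_normal//; last 4 first.
- exact/measurable_EFinP.
- by move=> s; rewrite lee_fin sqr_ge0.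
- exact/measurable_EFinP.
- by move=> s; rewrite lee_fin sqr_ge0.
pose W (s : R) := ((u s - u 0) ^+ 2 * pdf s)%:E.
pose D (s : R) := (u' s ^+ 2 * pdf s)%:E.
have W0 s : (0 <= W s)%E by rewrite lee_fin mulr_ge0// sqr_ge0.
have D0 s : (0 <= D s)%E by rewrite lee_fin mulr_ge0// sqr_ge0.
have mW : measurable_fun setT (W : MR -> \bar R).
  by apply/measurable_EFinP; exact: measurable_funM.
have mD : measurable_fun setT (D : MR -> \bar R).
  by apply/measurable_EFinP; exact: measurable_funM.
apply: (@ge0_le_integral_expand W) => // b b0.
have b0' : (BLeft (- b) <= BLeft 0)%O by rewrite bnd_simp; lra.
have b0'' : (BLeft 0 <= BRight b)%O by rewrite bnd_simp; lra.
have split (f : R -> \bar R) : measurable_fun setT (f : MR -> \bar R) ->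
    (forall s, 0 <= f s)%E ->
    (\int[leb]_(s in `[(- b)%R, b]) f s =
      \int[leb]_(s in `[(- b)%R, 0%R[) f s + \int[leb]_(s in `[0%R, b]) f s)%E.
  move=> mf f0; rewrite (itv_bndbnd_setU b0' b0'') ge0_integral_setU//.
    exact: measurable_funTS.
  apply/disj_setPS => x [] /=; rewrite !in_itv/= => /andP[_ x0] /andP[x0' _].
  by move: x0; rewrite ltNge x0'.
have neg : (\int[leb]_(s in `[(- b)%R, 0%R[) W s <= 4%:E * \int[leb]_(s in `[(- b)%R, 0%R[) D s)%E.
  have h := @poincare_half R (-1) (- b) 0 u u'.
  rewrite !integral_itv_bndo_bndc.
  + apply: h => //.
    * lra.
    * lra.
    * by move=> s /andP[_ s0]; lra.
    * by have := sqr_ge0 (u (- b) - u 0); lra.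
    * by rewrite subrr expr0n mulr0.
  + by apply: measurable_funTS.
  + by apply: measurable_funTS.
have posi : (\int[leb]_(s in `[0%R, b]) W s <= 4%:E * \int[leb]_(s in `[0%R, b]) D s)%E.
  apply: (@poincare_half R 1 0 b u u') => //.
  * lra.
  * by move=> s /andP[s0 _]; lra.
  * by rewrite subrr expr0n mulr0.
  * by have := sqr_ge0 (u b - u 0); lra.
rewrite split//; apply: (@le_trans _ _ (4%:E * \int[leb]_(s in `[(- b)%R, b]) D s)%E).
  rewrite split// muleDr; [|by []|].
    exact: leeD.
  by apply: ge0_adde_def; rewrite inE; exact: integral_ge0.
apply: lee_wpmul2l => //.
by apply: ge0_subset_integral => //; exact: measurable_funTS.
Qed.

(** The constant is not optimal: a factor 2 comes from splitting the difference at the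
origin, another from the two resulting terms, and 4 from [poincare_origin]. *)
Lemma poincare_normal (u u' : R -> R) :
    (forall s : R, is_derive s 1 u (u' s)) -> continuous u' ->
  (oscillation gam u <= 16%:E * \int[gam]_s (u' s ^+ 2)%:E)%E.
Proof.
move=> du cu'.
have cu : continuous u.
  by move=> s; apply/differentiable_continuous/derivable1_diffP; case: (du s).
have mu_ : measurable_fun setT (u : MR -> R) by exact: continuous_measurable_fun.
pose w (s : MR) := ((u s - u 0) ^+ 2)%:E.
have mw : measurable_fun setT w.
  by apply/measurable_EFinP; apply: measurable_funX; exact: measurable_funB.
have w0 s : (0 <= w s)%E by rewrite lee_fin sqr_ge0.
have g1 : (\int[gam]_s 1 = 1)%E.
  by rewrite integral_cst// mul1e; exact: probability_setT.
have m2 s : measurable_fun setT (fun t : MR => ((u s - u t) ^+ 2)%:E).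
  by apply/measurable_EFinP; apply: measurable_funX; exact: measurable_funB.
set I := (\int[gam]_s w s)%E.
have I0 : (0 <= I)%E by exact: integral_ge0.
have mw2 := measurable_funeM 2%:E mw.
have step s : (\int[gam]_t ((u s - u t) ^+ 2)%:E <= 2%:E * w s + 2%:E * I)%E.
  apply: (@le_trans _ _ (\int[gam]_t (2%:E * w s + 2%:E * w t)%E)%E).
    apply: ge0_le_integral => //.
    - by move=> t _; rewrite lee_fin sqr_ge0.
    - by apply: emeasurable_funD => //; exact: measurable_cst.
    - move=> t _; rewrite -!EFinM -EFinD lee_fin.
      by have := sqr_ge0 ((u s - u 0) + (u t - u 0)); nra.
  rewrite ge0_integralD//; last 2 first.
  - by move=> t _; rewrite mule_ge0.
  - by move=> t _; rewrite mule_ge0.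
  rewrite integral_cst// (_ : _ * _ setT = 2%:E * w s)%E ?ge0_integralZl//.
  by rewrite -[RHS]mule1; congr (_ * _)%E; exact: probability_setT.
rewrite /oscillation; apply: (@le_trans _ _ (\int[gam]_s (2%:E * w s + 2%:E * I)%E)%E).
  apply: ge0_le_integral => //.
  - by move=> s _; apply: integral_ge0 => t _; rewrite lee_fin sqr_ge0.
  - apply: (measurable_fun_fubini_tonelli_F (fun q : MR * MR => ((u q.1 - u q.2) ^+ 2)%:E)).
      apply/measurable_EFinP; apply: measurable_funX; apply: measurable_funB.
        by apply: (measurableT_comp mu_); exact: measurable_fst.
      by apply: (measurableT_comp mu_); exact: measurable_snd.
    by move=> q; rewrite lee_fin sqr_ge0.
  - by apply: emeasurable_funD => //; exact: measurable_cst.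
rewrite ge0_integralD//; last 2 first.
- by move=> t _; rewrite mule_ge0.
- by move=> t _; rewrite mule_ge0.
rewrite integral_cst// (_ : _ * _ setT = 2%:E * I)%E ?ge0_integralZl//; last first.
  by rewrite -[RHS]mule1; congr (_ * _)%E; exact: probability_setT.
have h := poincare_origin du cu'; rewrite -/I in h.
set J := (\int[gam]_s (u' s ^+ 2)%:E)%E in h *.
have J0 : (0 <= J)%E by apply: integral_ge0 => s _; rewrite lee_fin sqr_ge0.
apply: (@le_trans _ _ (2%:E * (4%:E * J) + 2%:E * (4%:E * J)))%E.
  by apply: leeD; exact: lee_wpmul2l.
rewrite !muleA -ge0_muleDl ?lee_fin//.
by rewrite le_eqVlt; apply/orP; left; apply/eqP; congr (_ * _)%E; rewrite -!EFinM -EFinD; congr EFin; lra.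
Qed.

End gaussian_poincare.

Section cube_poincare.
Context {R : realType}.
Local Notation MR := (measurableTypeR R).
Local Notation gam := (@normal_prob R 0 1).

Let gamT : gam setT = 1%E. Proof. exact: probability_setT. Qed.

Lemma square_gamT : square_measure gam setT = 1%E.
Proof.
rewrite /square_measure -setXTT product_measure1E//.
transitivity (1 * 1 : \bar R)%E; last by rewrite mule1.
by congr (_ * _)%E; exact: gamT.
Qed.

(** Two applications of [poincare_tensor] to the bound on each axis, whence
$64=2\cdot2\cdot16$. *)
Lemma poincare_cube (g : R3 R -> R) (d : 'I_3 -> R3 R -> R) :
    continuous g -> (forall i, continuous (d i)) ->
    (forall i x, is_derive x (basis3 i : R3 R) g (d i x)) ->
  (oscillation (cube_measure gam) g <=
   64%:E * \int[cube_measure gam]_x (\sum_(i < 3) d i x ^+ 2)%:E)%E.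
Proof.
move=> cg cd dg.
have mg : measurable_fun setT g by exact: continuous_measurable3.
have md i : measurable_fun setT (d i) by exact: continuous_measurable3.
pose D i (x : R3 R) := (d i x ^+ 2)%:E.
have mD i : measurable_fun setT (D i) by apply/measurable_EFinP; exact: measurable_funX.
have D0 i x : (0 <= D i x)%E by rewrite lee_fin sqr_ge0.
have line i (q : R3 R) (h : R -> R3 R) : (forall s, h s = q + (s - 0) *: basis3 i) ->
    (oscillation gam (fun s => g (h s)) <= 16%:E * \int[gam]_s D i (h s))%E.
  move=> hE; rewrite (_ : h = fun s => q + (s - 0) *: basis3 i); last exact/funext.
  by apply: poincare_normal; [exact: is_derive_line|exact: continuous_line].
have line0 (x2 b : R) : (oscillation gam (fun s : MR => g (s, x2, b)) <=
    16%:E * \int[gam]_s D 0%R (s, x2, b))%E.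
  apply: (line 0 (0, x2, b)) => s; rewrite subr0 /basis3/=.
  by congr (_, _, _); rewrite /= /GRing.scale/= ?mulr0 ?mulr1 ?add0r ?addr0.
have line1 (x1 b : R) : (oscillation gam (fun s : MR => g (x1, s, b)) <=
    16%:E * \int[gam]_s D 1%R (x1, s, b))%E.
  apply: (line 1 (x1, 0, b)) => s; rewrite subr0 /basis3/=.
  by congr (_, _, _); rewrite /= /GRing.scale/= ?mulr0 ?mulr1 ?add0r ?addr0.
have line2 (x1 x2 : R) : (oscillation gam (fun s : MR => g (x1, x2, s)) <=
    16%:E * \int[gam]_s D (inord 2) (x1, x2, s))%E.
  apply: (line (inord 2) (x1, x2, 0)) => s; rewrite subr0 /basis3 inordK//=.
  by congr (_, _, _); rewrite /= /GRing.scale/= ?mulr0 ?mulr1 ?add0r ?addr0.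
have mslice (F : R3 R -> \bar R) (b : MR) : measurable_fun setT F ->
    measurable_fun setT (fun a : MR * MR => F (a, b)).
  by move=> mF; apply: (measurableT_comp mF); exact: measurable_fun_pair.
have osc2 (b : MR) : (oscillation (square_measure gam) (fun a => g (a, b)) <=
    32%:E * \int[square_measure gam]_a (D 0%R (a, b) + D 1%R (a, b)))%E.
  have -> : (32%:E = (2 * 16)%R%:E :> \bar R)%E by congr (_%:E); lra.
  apply: (@poincare_tensor _ _ _ _ _ gam gamT gam gamT (square_measure gam)) => //; try by [apply: mslice|apply: (measurableT_comp mg); exact: measurable_fun_pair].
have -> : (64%:E = (2 * 32)%R%:E :> \bar R)%E by congr (_%:E); lra.
rewrite (eq_integral (fun x => (D 0%R x + D 1%R x) + D (inord 2) x)%E); last first.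
  move=> x _; rewrite /D -!EFinD; congr EFin; rewrite !big_ord_recl big_ord0 addr0 addrA.
  by congr (_ + _ + _); congr (d _ x ^+ 2); apply/val_inj; rewrite /= ?inordK.
apply: (@poincare_tensor _ _ _ _ _ (square_measure gam) square_gamT gam gamT
  (cube_measure gam)) => //.
- exact: emeasurable_funD.
- by move=> p; exact: adde_ge0.
- move=> a; apply: (@le_trans _ _ (16%:E * \int[gam]_b D (inord 2) (a, b))%E).
    by case: a => a1 a2; exact: line2.
  by apply: lee_wpmul2r; [exact: integral_ge0|rewrite lee_fin; lra].
Qed.

End cube_poincare.

(** * Square-summable families of coefficients *)

Section square_summable.
Context {R : realType}.
Implicit Types a d : nat -> R.

Lemma sqr_sum_le (I : finType) (a b : I -> R) :
  (\sum_i a i * b i) ^+ 2 <= (\sum_i a i ^+ 2) * (\sum_i b i ^+ 2).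
Proof.
have : 0 <= \sum_i \sum_j (a i * b j - a j * b i) ^+ 2.
  by apply: sumr_ge0 => i _; apply: sumr_ge0 => j _; exact: sqr_ge0.
rewrite expr2 !big_distrlr/=.
have -> : \sum_i \sum_j (a i * b j - a j * b i) ^+ 2 =
    \sum_i \sum_j a i ^+ 2 * b j ^+ 2 + \sum_i \sum_j a j ^+ 2 * b i ^+ 2
    - 2 * \sum_i \sum_j a i * b i * (a j * b j).
  rewrite mulr_sumr -big_split -sumrB/=; apply: eq_bigr => i _.
  rewrite mulr_sumr -big_split -sumrB/=; apply: eq_bigr => j _; ring.
rewrite [X in _ + X - _]exchange_big/=; lra.
Qed.

Lemma finite_cauchy_schwarz a d (A D : R) n : 0 <= A -> 0 <= D ->
    \sum_(i < n) a i ^+ 2 <= A ^+ 2 -> \sum_(i < n) d i ^+ 2 <= D ^+ 2 ->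
  `|\sum_(i < n) a i * d i| <= A * D.
Proof.
move=> A0 D0 hA hD; rewrite -(@ler_pXn2r _ 2)// ?nnegrE ?mulr_ge0//.
rewrite real_normK ?num_real// exprMn; apply: (le_trans (sqr_sum_le _ _)).
by apply: ler_pM => //; apply: sumr_ge0 => i _; exact: sqr_ge0.
Qed.

(** The scalar product of two square-summable sequences. *)
Definition pairing a d : R := limn (series (fun n => a n * d n)).

Section summable.
Context {a d : nat -> R} {A D : R}.
Hypothesis hA : forall n, \sum_(i < n) a i ^+ 2 <= A.
Hypothesis hD : forall n, \sum_(i < n) d i ^+ 2 <= D.

Lemma pairing_cvg : series (fun n => a n * d n) @ \oo --> pairing a d.
Proof.
apply: normed_cvg; apply: nondecreasing_is_cvgn.
  by apply: nondecreasing_series => n _ _; exact: normr_ge0.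
exists (A + D) => _ [n _ <-]; rewrite /= seriesEord /=.
apply: le_trans (lerD (hA n) (hD n)); rewrite -big_split/=; apply: ler_sum => i _.
rewrite normrM -[X in _ <= X + _]real_normK ?num_real// -[X in _ <= _ + X]real_normK ?num_real//.
have := sqr_ge0 (`|a i| - `|d i|); have := sqr_ge0 (`|a i| + `|d i|).
by rewrite sqrrB sqrrD; lra.
Qed.

End summable.

Lemma pairing_le a d (A D : R) : 0 <= A -> 0 <= D ->
    (forall n, \sum_(i < n) a i ^+ 2 <= A ^+ 2) ->
    (forall n, \sum_(i < n) d i ^+ 2 <= D ^+ 2) ->
  `|pairing a d| <= A * D.
Proof.
move=> A0 D0 hA hD; have c := pairing_cvg hA hD.
have {}c : (fun n => `|series (fun n => a n * d n) n|) @ \oo --> `|pairing a d|.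
  exact: cvg_norm.
rewrite -(cvg_lim _ c)//.
apply: limr_le; first by apply/cvg_ex; exists `|pairing a d|.
by apply: nearW => n; rewrite /= seriesEord finite_cauchy_schwarz.
Qed.

End square_summable.

Section enumerated_family.
Context {R : realType} {V : lmodType R} {ip : V -> V -> R}.
Context (sip : semi_inner ip) {I : countType} (e : I -> V).

(** Coefficients of [u] along a family indexed by a countable type, read along
the enumeration of that type. *)
Definition coef (F : I -> R) (n : nat) : R :=
  if pickle_inv n is Some k then F k else 0.

(** Indices of the enumeration that code no element are given the vector zero. *)
Lemma bessel_enum (K : R) n u : 0 < K ->
    (forall k l, k != l -> ip (e k) (e l) = 0) ->
    (forall k, ip (e k) (e k) <= K) ->
  \sum_(j < n) coef (fun k => ip u (e k)) j ^+ 2 <= K * ip u u.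
Proof.
move=> K0 orth eK.
pose f j := if pickle_inv j is Some k then e k else 0.
have <- : \sum_(j < n) ip u (f j) ^+ 2 = \sum_(j < n) coef (fun k => ip u (e k)) j ^+ 2.
  apply: eq_bigr => j _; rewrite /f /coef; case: (pickle_inv (T:=I) j) => //.
  by rewrite (sip0r sip).
apply: (bessel sip) => //.
- move=> i j ij; rewrite /f; case Ei: (pickle_inv i) => [k|]; last by rewrite (sip0l sip).
  case Ej: (pickle_inv j) => [l|]; last by rewrite (sip0r sip).
  apply: orth; apply: contra ij => /eqP kl.
  have := @pickle_invK I i; have := @pickle_invK I j; rewrite Ei Ej/= kl.
  by move=> <- <-.
- move=> i; rewrite /f; case: (pickle_inv i) => [k|] //.
  by rewrite (sip0l sip) (ltW K0).
Qed.

Lemma sum_coef_at (z : I) (F : I -> R) N :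
  \sum_(n < N) coef (fun k => (k == z)%:R * F k) n ^+ 2 <= F z ^+ 2.
Proof.
have E n : n != pickle z -> coef (fun k => (k == z)%:R * F k) n = 0.
  move=> nz; rewrite /coef; case E: (pickle_inv n) => [k|//].
  have [kz|_] := eqVneq k z; last by rewrite mul0r.
  by case/eqP: nz; have := @pickle_invK I n; rewrite E /= kz.
have [lt|ge] := ltnP (pickle z) N.
  rewrite (bigD1 (Ordinal lt))//= big1 ?addr0 => [|n nz]; last first.
    by rewrite E ?expr0n.
  by rewrite /coef pickleK_inv eqxx mul1r.
rewrite big1 ?sqr_ge0// => n _; rewrite E ?expr0n//.
by rewrite neq_ltn (leq_trans (ltn_ord n) ge).
Qed.

End enumerated_family.

(** * The macroscopic correction of the energy *)

Section correction.
Context {R : realType}.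
Local Notation P := (R3 R * R3 R)%type.
Local Notation Z3 := (int * int * int)%type.
Local Notation ip := (@ip2 _ _ R (@phase_measure R)).
Local Notation N := (snorm ip).
Implicit Types (u w : L2 R) (k l : Z3).

Let sip : semi_inner ip := semi_inner_ip2 _.

Definition square_integrable (f : P -> R) :=
  measurable_fun setT f /\ (\int[@phase_measure R]_p (f p ^+ 2)%:E < +oo)%E.

Definition toL2 (f : P -> R) : L2 R := insubd (0 : L2 R) f.

Lemma toL2E f : square_integrable f -> toL2 f = f :> (P -> R).
Proof. by move=> [mf fin]; rewrite /toL2 (insubdK (0 : L2 R))//; exact: Lfun2P. Qed.

Lemma bm_square_integrable f : bounded_measurable f -> square_integrable f.
Proof.
move=> bf; split; first by case: bf.
have bf2 := bmM bf bf.
by rewrite (eq_integral (fun p => (f p * f p)%:E)) -?meanE ?ltry.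
Qed.

Lemma ip_toL2 u f : square_integrable f -> ip u (toL2 f) = mean (fun p => u p * f p).
Proof. by move=> sf; rewrite /ip2 (toL2E sf). Qed.

Definition velocity_moment (i : 'I_3) : R :=
  fine (\int[@gaussian R]_v (coord3 v i ^+ 2)%:E).

Lemma velocity_moment_ge0 i : 0 <= velocity_moment i.
Proof. by apply: fine_ge0; apply: integral_ge0 => v _; rewrite lee_fin sqr_ge0. Qed.

Definition vmode (i : 'I_3) k (p : P) : R := coord3 p.2 i * mode k p.

Let mcoord i : measurable_fun setT (fun v : R3 R => coord3 v i).
Proof. by apply: continuous_measurable3; exact: continuous_coord3. Qed.

Lemma vmode_square_integrable i k : square_integrable (vmode i k).
Proof.
have mf : measurable_fun setT (vmode i k).
  by have [c _] := cpM (@cp_v R i) (@cp_mode R k); exact: continuous_measurable6 c.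
split => //.
apply: (@le_lt_trans _ _ (\int[@phase_measure R]_p (4 * coord3 p.2 i ^+ 2)%:E)%E).
  apply: ge0_le_integral => //.
  - by move=> p _; rewrite lee_fin sqr_ge0.
  - by apply/measurable_EFinP; exact: measurable_funX.
  - apply/measurable_EFinP; apply: measurable_funM => //; apply: measurable_funX.
    by apply: (measurableT_comp (mcoord i)); exact: measurable_snd.
  move=> p _; rewrite lee_fin /vmode exprMn mulrC ler_wpM2r ?sqr_ge0//.
  have := mode_le2 k p; rewrite ler_norml => /andP[h1 h2].
  by nra.
rewrite /phase_measure (@integral_prodM _ _ _ _ _ _ _ (fun=> 4) (fun v : R3 R => coord3 v i ^+ 2))//.
rewrite lte_mul_pinfty//.
- by apply: integral_ge0 => x _; rewrite lee_fin.
- by rewrite integral_cst// fin_numM//; exact: fin_num_measure.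
- exact: gaussian_second_moment.
- exact: measurable_funX.
- by move=> v; exact: sqr_ge0.
Qed.

Definition emode k : L2 R := toL2 (mode k).
Definition evmode i k : L2 R := toL2 (vmode i k).

Lemma mode_square_integrable k : square_integrable (mode k : P -> R).
Proof. exact/bm_square_integrable/bm_mode. Qed.

Lemma ip_emode k l : ip (emode k) (emode l) = (k == l)%:R * volume.
Proof.
rewrite ip_toL2 /emode ?(toL2E (mode_square_integrable _)); last exact: mode_square_integrable.
exact: mean_modeM.
Qed.

(** The velocity and the position are independent, so the orthogonality of the modes
carries over. *)
Lemma ip_evmode i k l :
  ip (evmode i k) (evmode i l) = (k == l)%:R * (volume * velocity_moment i).
Proof.
rewrite ip_toL2 /evmode ?(toL2E (vmode_square_integrable _ _)); last exact: vmode_square_integrable.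
have [mk [Mk hk]] := @bm_mode R k; have [ml [Ml hl]] := @bm_mode R l.
pose F (x : R3 R) := mode k (x, 0 : R3 R) * mode l (x, 0 : R3 R).
rewrite (@eq_mean _ _ (fun p => F p.1 * (coord3 p.2 i ^+ 2))); last first.
  by move=> -[x v]; rewrite /vmode /F /mode /=; ring.
rewrite (@mean_separated _ F (fun v => coord3 v i ^+ 2) (Mk * Ml)).
- rewrite mulrA -mean_modeM; congr (_ * _).
- apply: measurable_funM.
    by apply: (measurableT_comp mk); exact: measurable_fun_pair.
  by apply: (measurableT_comp ml); exact: measurable_fun_pair.
- by move=> x; rewrite normrM ler_pM.
- exact: measurable_funX.
- by move=> v; exact: sqr_ge0.
- exact: gaussian_second_moment.
Qed.

Lemma freq_zero k i : k = 0 -> freq k i = 0.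
Proof.
move=> k0; have := freqD k k i; rewrite {1 2}k0 addr0 -k0 => /eqP.
by rewrite -subr_eq0 opprD addNKr oppr_eq0 => /eqP.
Qed.

Definition freq2 k : R := \sum_(i < 3) (freq k i)%:~R ^+ 2.

Lemma freq2_ge1 k : k != 0 -> 1 <= freq2 k.
Proof.
move=> k0; have [i ki] : exists i, freq k i != 0.
  apply: contrapT => h; move/eqP : k0; apply; apply: freq_eq0 => i.
  by apply/eqP/negPn/negP => hi; apply: h; exists i.
rewrite /freq2 (bigD1 i)//= ler_wpDr ?sumr_ge0// => [j _|]; first exact: sqr_ge0.
rewrite -rmorphXn/= -[1]/(1%:~R) ler_int.
by rewrite -gtz0_ge1 exprn_even_gt0// ki.
Qed.

Definition density u k : R := ip u (emode k).

(** Up to sign, the mode $k$ of $\Delta^{-1}\nabla_x\cdot j$, where $j$ is the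
current; it vanishes for $k=0$. *)
Definition potential u k : R :=
  (\sum_(i < 3) (freq k i)%:~R * ip u (evmode i (- k))) / freq2 k.

(** A common bound of the squared norms of the [evmode i k], made positive by the
added 1. *)
Definition velocity_bound : R := 1 + \sum_i volume * velocity_moment i.

Lemma velocity_bound_gt0 : 0 < velocity_bound.
Proof.
rewrite ltr_wpDr// sumr_ge0// => i _.
by rewrite mulr_ge0 ?velocity_moment_ge0// (ltW volume_gt0).
Qed.

Lemma bessel_density (s : Z3 -> Z3) n u : injective s ->
  \sum_(j < n) coef (fun k => density u (s k)) j ^+ 2 <= volume * ip u u.
Proof.
move=> si; apply: (bessel_enum sip (e := fun k => emode (s k))); first exact: volume_gt0.
  by move=> k l kl; rewrite ip_emode (inj_eq si) (negbTE kl) mul0r.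
by move=> k; rewrite ip_emode eqxx mul1r.
Qed.

Lemma bessel_current (s : Z3 -> Z3) i n u : injective s ->
  \sum_(j < n) coef (fun k => ip u (evmode i (s k))) j ^+ 2 <= velocity_bound * ip u u.
Proof.
move=> si; apply: (bessel_enum sip (e := fun k => evmode i (s k))).
- exact: velocity_bound_gt0.
- by move=> k l kl; rewrite ip_evmode (inj_eq si) (negbTE kl) mul0r.
move=> k; rewrite ip_evmode eqxx mul1r /velocity_bound (bigD1 i)//=.
rewrite addrCA lerDl addr_ge0// sumr_ge0// => j _.
by rewrite mulr_ge0 ?velocity_moment_ge0// (ltW volume_gt0).
Qed.

Lemma potential_sqr_le u k : potential u k ^+ 2 <= \sum_i ip u (evmode i (- k)) ^+ 2.
Proof.
have s0 : 0 <= \sum_i ip u (evmode i (- k)) ^+ 2 by apply: sumr_ge0 => i _; exact: sqr_ge0.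
rewrite /potential; have [k0|k0] := eqVneq k 0.
  by rewrite big1 ?mul0r ?expr0n// => i _; rewrite freq_zero ?mul0r.
have q1 := freq2_ge1 k0.
have q0 : 0 < freq2 k by lra.
rewrite expr_div_n ler_pdivrMr ?exprn_gt0//.
have cs : (\sum_(i < 3) (freq k i)%:~R * ip u (evmode i (- k))) ^+ 2 <=
    freq2 k * \sum_i ip u (evmode i (- k)) ^+ 2.
  exact: sqr_sum_le.
apply: (le_trans cs); rewrite mulrC ler_wpM2l// expr2 ler_peMl//; lra.
Qed.

Lemma bessel_potential n u :
  \sum_(j < n) coef (potential u) j ^+ 2 <= 3 * velocity_bound * ip u u.
Proof.
apply: (@le_trans _ _ (\sum_(j < n) \sum_i
    coef (fun k => ip u (evmode i (- k))) j ^+ 2)).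
  apply: ler_sum => j _; rewrite /coef; case: (pickle_inv _) => [k|].
    exact: potential_sqr_le.
  by rewrite expr0n/= sumr_ge0// => i _; exact: sqr_ge0.
rewrite exchange_big/=; apply: (@le_trans _ _ (\sum_(i < 3) velocity_bound * ip u u)).
  by apply: ler_sum => i _; apply: bessel_current; exact: oppr_inj.
by rewrite sumr_const card_ord -mulrA mulr_natl.
Qed.

(** A discrete form of the scalar product of the density with the potential of the
current, as in the method of Dolbeault, Mouhot and Schmeiser. *)
Definition correction u w : R := pairing (coef (density u)) (coef (potential w)).

Definition correction_bound : R :=
  Num.sqrt volume * Num.sqrt (3 * velocity_bound).

Let V0 : (0 : R) <= volume. Proof. exact/ltW/volume_gt0. Qed.
Let W0 : 0 <= 3 * velocity_bound.
Proof. by rewrite mulr_ge0// ltW// velocity_bound_gt0. Qed.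

Lemma correction_cvg u w :
  series (fun n => coef (density u) n * coef (potential w) n) @ \oo --> correction u w.
Proof.
have hd n : \sum_(j < n) coef (density u) j ^+ 2 <= volume * ip u u.
  exact: (@bessel_density id).
exact: (pairing_cvg hd (fun n => bessel_potential n w)).
Qed.

Lemma coef_lin (a : R) (F G H : Z3 -> R) n : (forall k, H k = a * F k + G k) ->
  coef H n = a * coef F n + coef G n.
Proof. by rewrite /coef => h; case: (pickle_inv n) => [k|]//; rewrite mulr0 addr0. Qed.

Lemma density_lin (a : R) u w k : density (a *: u + w) k = a * density u k + density w k.
Proof. by rewrite /density (sipDl sip) (sipZl sip). Qed.

Lemma potential_lin (a : R) u w k :
  potential (a *: u + w) k = a * potential u k + potential w k.
Proof.
rewrite /potential mulrA -mulrDl mulr_sumr -big_split/=; congr (_ / _).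
by apply: eq_bigr => i _; rewrite (sipDl sip) (sipZl sip); ring.
Qed.

Lemma correction_linl (a : R) u v w :
  correction (a *: u + v) w = a * correction u w + correction v w.
Proof.
rewrite -(cvg_lim _ (@correction_cvg (a *: u + v) w))//; apply: cvg_lim => //.
have -> : series (fun n => coef (density (a *: u + v)) n * coef (potential w) n) =
  (fun n => a * series (fun n => coef (density u) n * coef (potential w) n) n
     + series (fun n => coef (density v) n * coef (potential w) n) n).
  apply/funext => n; rewrite !seriesEord mulr_sumr -big_split/=; apply: eq_bigr => i _.
  by rewrite (coef_lin _ (density_lin a u v)); ring.
by apply: cvgD; [apply: cvgM; [exact: cvg_cst|]|]; exact: correction_cvg.
Qed.

Lemma correction_linr (a : R) u v w :
  correction w (a *: u + v) = a * correction w u + correction w v.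
Proof.
rewrite -(cvg_lim _ (@correction_cvg w (a *: u + v)))//; apply: cvg_lim => //.
have -> : series (fun n => coef (density w) n * coef (potential (a *: u + v)) n) =
  (fun n => a * series (fun n => coef (density w) n * coef (potential u) n) n
     + series (fun n => coef (density w) n * coef (potential v) n) n).
  apply/funext => n; rewrite !seriesEord mulr_sumr -big_split/=; apply: eq_bigr => i _.
  by rewrite (coef_lin _ (potential_lin a u v)); ring.
by apply: cvgD; [apply: cvgM; [exact: cvg_cst|]|]; exact: correction_cvg.
Qed.

Lemma correction_bounded : bounded_bilinear ip correction correction_bound.
Proof.
have z w : correction 0 w = 0 by have := correction_linl (-1) 0 0 w; rewrite scaler0 addr0; lra.
have z' w : correction w 0 = 0 by have := correction_linr (-1) 0 0 w; rewrite scaler0 addr0; lra.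
split.
- by move=> u v w; rewrite -[u in LHS]scale1r correction_linl mul1r.
- by move=> a u w; rewrite -[a *: u]addr0 correction_linl z addr0.
- by move=> u v w; rewrite -[v in LHS]scale1r correction_linr mul1r.
- by move=> a u w; rewrite -[a *: w]addr0 correction_linr z' addr0.
move=> u w; rewrite /correction_bound mulrACA; apply: pairing_le.
- by rewrite mulr_ge0 ?sqrtr_ge0// snorm_ge0.
- by rewrite mulr_ge0 ?sqrtr_ge0// snorm_ge0.
- by move=> n; rewrite exprMn sqr_sqrtr// (snorm_sqr sip); exact: (@bessel_density id).
- by move=> n; rewrite exprMn sqr_sqrtr// (snorm_sqr sip); exact: bessel_potential.
Qed.

End correction.

(** * Fejer averages *)

Section fejer.
Context {R : realType}.
Local Notation P := (R3 R * R3 R)%type.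
Local Notation Z3 := (int * int * int)%type.
Implicit Types (x y : R3 R) (k l m : Z3) (f g : P -> R).

Definition cos_diff m x y : R := cos (wave m x - wave m y).

Lemma cos_diffE m x y : cos_diff m x y =
  cos (wave m x) * cos (wave m y) + sin (wave m x) * sin (wave m y).
Proof. by rewrite /cos_diff cosB. Qed.

Lemma waveB k l x : wave (k - l) x = wave k x - wave l x.
Proof. by rewrite waveD waveN. Qed.

Lemma bm_cos_diff m x : bounded_measurable (fun q : P => cos_diff m x q.1).
Proof.
under eq_fun do rewrite cos_diffE.
by apply: bmD; apply: bmZ; [exact: bm_cos_wave|exact: bm_sin_wave].
Qed.

Lemma mean_cos_diffM m x g : bounded_measurable g ->
  mean (fun q => cos_diff m x q.1 * g q) =
    cos (wave m x) * mean (fun q => cos (wave m q.1) * g q)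
    + sin (wave m x) * mean (fun q => sin (wave m q.1) * g q).
Proof.
move=> bg.
have bc : bounded_measurable (fun q : P => cos (wave m q.1) * g q).
  by apply: bmM => //; exact: bm_cos_wave.
have bs : bounded_measurable (fun q : P => sin (wave m q.1) * g q).
  by apply: bmM => //; exact: bm_sin_wave.
rewrite -!meanZ// -meanD; [|exact: bmZ|exact: bmZ].
by apply: eq_mean => q; rewrite cos_diffE; ring.
Qed.

Lemma mean_cos_diff m x : mean (fun q => cos_diff m x q.1) = (m == 0)%:R * volume.
Proof.
rewrite -(@eq_mean _ (fun q => cos_diff m x q.1 * 1)); last by move=> q; rewrite mulr1.
rewrite mean_cos_diffM; last exact: bm_cst.
rewrite (@eq_mean _ _ (fun q => cos (wave m q.1))); last by move=> q; rewrite mulr1.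
rewrite [X in _ + _ * X](@eq_mean _ _ (fun q => sin (wave m q.1))); last first.
  by move=> q; rewrite mulr1.
rewrite mean_cos_wave mean_sin_wave mulr0 addr0.
by case: eqP => [->|_]; rewrite ?wave0 ?cos0 ?mul1r ?mul0r ?mulr0.
Qed.

Section box.
Variable L : nat.
Hypothesis L0 : (0 < L)%N.
Local Notation box := {ffun 'I_3 -> 'I_L}.
Implicit Types (a b : box).

Definition box_freq a : Z3 := (Posz (a ord0), Posz (a (inord 1)), Posz (a (inord 2))).

Lemma freq_box a i : freq (box_freq a) i = Posz (a i).
Proof.
case: i => -[|[|[|//]]] p; rewrite /freq !(tnth_nth 0)/=; congr (Posz (a _));
  by apply/val_inj; rewrite /= ?inordK.
Qed.

Lemma freq_inj k l : (forall i, freq k i = freq l i) -> k = l.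
Proof.
move=> h; apply/eqP; rewrite -subr_eq0; apply/eqP; apply: freq_eq0 => i.
by rewrite freqD freqN h subrr.
Qed.

Lemma box_freq_inj : injective box_freq.
Proof.
move=> a b ab; apply/ffunP => i; apply/val_inj/eqP.
by rewrite -eqz_nat -!freq_box ab.
Qed.

Definition box_diff (ab : box * box) : Z3 := box_freq ab.1 - box_freq ab.2.

Let n : R := (L ^ 3)%:R.

Let n0 : 0 < n. Proof. by rewrite ltr0n expn_gt0 L0. Qed.

Lemma card_box : #|{: box}| = (L ^ 3)%N.
Proof. by rewrite card_ffun !card_ord. Qed.

(** The tensor product of three Fejer kernels. *)
Definition fejer x y : R := n^-1 * \sum_(ab : box * box) cos_diff (box_diff ab) x y.

(** The double sum is the squared modulus of an exponential sum. *)
Lemma fejer_ge0 x y : 0 <= fejer x y.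
Proof.
rewrite /fejer mulr_ge0 ?invr_ge0 ?(ltW n0)//.
pose A a := wave (box_freq a) x - wave (box_freq a) y.
have -> : \sum_(ab : box * box) cos_diff (box_diff ab) x y =
    (\sum_a cos (A a)) ^+ 2 + (\sum_a sin (A a)) ^+ 2.
  rewrite !expr2 !big_distrlr/= !pair_bigA/= -big_split/=; apply: eq_bigr => -[a b] _.
  by rewrite /cos_diff -cosB /A !waveB; congr cos; rewrite /=; ring.
by rewrite addr_ge0// sqr_ge0.
Qed.

Lemma bm_fejer x : bounded_measurable (fun q : P => fejer x q.1).
Proof. by apply: bmZ; apply: bm_sum => ab; exact: bm_cos_diff. Qed.

(** Integration against the kernel. The result is a trigonometric polynomial, so that
double means over the phase space reduce to finite sums of products. *)
Definition fejer_op g (p : P) : R := mean (fun q => fejer p.1 q.1 * g q).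

Lemma fejer_opE g p : bounded_measurable g ->
  fejer_op g p = n^-1 * \sum_(ab : box * box)
    (mean (fun q => cos (wave (box_diff ab) q.1) * g q) * cos (wave (box_diff ab) p.1)
   + mean (fun q => sin (wave (box_diff ab) q.1) * g q) * sin (wave (box_diff ab) p.1)).
Proof.
move=> bg; have b1 ab : bounded_measurable (fun q : P => cos_diff (box_diff ab) p.1 q.1 * g q).
  by apply: bmM => //; exact: bm_cos_diff.
rewrite (eq_bigr (fun ab => mean (fun q => cos_diff (box_diff ab) p.1 q.1 * g q))); last first.
  by move=> ab _; rewrite mean_cos_diffM// ![mean _ * _]mulrC.
rewrite -mean_sum// -meanZ; last exact: bm_sum.
by apply: eq_mean => q; rewrite /fejer -mulrA mulr_suml.
Qed.

Lemma bm_fejer_op g : bounded_measurable g -> bounded_measurable (fejer_op g).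
Proof.
move=> bg; have /funext -> := fun p => fejer_opE p bg.
apply: bmZ; apply: bm_sum => ab; apply: bmD; apply: bmZ.
  exact: bm_cos_wave.
exact: bm_sin_wave.
Qed.

Lemma fejer_op1 p : fejer_op (fun=> 1) p = volume.
Proof.
rewrite /fejer_op (@eq_mean _ _ (fun q => n^-1 *
  \sum_(ab : box * box) cos_diff (box_diff ab) p.1 q.1)); last by move=> q; rewrite mulr1.
rewrite meanZ; last by apply: bm_sum => ab; exact: bm_cos_diff.
rewrite mean_sum; last by move=> ab; exact: bm_cos_diff.
rewrite (eq_bigr (fun ab : box * box => (ab.1 == ab.2)%:R * volume)); last first.
  by move=> ab _; rewrite mean_cos_diff subr_eq0 (inj_eq box_freq_inj).
rewrite -(pair_bigA _ (fun a b => (a == b)%:R * volume))/=.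
rewrite (eq_bigr (fun=> volume)).
  by rewrite sumr_const card_box -[volume *+ _]mulr_natl -/n mulKf// gt_eqF.
move=> a _; rewrite (bigD1 a)//= eqxx mul1r big1 ?addr0// => b ba.
by rewrite eq_sym (negbTE ba) mul0r.
Qed.

Lemma mean_fejer_op f g : bounded_measurable f -> bounded_measurable g ->
  mean (fun p => f p * fejer_op g p) = n^-1 * \sum_(ab : box * box)
    (mean (fun q => cos (wave (box_diff ab) q.1) * g q) *
     mean (fun q => cos (wave (box_diff ab) q.1) * f q)
   + mean (fun q => sin (wave (box_diff ab) q.1) * g q) *
     mean (fun q => sin (wave (box_diff ab) q.1) * f q)).
Proof.
move=> bf bg.
have bc ab : bounded_measurable (fun q : P => cos (wave (box_diff ab) q.1) * f q).
  by apply: bmM => //; exact: bm_cos_wave.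
have bs ab : bounded_measurable (fun q : P => sin (wave (box_diff ab) q.1) * f q).
  by apply: bmM => //; exact: bm_sin_wave.
pose c ab := mean (fun q => cos (wave (box_diff ab) q.1) * g q).
pose s ab := mean (fun q => sin (wave (box_diff ab) q.1) * g q).
rewrite [in RHS](eq_bigr (fun ab => mean (fun q =>
    c ab * (cos (wave (box_diff ab) q.1) * f q) + s ab * (sin (wave (box_diff ab) q.1) * f q)))).
  2: by move=> ab _; rewrite meanD ?meanZ//; exact: bmZ.
rewrite -mean_sum; last by move=> ab; apply: bmD; exact: bmZ.
rewrite -meanZ; last by apply: bm_sum => ab; apply: bmD; exact: bmZ.
apply: eq_mean => p; rewrite fejer_opE// mulrCA mulr_sumr; congr (_ * _).
by apply: eq_bigr => ab _; rewrite /c /s; ring.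
Qed.

(** The Cesaro average of the squared coefficients. *)
Definition fejer_energy f : R := n^-1 * \sum_(ab : box * box)
  mean (fun p => f p * mode (box_diff ab) p) ^+ 2.

Lemma mean_fejer_op_self f : bounded_measurable f ->
  mean (fun p => f p * fejer_op f p) = fejer_energy f.
Proof.
move=> bf; rewrite mean_fejer_op// /fejer_energy; congr (_ * _).
pose A m := mean (fun p => f p * mode m p).
have bA m : bounded_measurable (fun p => f p * mode m p).
  by apply: bmM => //; exact: bm_mode.
have cE m : mean (fun q => cos (wave m q.1) * f q) = 2^-1 * (A m + A (- m)).
  rewrite /A -meanD// -meanZ; last exact: bmD.
  by apply: eq_mean => p; rewrite cos_wave; field.
have sE m : mean (fun q => sin (wave m q.1) * f q) = 2^-1 * (A m - A (- m)).
  rewrite /A -meanB// -meanZ; last by apply: bmD => //; exact: bmN.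
  by apply: eq_mean => p; rewrite sin_wave; field.
transitivity (\sum_(ab : box * box) 2^-1 * (A (box_diff ab) ^+ 2 + A (- box_diff ab) ^+ 2)).
  by apply: eq_bigr => ab _; rewrite cE sE; field.
have swap : \sum_(ab : box * box) A (- box_diff ab) ^+ 2 =
    \sum_(ab : box * box) A (box_diff ab) ^+ 2.
  rewrite -(pair_bigA _ (fun a b => A (- box_diff (a, b)) ^+ 2)) exchange_big/=.
  rewrite pair_bigA/=; apply: eq_bigr => -[a b] _.
  by rewrite /box_diff/= opprB.
by rewrite -mulr_sumr big_split/= swap; rewrite /A; field.
Qed.

(** The oscillation around a point, weighted by the kernel. *)
Definition fejer_dev f (p : P) : R :=
  mean (fun q => fejer p.1 q.1 * (f p - f q) ^+ 2).

Lemma bm_sqr f : bounded_measurable f -> bounded_measurable (fun p => f p ^+ 2).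
Proof. by move=> bf; under eq_fun do rewrite expr2; exact: bmM. Qed.

Lemma fejer_devE f p : bounded_measurable f -> fejer_dev f p =
  f p ^+ 2 * fejer_op (fun=> 1) p
  + ((- 2) * (f p * fejer_op f p) + 1 * fejer_op (fun q => f q ^+ 2) p).
Proof.
move=> bf; have bK := bm_fejer p.1.
have B1 := bmM bK (bm_cst (1 : R)); have B2 := bmM bK bf; have B3 := bmM bK (bm_sqr bf).
rewrite /fejer_dev /fejer_op mul1r mulrA -(meanZ _ B1) -(meanZ _ B2).
rewrite -(meanD (bmZ _ B2) B3) -(meanD (bmZ _ B1) (bmD (bmZ _ B2) B3)).
by apply: eq_mean => q; ring.
Qed.

Lemma bm_fejer_dev f : bounded_measurable f -> bounded_measurable (fejer_dev f).
Proof.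
move=> bf; have bf2 := bm_sqr bf; have b1 := bm_cst (1 : R).
have A1 := bmM bf2 (bm_fejer_op b1); have A2 := bmM bf (bm_fejer_op bf).
have A3 := bmM b1 (bm_fejer_op bf2).
have /funext -> := fun p => fejer_devE p bf.
exact: (bmD A1 (bmD (bmZ _ A2) A3)).
Qed.

(** The mean of the weighted oscillation is what the Cesaro average misses of the
total energy. *)
Lemma mean_fejer_dev f : bounded_measurable f ->
  mean (fejer_dev f) = 2 * (volume * mean (fun p => f p ^+ 2) - fejer_energy f).
Proof.
move=> bf; have bf2 := bm_sqr bf; have b1 := bm_cst (1 : R).
rewrite (eq_mean (fun p => fejer_devE p bf)).
have A1 := bmM bf2 (bm_fejer_op b1); have A2 := bmM bf (bm_fejer_op bf).
have A3 := bmM b1 (bm_fejer_op bf2).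
rewrite (meanD A1 (bmD (bmZ _ A2) A3)) (meanD (bmZ _ A2) A3) (meanZ _ A2).
rewrite mean_fejer_op_self//.
have e1 : mean (fun p => f p ^+ 2 * fejer_op (fun=> 1) p) =
    volume * mean (fun p => f p ^+ 2).
  rewrite -meanZ//; apply: eq_mean => p; by rewrite fejer_op1 mulrC.
have e2 : mean (fun p => 1 * fejer_op (fun q => f q ^+ 2) p) =
    mean (fun p => f p ^+ 2 * fejer_op (fun=> 1) p).
  rewrite !mean_fejer_op//; congr (_ * _); apply: eq_bigr => ab _.
  by rewrite [X in X + _]mulrC [X in _ + X]mulrC.
rewrite e2 e1; ring.
Qed.

Definition basis_freq (i : 'I_3) : Z3 :=
  ((i == 0 :> nat)%:Z, (i == 1 :> nat)%:Z, (i == 2 :> nat)%:Z).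

Lemma freq_basis i j : freq (basis_freq i) j = (i == j)%:Z.
Proof.
by case: i => -[|[|[|//]]] p; case: j => -[|[|[|//]]] q; rewrite /freq !(tnth_nth 0).
Qed.

Lemma cos_diff_basis i x y : cos_diff (basis_freq i) x y = cos (coord3 x i - coord3 y i).
Proof.
have w z : wave (basis_freq i) z = coord3 z i.
  rewrite /wave (bigD1 i)//= freq_basis eqxx mul1r big1 ?addr0// => j ji.
  by rewrite freq_basis eq_sym (negbTE ji) mul0r.
by rewrite /cos_diff !w.
Qed.

(** The pairs of neighbours in direction [i] in the box: only the frequencies on one
face have none, which is the reason for the concentration of the kernel. *)
Lemma box_step_count i :
  (L ^ 2 * L.-1)%:R <= \sum_(ab : box * box) (box_diff ab == basis_freq i)%:R :> R.
Proof.
rewrite -(pair_bigA _ (fun a b => (box_diff (a, b) == basis_freq i)%:R)) exchange_big/=.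
apply: (@le_trans _ _ (\sum_(b : box) ((b i).+1 < L)%N%:R)); last first.
  apply: ler_sum => b _; have [bL|_] := ltnP (b i).+1 L; last exact: sumr_ge0.
  pose a : box := [ffun j => if j == i then Ordinal bL else b j].
  rewrite (bigD1 a)//= (_ : (box_diff _ == _) = true) ?lerDl ?sumr_ge0//.
  apply/eqP/freq_inj => j; rewrite /box_diff freqD freqN !freq_box freq_basis /= ffunE.
  rewrite [i == j]eq_sym; case: eqP => [jb|_]/=; last by rewrite subrr.
  by rewrite jb -addn1 PoszD addrAC subrr add0r.
pose F (j : 'I_3) (c : 'I_L) : R := if j == i then (c.+1 < L)%N%:R else 1.
rewrite (eq_bigr (fun b : box => \prod_j F j (b j))); last first.
  move=> b _; rewrite (bigD1 i)//= big1 ?mulr1 /F ?eqxx// => j ji.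
  by rewrite (negbTE ji).
rewrite -bigA_distr_bigA (bigD1 i)//=.
have -> : \prod_(j < 3 | j != i) \sum_(c < L) F j c = L%:R ^+ 2.
  rewrite (eq_bigr (fun=> L%:R)) => [|j ji]; last first.
    rewrite (eq_bigr (fun=> 1)) ?sumr_const ?card_ord// => c _.
    by rewrite /F (negbTE ji).
  by rewrite prodr_const (eq_card (B := predC1 i)) ?cardC1 ?card_ord.
rewrite /F eqxx (_ : \sum_(c < L) _ = L.-1%:R).
  by rewrite natrM natrX mulrC.
case: L L0 => // L' _; rewrite big_ord_recr/= ltnn addr0.
rewrite (eq_bigr (fun=> 1)) ?sumr_const ?card_ord// => c _.
by rewrite ltnS ltn_ord.
Qed.

(** The kernel concentrates on the diagonal as the box grows. *)
Lemma mean_fejer_basis i x :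
  mean (fun q => fejer x q.1 * (1 - cos (coord3 x i - coord3 q.1 i))) <= volume / L%:R.
Proof.
set e := basis_freq i.
have bK := bm_fejer x; have be := bm_cos_diff e x.
rewrite (@eq_mean _ _ (fun q => fejer x q.1 * 1 - fejer x q.1 * cos_diff e x q.1)); last first.
  by move=> q; rewrite cos_diff_basis; ring.
have b1 := bmM bK (bm_cst (1 : R)).
rewrite meanB//; last exact: bmM.
rewrite -[X in X - _]/(fejer_op (fun=> 1) (x, 0)) fejer_op1.
have V0 : 0 < volume :> R := volume_gt0.
have L00 : 0 < L%:R :> R by rewrite ltr0n.
have -> : mean (fun q => fejer x q.1 * cos_diff e x q.1) = n^-1 * (2^-1 * volume *
   (\sum_(ab : box * box) (box_diff ab == - e)%:R +
    \sum_(ab : box * box) (box_diff ab == e)%:R)).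
  rewrite -big_split/= mulr_sumr.
  rewrite (eq_bigr (fun ab => mean (fun q =>
      2^-1 * (cos_diff (box_diff ab + e) x q.1 + cos_diff (box_diff ab - e) x q.1)))); last first.
    move=> ab _; have B1 := bm_cos_diff (box_diff ab + e) x.
    have B2 := bm_cos_diff (box_diff ab - e) x.
    rewrite (meanZ _ (bmD B1 B2)) (meanD B1 B2) !mean_cos_diff subr_eq0 addr_eq0.
    by rewrite -mulrDl mulrA [_ * volume]mulrC; ring.
  rewrite -mean_sum; last by move=> ab; apply: bmZ; apply: bmD; exact: bm_cos_diff.
  rewrite -meanZ; last first.
    by apply: bm_sum => ab; apply: bmZ; apply: bmD; exact: bm_cos_diff.
  apply: eq_mean => q; rewrite /fejer -mulrA mulr_suml; congr (_ * _).
  apply: eq_bigr => ab _; rewrite /cos_diff; move: (box_diff ab) => m; move: e {be} => l; rewrite !waveB !waveD.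
  set a := wave m x; set b := wave m q.1; set c := wave l x; set d := wave l q.1.
  rewrite (_ : a + c - (b + d) = (a - b) + (c - d)); last by ring.
  rewrite (_ : a - c - (b - d) = (a - b) - (c - d)); last by ring.
  by rewrite (cosD (a - b)) (cosB (a - b)); field.
have -> : \sum_(ab : box * box) (box_diff ab == - e)%:R =
    \sum_(ab : box * box) (box_diff ab == e)%:R :> R.
  rewrite -(pair_bigA _ (fun a b => (box_diff (a, b) == - e)%:R)) exchange_big/=.
  rewrite pair_bigA/=; apply: eq_bigr => -[a b] _.
  by rewrite /box_diff/= -eqr_oppLR opprB.
have := box_step_count i; set s := \sum_(ab : box * box) _ => hs.
have -> : n^-1 * (2^-1 * volume * (s + s)) = volume * (s / n) by field; rewrite gt_eqF.
have h : 1 - L%:R^-1 <= s / n.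
  rewrite ler_pdivlMr//; apply: le_trans hs; rewrite le_eqVlt; apply/orP; left.
  apply/eqP; rewrite /n natrM natrX [in RHS](_ : L.-1%:R = L%:R - 1); last first.
    by rewrite -subn1 natrB.
  by rewrite natrX; field; rewrite gt_eqF.
have := ler_wpM2l (ltW V0) h; by rewrite mulrBr mulr1; lra.
Qed.

End box.

End fejer.

(** * Increments of periodic functions *)

Section periodic_lipschitz.
Context {R : realType}.
Local Notation P := (R3 R * R3 R)%type.

(** With $u=s/4\le\pi/4$, the mean value theorem gives $\sin u=u\cos c$ where
$2\cos^2c\ge1$, and $1-\cos4u=8\sin^2u\cos^2u$. *)
Lemma sqr_le_cos_small (s : R) : 0 <= s <= pi -> s ^+ 2 <= 8 * (1 - cos s).
Proof.
move=> /andP[s0 spi]; pose u := s / 4; have pi0 := @pi_ge0 R.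
have cos2 (c : R) : 0 <= c <= u -> 1 <= 2 * cos c ^+ 2.
  move=> /andP[c0 cu]; have := @cos_ge0_pihalf R (c *+ 2).
  rewrite cos_mulr2n [c *+ 2]mulr2n => h.
  have : 0 <= cos c ^+ 2 *+ 2 - 1 by apply: h; move: cu spi; rewrite /u => cu spi; apply/andP; split; lra.
  by rewrite mulr2n; lra.
have u0 : 0 <= u by rewrite /u; lra.
have [c cu] : exists2 c : R, c \in `[0, u]%R & sin u - sin 0 = cos c * (u - 0).
  apply: MVT_segment => //.
  by apply: continuous_subspaceT => x; exact: continuous_sin.
rewrite sin0 !subr0 => su.
rewrite in_itv/= in cu.
have h1 := cos2 c cu; have h2 : 1 <= 2 * cos u ^+ 2 by apply: cos2; rewrite u0 lexx.
have -> : s = (u *+ 2) *+ 2 by rewrite /u -mulrnA -mulr_natr; field.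
rewrite cos_mulr2n cos2sin2 sin_mulr2n su.
have -> : 8 * (1 - ((1 - (cos u * (cos c * u) *+ 2) ^+ 2) *+ 2 - 1)) =
    16 * u ^+ 2 * ((2 * cos u ^+ 2) * (2 * cos c ^+ 2)) by ring.
have -> : (u *+ 2 *+ 2) ^+ 2 = 16 * u ^+ 2 * 1 by ring.
rewrite ler_wpM2l ?mulr_ge0 ?sqr_ge0//.
by rewrite -[X in X <= _]mulr1 ler_pM.
Qed.

Lemma sqr_le_cos (s : R) : `|s| <= pi -> s ^+ 2 <= 8 * (1 - cos s).
Proof.
move=> spi; have [s0|s0] := leP 0 s.
  by apply: sqr_le_cos_small; rewrite s0 (le_trans (ler_norm s)).
rewrite -sqrrN -(cosN s); apply: sqr_le_cos_small.
by rewrite oppr_ge0 (ltW s0)/= (le_trans (ler_norm _))// normrN.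
Qed.

Lemma nearest_period (s : R) : exists n : int, `|s + n%:~R * (2 * pi)| <= pi.
Proof.
have pi0 := @pi_gt0 R.
have pi2 : 0 < 2 * pi :> R by rewrite mulr_gt0 ?pi_gt0.
exists (- Num.floor ((s + pi) / (2 * pi))).
have := floor_le ((s + pi) / (2 * pi)).
have := lt_succ_floor ((s + pi) / (2 * pi)).
rewrite ler_pdivlMr// ltr_pdivrMr// intrD mulrDl mul1r rmorphN/= mulNr ler_norml.
by move=> *; apply/andP; split; lra.
Qed.

Lemma line_increment (f f' : R -> R) (M : R) (s : R) :
    (forall s : R, is_derive s 1 f (f' s)) -> (forall s, `|f' s| <= M) ->
    (forall s (n : int), f (s + n%:~R * (2 * pi)) = f s) ->
  (f 0 - f s) ^+ 2 <= 8 * M ^+ 2 * (1 - cos s).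
Proof.
move=> df fM fp; have [n np] := nearest_period s.
rewrite -(fp s n) -(@periodic_2pi_int R cos n s); last exact: cosD2pi.
set t := s + _ in np *.
have lip (a b : R) : a <= b -> `|f b - f a| <= M * `|b - a|.
  move=> ab; have [|c _ ->] := @MVT_segment R f f' a b ab.
    apply: continuous_subspaceT => x; apply: differentiable_continuous.
    by apply/derivable1_diffP; case: (df x).
  by rewrite normrM ler_wpM2r.
have ft : `|f 0 - f t| <= M * `|t|.
  have [t0|t0] := leP 0 t.
    by have := lip _ _ t0; rewrite distrC subr0.
  by have := lip _ _ (ltW t0); rewrite sub0r normrN.
have M0 : 0 <= M by apply: le_trans (fM 0).
rewrite -real_normK ?num_real//.
apply: (@le_trans _ _ ((M * `|t|) ^+ 2)); first by rewrite lerXn2r ?nnegrE// mulr_ge0.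
rewrite exprMn real_normK ?num_real// [8 * _]mulrC -[X in _ <= X]mulrA ler_wpM2l ?sqr_ge0//.
exact: sqr_le_cos.
Qed.

(** A form of the Lipschitz estimate that is itself periodic, hence integrable against
the Fejer kernel. *)
Lemma torus_increment (h : P -> R) (h' : 'I_3 -> P -> R) (M : R) (x y w : R3 R) :
    continuous_periodic h -> (forall i, has_partial (xdir i) h (h' i)) ->
    (forall i p, `|h' i p| <= M) ->
  (h (x, w) - h (y, w)) ^+ 2 <=
    24 * M ^+ 2 * \sum_(i < 3) (1 - cos (coord3 x i - coord3 y i)).
Proof.
move=> [ch ph] dh hM.
pose s i := coord3 y i - coord3 x i.
have step (z : R3 R) i :
    (h (z, w) - h (z + s i *: basis3 i, w)) ^+ 2 <= 8 * M ^+ 2 * (1 - cos (s i)).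
  have lineE (r : R) : (z + r *: basis3 i, w) = (z, w) + (r - 0) *: xdir i :> P.
    by rewrite subr0 /xdir; congr (_, _); rewrite /= scaler0 addr0.
  have h0 : h (z, w) = h (z + 0 *: basis3 i, w) by rewrite scale0r addr0.
  rewrite h0; apply: (@line_increment (fun r => h (z + r *: basis3 i, w))
     (fun r => h' i (z + r *: basis3 i, w)) M (s i)).
  - move=> r; have := @is_derive_line _ _ _ h (h' i) (xdir i) (dh i) (z, w) 0 r.
    by under eq_fun do rewrite -lineE; rewrite -lineE.
  - by move=> r.
  - move=> r n; rewrite scalerDl addrA -(periodic_int n (z + r *: basis3 i) i (ph w)).
    by congr (h (_ + _ *: _, _)); rewrite mulrzl.
pose x1 : R3 R := x + s ord0 *: basis3 ord0.
pose x2 : R3 R := x1 + s (inord 1) *: basis3 (inord 1).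
have yE : y = x2 + s (inord 2) *: basis3 (inord 2).
  rewrite /x2 /x1 /s /basis3 !inordK//=.
  case: x {x1 x2 s step} => [[? ?] ?]; case: y => [[? ?] ?].
  rewrite /coord3 !(tnth_nth 0) !inordK//=.
  by congr (_, _, _); rewrite /= /GRing.scale/= ?mulr0 ?mulr1 ?addr0 subrKC.
have h0 := step x ord0; have h1 := step x1 (inord 1); have h2 := step x2 (inord 2).
rewrite -yE in h2; rewrite -/x1 in h0; rewrite -/x2 in h1.
have cE i : cos (coord3 x i - coord3 y i) = cos (s i) by rewrite -cosN opprB.
have -> : \sum_(i < 3) (1 - cos (coord3 x i - coord3 y i)) =
    (1 - cos (s ord0)) + (1 - cos (s (inord 1))) + (1 - cos (s (inord 2))).
  rewrite !big_ord_recl big_ord0 addr0 addrA !cE.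
  by congr (1 - cos (s _) + (1 - cos (s _)) + (1 - cos (s _)));
    apply/val_inj; rewrite /= ?inordK.
have -> : h (x, w) - h (y, w) = (h (x, w) - h (x1, w)) + (h (x1, w) - h (x2, w))
   + (h (x2, w) - h (y, w)) by ring.
set a := h (x, w) - _ in h0 *; set b := h (x1, w) - _ in h1 *.
set c := h (x2, w) - _ in h2 *.
apply: (@le_trans _ _ (3 * (a ^+ 2 + b ^+ 2 + c ^+ 2))); last by lra.
have := sqr_ge0 (a - b); have := sqr_ge0 (a - c); have := sqr_ge0 (b - c).
by nra.
Qed.

End periodic_lipschitz.

(** * Coercivity of the densities *)

Section macroscopic.
Context {R : realType}.
Local Notation P := (R3 R * R3 R)%type.
Local Notation Z3 := (int * int * int)%type.
Local Notation gam := (@normal_prob R 0 1).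

(** The mean over [p.2] is twice the variance of [h] in the velocity at the position
[p.1]. *)
Definition velocity_osc (h : P -> R) (p : P) : R :=
  fine (\int[@gaussian R]_w ((h p - h (p.1, w)) ^+ 2)%:E)%E.

Section bounded.
Context {h : P -> R} {B : R}.
Hypotheses (mh : measurable_fun setT h) (hB : forall p, `|h p| <= B).

Let B0 : 0 <= B. Proof. by apply: le_trans (hB (0, 0)). Qed.

Let mdiff (p : P) : measurable_fun setT (fun w : R3 R => (h p - h (p.1, w)) ^+ 2).
Proof.
apply: measurable_funX; apply: measurable_funB => //.
by apply: (measurableT_comp mh); exact: measurable_fun_pair.
Qed.

Let diff_le (p q : P) : (h p - h q) ^+ 2 <= 4 * B ^+ 2.
Proof.
have := hB p; have := hB q; rewrite !ler_norml => /andP[h1 h2] /andP[h3 h4].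
have : `|h p - h q| <= 2 * B by rewrite ler_norml; apply/andP; split; lra.
move=> hh; rewrite -real_normK ?num_real// (_ : 4 * B ^+ 2 = (2 * B) ^+ 2); last by ring.
by rewrite lerXn2r ?nnegrE// mulr_ge0.
Qed.

Lemma velocity_osc_int p :
  ((velocity_osc h p)%:E = \int[@gaussian R]_w ((h p - h (p.1, w)) ^+ 2)%:E)%E.
Proof.
rewrite /velocity_osc fineK//; apply: integrable_fin_num => //.
apply: (@bm_integrable_on _ _ _ _ (fun w => (h p - h (p.1, w)) ^+ 2) (4 * B ^+ 2)) => //.
by move=> w; rewrite ger0_norm ?sqr_ge0.
Qed.

Lemma bm_velocity_osc : bounded_measurable (velocity_osc h).
Proof.
split.
  apply: measurableT_comp => //.
  apply: (measurable_fun_fubini_tonelli_F (fun q : P * R3 R =>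
     ((h q.1 - h (q.1.1, q.2)) ^+ 2)%:E)) => //; last first.
    by move=> q; rewrite lee_fin sqr_ge0.
  apply/measurable_EFinP/measurable_funX/measurable_funB.
    by apply: (measurableT_comp mh); exact: measurable_fst.
  apply: (measurableT_comp mh); apply: measurable_fun_pair => //.
  by apply: (measurableT_comp measurable_fst); exact: measurable_fst.
exists (4 * B ^+ 2) => p; have := velocity_osc_int p.
rewrite ger0_norm; last by apply: fine_ge0; apply: integral_ge0 => w _; rewrite lee_fin sqr_ge0.
move=> E; rewrite -lee_fin E.
apply: (@le_trans _ _ (\int[@gaussian R]_w (4 * B ^+ 2)%:E)%E).
  apply: ge0_le_integral => //.
  - by move=> w _; rewrite lee_fin sqr_ge0.
  - exact/measurable_EFinP.
  - by move=> w _; rewrite lee_fin diff_le.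
rewrite integral_cst// -[leRHS]mule1 le_eqVlt; apply/orP; left; apply/eqP.
by congr (_ * _)%E; exact: probability_setT.
Qed.

End bounded.

(** The Poincare inequality at each position. *)
Lemma mean_velocity_osc (h : P -> R) (d : 'I_3 -> P -> R) :
    tame h -> (forall i, tame (d i)) -> (forall i, has_partial (vdir i) h (d i)) ->
  mean (velocity_osc h) <= 64 * \sum_i mean (fun p => d i p ^+ 2).
Proof.
move=> th td dh; have [mh [B hB]] := tame_bm th.
have bd i : bounded_measurable (fun p => d i p ^+ 2).
  by under eq_fun do rewrite expr2; apply: bmM; exact: tame_bm.
have bs : bounded_measurable (fun p => \sum_i d i p ^+ 2) by exact: bm_sum.
rewrite -mean_sum// -meanZ// -lee_fin !meanE; [|exact: bmZ|exact: bm_velocity_osc mh hB].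
under eq_integral do rewrite (velocity_osc_int mh hB).
have mi : measurable_fun setT (fun p : P =>
    (\int[@gaussian R]_w ((h p - h (p.1, w)) ^+ 2)%:E)%E).
  have /funext <- := velocity_osc_int mh hB.
  by apply/measurable_EFinP; case: (bm_velocity_osc mh hB).
have m64 : measurable_fun setT (fun p : P => (64 * \sum_i d i p ^+ 2)%:E).
  by apply/measurable_EFinP; case: (bmZ 64 bs).
have s0 p : 0 <= \sum_i d i p ^+ 2 by apply: sumr_ge0 => i _; exact: sqr_ge0.
have i0 (p : P) : (0 <= \int[@gaussian R]_w ((h p - h (p.1, w)) ^+ 2)%:E)%E.
  by apply: integral_ge0 => w _; rewrite lee_fin sqr_ge0.
have s64 (p : P) : (0 <= (64 * \sum_i d i p ^+ 2)%:E)%E by rewrite lee_fin mulr_ge0.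
rewrite /phase_measure !fubini_tonelli1//=.
have mF := measurable_fun_fubini_tonelli_F.
apply: ge0_le_integral => //.
- by move=> x _; exact: integral_ge0.
- exact: mF.
- exact: mF.
move=> x _; rewrite /fubini_F/=.
have gE (g : R3 R -> \bar R) :
    (\int[@gaussian R]_v g v = \int[cube_measure gam]_v g v)%E.
  by apply: eq_measure_integral => A mA _; exact: gaussianE.
rewrite gE [leRHS]gE; under eq_integral do rewrite gE.
have [[ch _] _] := th.
have cx (f : P -> R) : continuous f -> continuous (fun v => f (x, v)).
  move=> cf v; apply: (@continuous_comp _ _ _ (fun v => (x, v)) f); last exact: cf.
  by apply: (cvg_pair (G := nbhs x) (H := nbhs v)); [exact: cvg_cst|exact: cvg_id].
have md : measurable_fun setT (fun v : R3 R => (\sum_i d i (x, v) ^+ 2)%:E).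
  apply/measurable_EFinP; have [m _] := bs.
  by apply: (measurableT_comp m); exact: measurable_fun_pair.
under [leRHS]eq_integral do rewrite EFinM.
rewrite ge0_integralZl//; last by move=> v _; rewrite lee_fin.
apply: (@poincare_cube _ (fun v => h (x, v)) (fun i v => d i (x, v))).
- exact: cx.
- by move=> i; apply: cx; case: (td i) => -[].
- move=> i v; apply: is_derive_of_line.
  have := @is_derive_line _ _ _ h (d i) (vdir i) (dh i) (x, v) 0 0.
  rewrite /= subrr scale0r addr0.
  suff E r : (x, v) + (r - 0) *: vdir i = (x, v + r *: basis3 i) :> P.
    by under eq_fun do rewrite E.
  by rewrite subr0 /vdir; congr (_, _); rewrite /= scaler0 addr0.
Qed.

Lemma sum_coef_ge (J : finType) (f : J -> Z3) (F : Z3 -> R) (N : nat) :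
    injective f -> (forall j, pickle (f j) < N)%N ->
  \sum_j F (f j) ^+ 2 <= \sum_(n < N) coef F n ^+ 2.
Proof.
move=> fi fN; pose g j : 'I_N := Ordinal (fN j).
have gi : injective g by move=> i j [] /(pcan_inj pickleK) /fi.
have E j : F (f j) = coef F (g j) by rewrite /coef /= pickleK_inv.
under eq_bigr do rewrite E.
rewrite -(big_imset (fun n : 'I_N => coef F n ^+ 2)) /=; last by move=> i j _ _; exact: gi.
rewrite [leRHS](bigID (mem (g @: J)))/= lerDl sumr_ge0// => i _.
exact: sqr_ge0.
Qed.

(** For each fixed [a] the differences [a - b] are distinct frequencies, so that the
Cesaro mean is an average of partial sums. *)
Lemma fejer_energy_le (L : nat) (h : P -> R) : (0 < L)%N ->
  exists N0, forall N, (N0 <= N)%N ->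
    fejer_energy L h <= \sum_(n < N) coef (fun k => mean (fun p => h p * mode k p)) n ^+ 2.
Proof.
move=> L0; pose J := {ffun 'I_3 -> 'I_L}.
exists (\max_(ab : J * J) (pickle (box_diff ab)).+1) => N hN.
rewrite /fejer_energy ler_pdivrMl ?ltr0n ?expn_gt0 ?L0//.
rewrite -(pair_bigA _ (fun a b => mean (fun p => h p * mode (box_diff (a, b)) p) ^+ 2))/=.
set s := \sum_(n < N) _.
rewrite -[leRHS](_ : \sum_(a : J) s = _); last first.
  by rewrite sumr_const card_box mulr_natl.
apply: ler_sum => a _.
apply: (@sum_coef_ge J (fun b => box_diff (a, b)) (fun k => mean (fun p => h p * mode k p))).
  by move=> b c /addrI /oppr_inj /box_freq_inj.
move=> b; apply: leq_trans hN.
exact: (leq_bigmax_cond (F := fun ab : J * J => (pickle (box_diff ab)).+1) (a, b)).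
Qed.

(** The modes exhaust the macroscopic part of [h]; the microscopic part is
controlled by the velocity derivatives. *)
Lemma macroscopic_bound (h : P -> R) (d d' : 'I_3 -> P -> R) (eta : R) :
    tame h -> (forall i, tame (d i)) -> (forall i, has_partial (vdir i) h (d i)) ->
    (forall i, tame (d' i)) -> (forall i, has_partial (xdir i) h (d' i)) -> 0 < eta ->
  exists N0, forall N, (N0 <= N)%N ->
    volume * mean (fun p => h p ^+ 2) <=
      \sum_(n < N) coef (fun k => mean (fun p => h p * mode k p)) n ^+ 2
      + 64 * volume * \sum_i mean (fun p => d i p ^+ 2) + eta.
Proof.
move=> th td dh td' dh' eta0; have bh := tame_bm th; have [mh [B hB]] := bh.
have [M M0 hM] : exists2 M, 0 <= M & forall i p, `|d' i p| <= M.
  have pick i : exists Mi, forall p, `|d' i p| <= Mi by exact: tame_bounded.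
  have [Mf MfP] := choice pick.
  have Mf0 i : 0 <= Mf i by apply: le_trans (MfP i (0, 0)).
  exists (\sum_i Mf i) => [|i p]; first exact: sumr_ge0.
  by rewrite (bigD1 i)//= (le_trans (MfP i p))// lerDl sumr_ge0.
pose c := 24 * M ^+ 2; have c0 : 0 <= c by rewrite mulr_ge0// sqr_ge0.
have V0 : 0 < volume :> R := volume_gt0.
(* The box must be large enough for the cost [3 * c * volume ^+ 2 / L] of the changes of
   position to be at most [eta]. *)
have [l hl] := nat_above (3 * c * volume ^+ 2 / eta).
pose L := l.+1; have L0 : (0 < L)%N by [].
have LR0 : 0 < L%:R :> R by rewrite ltr0n.
have Leta : 3 * c * volume ^+ 2 / L%:R <= eta.
  rewrite ler_pdivrMr// [eta * _]mulrC -ler_pdivrMr//; apply: (le_trans (ltW hl)).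
  by rewrite ler_nat.
(* The change from $(x,v)$ to $(y,w)$ passes through $(x,w)$. *)
have dev p : fejer_dev L h p <= 2 * volume * velocity_osc h p + 6 * c * volume / L%:R.
  case: p => x v.
  pose F (y : R3 R) : R := fejer L x y.
  have [mF [MF hF]] := @bm_fejer R L x.
  have mF' : measurable_fun setT F.
    have mp : measurable_fun setT (fun y : R3 R => (y, 0 : R3 R)).
      exact: measurable_fun_pair.
    exact: (measurableT_comp mF mp).
  have bG : bounded_measurable (fun q : P => (h (x, v) - h (x, q.2)) ^+ 2).
    have := bmD (bm_cst (h (x, v))) (@bmN _ (fun q : P => h (x, q.2)) _).
    move=> H; under eq_fun do rewrite expr2.
    have H' : bounded_measurable (fun q : P => h (x, v) - h (x, q.2)).
      apply: H; split; last by exists B.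
      by apply: (measurableT_comp mh); apply: measurable_fun_pair => //; exact: measurable_snd.
    exact: bmM.
  have bC i : bounded_measurable (fun q : P => fejer L x q.1 * (1 - cos (coord3 x i - coord3 q.1 i))).
    apply: bmM; first exact: bm_fejer.
    under eq_fun do rewrite -cos_diff_basis.
    by apply: bmD; [exact: bm_cst|apply: bmN; exact: bm_cos_diff].
  have bFG := bmM (@bm_fejer R L x) bG.
  have bS : bounded_measurable (fun q : P => \sum_(i < 3)
      fejer L x q.1 * (1 - cos (coord3 x i - coord3 q.1 i))) by exact: bm_sum.
  apply: (@le_trans _ _ (mean (fun q : P => 2 * (fejer L x q.1 * (h (x, v) - h (x, q.2)) ^+ 2)
     + 2 * c * \sum_(i < 3) fejer L x q.1 * (1 - cos (coord3 x i - coord3 q.1 i))))).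
    apply: le_mean.
    - apply: bmM; first exact: bm_fejer.
      by apply: bm_sqr; apply: bmD; [exact: bm_cst|exact: bmN].
    - by apply: bmD; exact: bmZ.
    move=> [y w] /=; rewrite -mulr_sumr.
    have := torus_increment x y w (proj1 th) dh' hM.
    rewrite -/c; set s := \sum_(i < 3) _ => hs.
    have K0 := fejer_ge0 L0 x y.
    rewrite (_ : 2 * _ + _ = fejer L x y * (2 * (h (x, v) - h (x, w)) ^+ 2 + 2 * (c * s))); last by ring.
    apply: ler_wpM2l => //.
    have := sqr_ge0 ((h (x, v) - h (x, w)) - (h (x, w) - h (y, w))).
    by nra.
  rewrite (meanD (bmZ _ bFG) (bmZ _ bS)) (meanZ _ bFG) (meanZ _ bS) mean_sum//.
  apply: lerD.
    rewrite -mulrA ler_wpM2l//.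
    rewrite (@mean_separated _ F (fun w => (h (x, v) - h (x, w)) ^+ 2) MF)//.
    - have -> // : mean (fun q : P => F q.1) = volume.
      by rewrite -(fejer_op1 L0 (x, 0)); apply: eq_mean => q; rewrite mulr1.
    - by move=> y; exact: (hF (y, 0)).
    - apply: measurable_funX; apply: measurable_funB => //.
      by apply: (measurableT_comp mh); exact: measurable_fun_pair.
    - by move=> w; exact: sqr_ge0.
    - by have := velocity_osc_int mh hB (x, v) => /= <-; rewrite ltry.
  rewrite (_ : 6 * c * volume / L%:R = 2 * c * \sum_(i < 3) volume / L%:R); last first.
    by rewrite sumr_const card_ord -mulr_natl; ring.
  by rewrite ler_wpM2l ?mulr_ge0//; apply: ler_sum => i _; exact: mean_fejer_basis.
have [N0 hN0] := fejer_energy_le h L0.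
exists N0 => N /hN0; set s := \sum_(n < N) _ => hs.
have bo := bm_velocity_osc mh hB.
have := le_mean (bm_fejer_dev L bh) (bmD (bmZ _ bo) (bm_cst _)) dev.
rewrite (meanD (bmZ _ bo) (bm_cst _)) (meanZ _ bo).
rewrite (mean_fejer_dev L0 bh).
have meanc (k : R) : mean (fun _ : P => k) = k * volume.
  by rewrite /volume -(meanZ k (bm_cst 1)); apply: eq_mean => p; rewrite mulr1.
rewrite meanc.
have hv := mean_velocity_osc th td dh.
have := ler_wpM2l (ltW V0) hv.
rewrite (_ : 6 * c * volume / L%:R * volume = 2 * (3 * c * volume ^+ 2 / L%:R)); last by ring.
set D := \sum_i _; set o := mean (velocity_osc h).
by move: Leta hs; set a := 3 * c * _ / _; lra.
Qed.

End macroscopic.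

(** * Weak form of the kinetic operator *)

Section weak_formulation.
Context {R : realType}.
Local Notation P := (R3 R * R3 R)%type.
Local Notation Z3 := (int * int * int)%type.
Implicit Types g : P -> R.

Lemma cross_coord (u w : R3 R) (i : 'I_3) : coord3 (cross u w) i =
  coord3 u (ordS i) * coord3 w (ordS (ordS i)) - coord3 u (ordS (ordS i)) * coord3 w (ordS i).
Proof.
by case: u => [[? ?] ?]; case: w => [[? ?] ?]; case: i => -[|[|[|//]]] p;
  rewrite /coord3 !(tnth_nth 0).
Qed.

Lemma ordS_neq (i : 'I_3) : (i == ordS i) = false /\ (i == ordS (ordS i)) = false.
Proof. by case: i => -[|[|[|//]]]. Qed.

Lemma dot_cross (u w : R3 R) : \sum_i coord3 u i * coord3 (cross u w) i = 0.
Proof.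
case: u => [[? ?] ?]; case: w => [[? ?] ?].
by rewrite !big_ord_recl big_ord0 /coord3 !(tnth_nth 0)/=; ring.
Qed.

Context {Be : R3 R -> R3 R}.
Hypothesis cB : forall i, continuous_periodic (fun p : P => coord3 (Be p.1) i).
(** Only the tameness of the derivatives and the fact that they are partial
derivatives matter, so they are variables. *)
Context {h : P -> R} {X D DD : 'I_3 -> P -> R}.
Hypotheses (th : tame h) (tX : forall i, tame (X i)) (tD : forall i, tame (D i))
  (tDD : forall i, tame (DD i)).
Hypotheses (dX : forall i, has_partial (xdir i) h (X i))
  (dD : forall i, has_partial (vdir i) h (D i))
  (dDD : forall i, has_partial (vdir i) (D i) (DD i)).

Let vel i (p : P) := coord3 p.2 i.
Let lorentz i (p : P) := coord3 (cross p.2 (Be p.1)) i.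

Let cv i : continuous_periodic (vel i). Proof. exact: cp_v. Qed.

Definition kinetic_op (p : P) : R :=
  \sum_i vel i p * X i p - \sum_i lorentz i p * D i p
  + \sum_i (- DD i p + vel i p * D i p).

Lemma cp_lorentz i : continuous_periodic (lorentz i).
Proof.
rewrite /lorentz; under eq_fun do rewrite cross_coord.
by apply: cpD; [|apply: cpN]; apply: cpM; (exact: cp_v || exact: cB).
Qed.

Let bh g : continuous_periodic g -> bounded_measurable (fun p => h p * g p).
Proof. by move=> cg; exact/tame_bm/tameM. Qed.

Let bD i g : continuous_periodic g -> bounded_measurable (fun p => D i p * g p).
Proof. by move=> cg; exact/tame_bm/tameM. Qed.

(** The Lorentz force is free of divergence in the velocity, component by component. *)
Lemma lorentz_partial i : has_partial (vdir i) (lorentz i) (fun=> 0).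
Proof.
move=> p; have [n1 n2] := ordS_neq i.
have d a b : has_partial (vdir i) (fun p : P => coord3 p.2 a * coord3 (Be p.1) b)
    (fun p => (i == a)%:R * coord3 (Be p.1) b + coord3 p.2 a * 0).
  by apply: has_partialM; [exact: v_partial_v|exact: (@x_partial_v _ (fun x => coord3 (Be x) b))].
rewrite (_ : lorentz i = fun p => coord3 p.2 (ordS i) * coord3 (Be p.1) (ordS (ordS i))
  - coord3 p.2 (ordS (ordS i)) * coord3 (Be p.1) (ordS i)); last first.
  by apply/funext => q; rewrite /lorentz cross_coord.
apply: (is_derive_eq (is_deriveB (d _ _ p) (d _ _ p))).
by rewrite n1 n2 !mul0r !mulr0 addr0 subrr.
Qed.

Lemma transport_weak i g gx : continuous_periodic g -> continuous_periodic gx ->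
    has_partial (xdir i) g gx ->
  mean (fun p => vel i p * X i p * g p) = - mean (fun p => h p * (vel i p * gx p)).
Proof.
move=> cg cgx dg.
have dvg : has_partial (xdir i) (fun p => vel i p * g p) (fun p => vel i p * gx p).
  have := has_partialM (@v_partial_x R i i) dg.
  by under [X in has_partial _ _ X -> _]eq_fun do rewrite mul0r add0r.
rewrite -(mean_ibp_x th (tX i) _ _ (dX i) dvg); [|exact: cpM|exact: cpM].
by apply: eq_mean => p; ring.
Qed.

(** The Gaussian weight contributes $v\cdot(v\wedge B_e)=0$. *)
Lemma magnetic_weak g (gv : 'I_3 -> P -> R) : continuous_periodic g ->
    (forall i, continuous_periodic (gv i)) -> (forall i, has_partial (vdir i) g (gv i)) ->
  \sum_i mean (fun p => lorentz i p * D i p * g p) =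
  - \sum_i mean (fun p => h p * (lorentz i p * gv i p)).
Proof.
move=> cg cgv dg; have cl := cp_lorentz.
have H i : mean (fun p => lorentz i p * D i p * g p) =
    mean (fun p => h p * (vel i p * lorentz i p * g p))
    - mean (fun p => h p * (lorentz i p * gv i p)).
  have dlg : has_partial (vdir i) (fun p => lorentz i p * g p) (fun p => lorentz i p * gv i p).
    have := has_partialM (lorentz_partial i) (dg i).
    by under [X in has_partial _ _ X -> _]eq_fun do rewrite mul0r add0r.
  have := mean_ibp_v th (tD i) (cpM (cl i) cg) (cpM (cl i) (cgv i)) (dD i) dlg.
  rewrite (eq_mean (g := fun p => lorentz i p * D i p * g p)); last by move=> p; ring.
  by move=> ->; congr (_ - _); apply: eq_mean => p; rewrite /vel; ring.
under eq_bigr do rewrite H.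
rewrite sumrB.
have -> : \sum_i mean (fun p => h p * (vel i p * lorentz i p * g p)) = 0; last by rewrite sub0r.
rewrite -mean_sum; last first.
  by move=> i; apply: bh; apply: cpM => //; exact: cpM.
rewrite -[RHS](@mean0 R); apply: eq_mean => p.
by rewrite -mulr_sumr -mulr_suml dot_cross mul0r mulr0.
Qed.

Lemma friction_weak i g gv : continuous_periodic g -> continuous_periodic gv ->
    has_partial (vdir i) g gv ->
  mean (fun p => (- DD i p + vel i p * D i p) * g p) = mean (fun p => D i p * gv p).
Proof.
move=> cg cgv dg.
have := mean_ibp_v (tD i) (tDD i) cg cgv (dDD i) dg.
have b1 : bounded_measurable (fun p => DD i p * g p) by exact/tame_bm/tameM.
have b2 : bounded_measurable (fun p => D i p * (vel i p * g p)) by apply: bD; exact: cpM.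
rewrite (eq_mean (f := fun p => coord3 p.2 i * D i p * g p)
  (g := fun p => D i p * (vel i p * g p))); last by move=> p; rewrite /vel; ring.
move=> E; rewrite (_ : mean (fun p => D i p * gv p) =
    mean (fun p => D i p * (vel i p * g p)) - mean (fun p => DD i p * g p)).
  by rewrite -meanB//; apply: eq_mean => p; ring.
by rewrite E opprB addrC subrK.
Qed.

Let bvX i g : continuous_periodic g -> bounded_measurable (fun p => vel i p * X i p * g p).
Proof.
move=> cg; have := tame_bm (tameM (tameM (tX i) (cv i)) cg).
by under eq_fun do rewrite [X i _ * _]mulrC.
Qed.

Let blD i g : continuous_periodic g -> bounded_measurable (fun p => lorentz i p * D i p * g p).
Proof.
move=> cg; have := tame_bm (tameM (tameM (tD i) (cp_lorentz i)) cg).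
by under eq_fun do rewrite [D i _ * _]mulrC.
Qed.

Let bFr i g : continuous_periodic g ->
  bounded_measurable (fun p => (- DD i p + vel i p * D i p) * g p).
Proof.
move=> cg; have := tame_bm (tameM (tameD (tameN (tDD i)) (tameM (tD i) (cv i))) cg).
by under eq_fun do rewrite [D i _ * _]mulrC.
Qed.

Lemma kineticM g p : kinetic_op p * g p = \sum_i vel i p * X i p * g p
  - \sum_i lorentz i p * D i p * g p
  + \sum_i (- DD i p + vel i p * D i p) * g p.
Proof.
have aux (I : finType) (a b c : I -> R) (y : R) :
    (\sum_i a i - \sum_i b i + \sum_i c i) * y =
    \sum_i a i * y - \sum_i b i * y + \sum_i c i * y.
  by rewrite mulrDl mulrBl !mulr_suml.
by rewrite /kinetic_op aux.
Qed.

Lemma bm_kinetic : bounded_measurable kinetic_op.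
Proof.
have c1 := @cp_cst R 1.
have /funext E : forall p, kinetic_op p = kinetic_op p * 1 by move=> p; rewrite mulr1.
rewrite E; have /funext -> := kineticM (fun=> 1).
apply: bmD; [apply: bmD; [|apply: bmN]|]; apply: bm_sum => i.
- exact: bvX.
- exact: blD.
- exact: bFr.
Qed.

Lemma kinetic_weak g (gx gv : 'I_3 -> P -> R) : continuous_periodic g ->
    (forall i, continuous_periodic (gx i)) -> (forall i, has_partial (xdir i) g (gx i)) ->
    (forall i, continuous_periodic (gv i)) -> (forall i, has_partial (vdir i) g (gv i)) ->
  mean (fun p => kinetic_op p * g p) =
    - (\sum_i mean (fun p => h p * (vel i p * gx i p)))
    + \sum_i mean (fun p => h p * (lorentz i p * gv i p))
    + \sum_i mean (fun p => D i p * gv i p).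
Proof.
move=> cg cgx dgx cgv dgv; rewrite (eq_mean (kineticM g)).
have s1 := bm_sum (index_enum 'I_3) xpredT (fun i => bvX i cg).
have s2 := bm_sum (index_enum 'I_3) xpredT (fun i => blD i cg).
have s3 := bm_sum (index_enum 'I_3) xpredT (fun i => bFr i cg).
rewrite (meanD (bmD s1 (bmN s2)) s3) (meanB s1 s2).
rewrite (mean_sum _ _ (fun i => bvX i cg)) (mean_sum _ _ (fun i => blD i cg)).
rewrite (mean_sum _ _ (fun i => bFr i cg)).
rewrite (magnetic_weak cg cgv dgv) opprK; congr (_ + _ + _).
  by rewrite -sumrN; apply: eq_bigr => i _; exact: transport_weak.
by apply: eq_bigr => i _; exact: friction_weak.
Qed.

Definition dissipation : R := \sum_i mean (fun p => D i p ^+ 2).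

Lemma mean_kinetic : mean kinetic_op = 0.
Proof.
have c0 := @cp_cst R 0.
have d0 e : has_partial e (fun=> (1 : R)) (fun=> 0) by move=> p; exact: is_derive_cst.
have := @kinetic_weak (fun=> 1) (fun _ _ => 0) (fun _ _ => 0) (cp_cst 1) (fun=> c0)
  (fun=> d0 _) (fun=> c0) (fun=> d0 _).
rewrite (eq_mean (g := kinetic_op)); last by move=> p; rewrite mulr1.
move=> ->; rewrite !big1 ?oppr0 ?addr0// => i _; rewrite -[RHS](@mean0 R);
  by apply: eq_mean => p; rewrite !mulr0.
Qed.

(** The transport part is antisymmetric, the friction part dissipates. *)
Lemma kinetic_energy : mean (fun p => kinetic_op p * h p) = dissipation.
Proof.
have cph : continuous_periodic h by case: th.
have cX i : continuous_periodic (X i) by case: (tX i).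
have cD i : continuous_periodic (D i) by case: (tD i).
rewrite (kinetic_weak cph cX dX cD dD).
have e1 : \sum_i mean (fun p => h p * (vel i p * X i p)) = 0.
  apply: big1 => i _; have := transport_weak cph (cX i) (dX i).
  rewrite (eq_mean (g := fun p => h p * (vel i p * X i p))); last by move=> p; ring.
  by move=> E; lra.
have e2 : \sum_i mean (fun p => h p * (lorentz i p * D i p)) = 0.
  have := magnetic_weak cph cD dD.
  rewrite (eq_bigr (fun i => mean (fun p => h p * (lorentz i p * D i p)))); last first.
    by move=> i _; apply: eq_mean => p; ring.
  by move=> E; lra.
rewrite e1 e2 oppr0 !add0r; apply: eq_bigr => i _.
by apply: eq_mean => p; rewrite expr2.
Qed.

Let density_ k := mean (fun p => h p * mode k p).

Lemma mode_partials k : [/\ continuous_periodic (@mode R k),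
   forall i, continuous_periodic (fun p : P => (freq k i)%:~R * mode (- k) p)
   & forall i, has_partial (vdir i) (@mode R k) (fun=> 0)].
Proof.
split; [exact: cp_mode| |exact: mode_partial_v].
by move=> i; apply: cpM; [exact: cp_cst|exact: cp_mode].
Qed.

(** The moments of the velocity are controlled by the dissipation. *)
Lemma mean_vel_mode i k :
  mean (fun p => h p * (vel i p * mode k p)) = mean (fun p => D i p * mode k p).
Proof.
have := mean_ibp_v th (tD i) (cp_mode k) (cp_cst 0) (dD i) (@mode_partial_v R k i).
rewrite (_ : mean (fun p => h p * 0) = 0) ?subr0.
  by move=> ->; apply: eq_mean => p; rewrite /vel; ring.
by rewrite -[RHS](@mean0 R); apply: eq_mean => p; rewrite mulr0.
Qed.

(** The continuity equation. *)
Lemma kinetic_density k : mean (fun p => kinetic_op p * mode k p) =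
  - \sum_i (freq k i)%:~R * mean (fun p => D i p * mode (- k) p).
Proof.
have [cm cx dv0] := mode_partials k.
rewrite (kinetic_weak cm cx (mode_partial_x k) (fun=> cp_cst 0) dv0).
rewrite [X in _ + X + _]big1 ?addr0; last first.
  by move=> i _; rewrite -[RHS](@mean0 R); apply: eq_mean => p; rewrite !mulr0.
rewrite [X in _ + X]big1 ?addr0; last first.
  by move=> i _; rewrite -[RHS](@mean0 R); apply: eq_mean => p; rewrite !mulr0.
congr (- _); apply: eq_bigr => i _; rewrite -mean_vel_mode -meanZ; last first.
  by apply: bh; apply: cpM => //; exact: cp_mode.
by apply: eq_mean => p; ring.
Qed.

(** Integration by parts of one of the velocities, since $v$ is minus the logarithmic
derivative of the Gaussian. *)
Lemma mean_stress i l k : mean (fun p => h p * (vel l p * (vel i p * mode k p))) =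
  (i == l)%:R * density_ k + mean (fun p => D l p * (vel i p * mode k p)).
Proof.
have cm := @cp_mode R k.
have dvm : has_partial (vdir l) (fun p => vel i p * mode k p)
    (fun p => (l == i)%:R * mode k p).
  have := has_partialM (@v_partial_v R l i) (@mode_partial_v R k l).
  by under [X in has_partial _ _ X -> _]eq_fun do rewrite mulr0 addr0.
have := mean_ibp_v th (tD l) (cpM (cv i) cm) (cpM (cp_cst _) cm) (dD l) dvm.
move=> ->; rewrite eq_sym -meanZ; last exact: bh.
rewrite [X in _ + (X - _)](eq_mean (g := fun p => h p * (vel l p * (vel i p * mode k p)))); last first.
  by move=> p; rewrite /vel; ring.
rewrite [X in X + (_ - _)](eq_mean (g := fun p => h p * ((l == i)%:R * mode k p))); last first.
  by move=> p; ring.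
by rewrite addrC subrK.
Qed.

(** Integrating the velocity by parts turns the moments of $v\wedge B_e$ into those of
$\nabla_vh\wedge B_e$, which the dissipation controls. *)
Definition lorentz_flux i (p : P) : R :=
  D (ordS i) p * coord3 (Be p.1) (ordS (ordS i)) - D (ordS (ordS i)) p * coord3 (Be p.1) (ordS i).

Lemma tame_lorentz_flux i : tame (lorentz_flux i).
Proof. by apply: tameD; [|apply: tameN]; apply: tameM. Qed.

Lemma mean_lorentz_mode i k :
  mean (fun p => h p * (lorentz i p * mode k p)) = mean (fun p => lorentz_flux i p * mode k p).
Proof.
have cm := @cp_mode R k.
have H a b : mean (fun p => h p * (vel a p * (coord3 (Be p.1) b * mode k p))) =
    mean (fun p => D a p * (coord3 (Be p.1) b * mode k p)).
  have d0 : has_partial (vdir a) (fun p : P => coord3 (Be p.1) b * mode k p) (fun=> 0).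
    exact: (@x_partial_v _ (fun x => coord3 (Be x) b * (cos (wave k x) + sin (wave k x)))).
  have := mean_ibp_v th (tD a) (cpM (cB b) cm) (cp_cst 0) (dD a) d0.
  rewrite [X in _ - X](_ : _ = 0) ?subr0; last first.
    by rewrite -[RHS](@mean0 R); apply: eq_mean => p; rewrite mulr0.
  by move=> ->; apply: eq_mean => p; rewrite /vel; ring.
have c1 a b : continuous_periodic (fun p => vel a p * (coord3 (Be p.1) b * mode k p)).
  by apply: cpM => //; exact: cpM.
have c2 b : continuous_periodic (fun p : P => coord3 (Be p.1) b * mode k p) by exact: cpM.
rewrite (eq_mean (g := fun p =>
    h p * (vel (ordS i) p * (coord3 (Be p.1) (ordS (ordS i)) * mode k p))
  - h p * (vel (ordS (ordS i)) p * (coord3 (Be p.1) (ordS i) * mode k p)))); last first.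
  by move=> p; rewrite /lorentz cross_coord /vel; ring.
rewrite meanB ?H; [|exact: bh|exact: bh].
rewrite -meanB; [|exact: bD|exact: bD].
by apply: eq_mean => p; rewrite /lorentz_flux; ring.
Qed.

(** The momentum equation: the stress is the density up to terms controlled by the
dissipation. *)
Lemma kinetic_current i k : mean (fun p => kinetic_op p * (vel i p * mode (- k) p)) =
  \sum_l (freq k l)%:~R * ((i == l)%:R * density_ k
     + mean (fun p => D l p * (vel i p * mode k p)))
  + mean (fun p => lorentz_flux i p * mode (- k) p)
  + mean (fun p => D i p * mode (- k) p).
Proof.
have cm m := @cp_mode R m.
have cx l : continuous_periodic (fun p => (freq (- k) l)%:~R * (vel i p * mode k p)).
  by apply: cpM; [exact: cp_cst|exact: cpM].
have dx_ l : has_partial (xdir l) (fun p => vel i p * mode (- k) p)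
    (fun p => (freq (- k) l)%:~R * (vel i p * mode k p)).
  have := has_partialM (@v_partial_x R l i) (@mode_partial_x R (- k) l); rewrite opprK.
  by under [X in has_partial _ _ X -> _]eq_fun do rewrite mul0r add0r mulrCA.
have cvv l : continuous_periodic (fun p : P => (l == i)%:R * mode (- k) p).
  by apply: cpM => //; exact: cp_cst.
have dv_ l : has_partial (vdir l) (fun p => vel i p * mode (- k) p)
    (fun p => (l == i)%:R * mode (- k) p).
  have := has_partialM (@v_partial_v R l i) (@mode_partial_v R (- k) l).
  by under [X in has_partial _ _ X -> _]eq_fun do rewrite mulr0 addr0.
rewrite (kinetic_weak (cpM (cv i) (cm _)) cx dx_ cvv dv_).
have pick (F : 'I_3 -> P -> R) : (forall l, bounded_measurable (fun p => F l p * mode (- k) p)) ->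
    \sum_l mean (fun p => F l p * ((l == i)%:R * mode (- k) p)) =
    mean (fun p => F i p * mode (- k) p).
  move=> bF; rewrite (bigD1 i)//= [X in _ + X]big1 ?addr0 => [|l li].
    by apply: eq_mean => p; rewrite eqxx mul1r.
  rewrite -[RHS](@mean0 R); apply: eq_mean => p.
  by rewrite (negbTE li) mul0r mulr0.
congr (_ + _ + _).
- rewrite -sumrN; apply: eq_bigr => l _; rewrite -mean_stress.
  rewrite -meanZ; last first.
    by apply: bh; apply: cpM => //; exact: cpM.
  rewrite -meanN; last first.
    by apply: bh; apply: cpM.
  by apply: eq_mean => p; rewrite freqN rmorphN/=; ring.
- rewrite -mean_lorentz_mode.
  have bl l : bounded_measurable (fun p => h p * lorentz l p * mode (- k) p).
    under eq_fun do rewrite -mulrA.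
    by apply: bh; apply: cpM => //; exact: cp_lorentz.
  have := pick (fun l p => h p * lorentz l p) bl => /= E.
  transitivity (mean (fun p => h p * lorentz i p * mode (- k) p)).
    by rewrite -E; apply: eq_bigr => l _; apply: eq_mean => p; rewrite mulrA.
  by apply: eq_mean => p; rewrite mulrA.
- by apply: (pick D) => l; exact: bD.
Qed.

End weak_formulation.

(** * Time derivative of the correction *)

(** The mode $\kappa$ of the time derivative of the correction. The stress contributes
the squared density, all other terms are absorbed by half of it up to quantities
controlled by the dissipation. *)
Lemma mode_estimate (R : realType) (kap al e : 'I_3 -> R) (M : 'I_3 -> 'I_3 -> R) (a : R) :
    let q := \sum_i kap i ^+ 2 in
    (forall i, kap i = 0) \/ 1 <= q ->
  2^-1 * a ^+ 2 - 2^-1 * ((q == 0)%:R * a) ^+ 2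
   - (3 * \sum_i al i ^+ 2 + \sum_i \sum_l M i l ^+ 2 + 2 * \sum_i e i ^+ 2) <=
  (- \sum_i kap i * al i) * ((\sum_i kap i * al i) / q) +
  a * ((\sum_i kap i *
    (\sum_l kap l * ((i == l)%:R * a + M i l) + e i + al i)) / q).
Proof.
move=> q; set S := \sum_i al i ^+ 2; set T := \sum_i \sum_l M i l ^+ 2.
set W := \sum_i e i ^+ 2.
have S0 : 0 <= S by apply: sumr_ge0 => i _; exact: sqr_ge0.
have T0 : 0 <= T by apply: sumr_ge0 => i _; apply: sumr_ge0 => l _; exact: sqr_ge0.
have W0 : 0 <= W by apply: sumr_ge0 => i _; exact: sqr_ge0.
case=> [k0|q1].
  have -> : q = 0 by rewrite /q big1// => i _; rewrite k0 expr0n.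
  rewrite invr0 !mulr0 addr0 eqxx mul1r subrr; lra.
have q0 : 0 < q by lra.
rewrite gt_eqF// mul0r expr0n/= mulr0 subr0.
set s := \sum_i kap i * al i.
have sS : s ^+ 2 <= q * S by exact: sqr_sum_le.
pose r := (\sum_i kap i * (\sum_l kap l * M i l)) / q.
pose t := (\sum_i kap i * (e i + al i)) / q.
have -> : (\sum_i kap i * (\sum_l kap l * ((i == l)%:R * a + M i l) + e i + al i)) / q = a + r + t.
  rewrite /r /t -[X in X + _ / _ + _](_ : q * a / q = a); last first.
    by rewrite mulrC mulKf// gt_eqF.
  rewrite -!mulrDl; congr (_ / _); rewrite /q mulr_suml -!big_split; apply: eq_bigr => i _ /=.
  have -> : \sum_l kap l * ((i == l)%:R * a + M i l) = kap i * a + \sum_l kap l * M i l.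
    rewrite (eq_bigr (fun l => kap l * ((i == l)%:R * a) + kap l * M i l)); last first.
      by move=> l _; rewrite mulrDr.
    rewrite big_split/=; congr (_ + _); rewrite (bigD1 i)//= eqxx mul1r big1 ?addr0// => l li.
    by rewrite eq_sym (negbTE li) mul0r mulr0.
  by ring.
have rT : r ^+ 2 <= T.
  rewrite /r expr_div_n ler_pdivrMr ?exprn_gt0//.
  apply: (le_trans (sqr_sum_le _ _)); rewrite -/q expr2 mulrCA ler_wpM2l ?(ltW q0)//.
  rewrite /T mulr_suml; apply: ler_sum => i _; apply: (le_trans (sqr_sum_le _ _)).
  by rewrite -/q mulrC.
have tW : t ^+ 2 <= 2 * W + 2 * S.
  rewrite /t expr_div_n ler_pdivrMr ?exprn_gt0//.
  apply: (le_trans (sqr_sum_le _ _)); rewrite -/q mulrC.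
  have h : \sum_i (e i + al i) ^+ 2 <= 2 * W + 2 * S.
    rewrite /W /S !mulr_sumr -big_split/=; apply: ler_sum => i _.
    by have := sqr_ge0 (e i - al i); rewrite sqrrB sqrrD; lra.
  apply: ler_pM => //; last by rewrite expr2 ler_peMl// ltW.
  - by apply: sumr_ge0 => i _; exact: sqr_ge0.
  - exact: ltW.
have sq : s * (s / q) <= S by rewrite mulrA -expr2 ler_pdivrMr// mulrC.
have := sqr_ge0 (2^-1 * a + r); have := sqr_ge0 (2^-1 * a + t).
by nra.
Qed.

Lemma series2E (R : realType) (a b c d : nat -> R) N :
  series (fun n => a n * b n) N + series (fun n => c n * d n) N =
  \sum_(n < N) (a n * b n + c n * d n).
Proof. by rewrite big_split !seriesEord. Qed.

Section correction_lower.
Context {R : realType}.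
Local Notation P := (R3 R * R3 R)%type.
Local Notation Z3 := (int * int * int)%type.
Local Notation ip := (@ip2 _ _ R (@phase_measure R)).

Lemma ip_bm (f e : P -> R) : bounded_measurable f -> square_integrable e ->
  ip (toL2 f) (toL2 e) = mean (fun p => f p * e p).
Proof. by move=> bf se; rewrite ip_toL2// (toL2E (bm_square_integrable bf)). Qed.

Lemma ip_bm_self (f : P -> R) : bounded_measurable f ->
  ip (toL2 f) (toL2 f) = mean (fun p => f p ^+ 2).
Proof.
move=> bf; by rewrite ip_bm//; exact: bm_square_integrable.
Qed.

Context {Be : R3 R -> R3 R} {MB : R}.
Hypothesis cB : forall i, continuous_periodic (fun p : P => coord3 (Be p.1) i).
Hypothesis BM : forall x i, `|coord3 (Be x) i| <= MB.
Context {h : P -> R} {X D DD : 'I_3 -> P -> R}.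
Hypotheses (th : tame h) (tX : forall i, tame (X i)) (tD : forall i, tame (D i))
  (tDD : forall i, tame (DD i)).
Hypotheses (dX : forall i, has_partial (xdir i) h (X i))
  (dD : forall i, has_partial (vdir i) h (D i))
  (dDD : forall i, has_partial (vdir i) (D i) (DD i)).

Let w := toL2 (kinetic_op (Be := Be) (X := X) (D := D) (DD := DD)).
Let u := toL2 h.
Let bh : bounded_measurable h := tame_bm th.
Let bD i : bounded_measurable (D i) := tame_bm (tD i).
Let bw := bm_kinetic cB tX tD tDD.
Let bF i : bounded_measurable (lorentz_flux (Be := Be) (D := D) i) :=
  tame_bm (tame_lorentz_flux cB tD i).
Let sm k : square_integrable (@mode R k) := mode_square_integrable k.
Let sv i k := @vmode_square_integrable R i k.

Let al (k : Z3) i := density (toL2 (D i)) (- k).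
Let stress (k : Z3) (i l : 'I_3) := ip (toL2 (D l)) (evmode i k).
Let flux (k : Z3) i := density (toL2 (lorentz_flux (Be := Be) (D := D) i)) (- k).

Let densityE f k : bounded_measurable f -> density (toL2 f) k = mean (fun p : P => f p * mode k p).
Proof. by move=> bf; exact: ip_bm. Qed.

Let current_u k i : ip u (evmode i (- k)) = al k i.
Proof. by rewrite /u ip_bm// /al densityE// -(mean_vel_mode th tD dD). Qed.

Let density_w k : density w k = - \sum_i (freq k i)%:~R * al k i.
Proof.
rewrite /w densityE// (kinetic_density cB th tX tD tDD dX dD dDD); congr (- _).
by apply: eq_bigr => i _; rewrite /al densityE.
Qed.

Let current_w k i : ip w (evmode i (- k)) =
  \sum_l (freq k l)%:~R * ((i == l)%:R * density u k + stress k i l) + flux k i + al k i.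
Proof.
rewrite /w ip_bm// (kinetic_current cB th tX tD tDD dX dD dDD) /flux /al !densityE//.
congr (_ + _ + _); apply: eq_bigr => l _; by rewrite /stress /evmode ip_bm.
Qed.

Let T k := density w k * potential u k + density u k * potential w k.

Lemma correction_mode k :
  2^-1 * density u k ^+ 2 - 2^-1 * ((k == 0)%:R * density u k) ^+ 2
   - (3 * \sum_i al k i ^+ 2 + \sum_i \sum_l stress k i l ^+ 2 + 2 * \sum_i flux k i ^+ 2)
  <= T k.
Proof.
pose kap i : R := (freq k i)%:~R.
have k0 : (k == 0) = (freq2 k == 0 :> R).
  have [k0|kn] := eqVneq k 0; last by rewrite gt_eqF// (lt_le_trans _ (@freq2_ge1 R k kn)).
  by apply/esym/eqP; rewrite /freq2 big1// => i _; rewrite freq_zero// expr0n.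
have alt : (forall i, kap i = 0) \/ 1 <= \sum_i kap i ^+ 2.
  have [kz|kn] := eqVneq k 0; last by right; exact: (@freq2_ge1 R k kn).
  by left => i; rewrite /kap freq_zero.
have := mode_estimate (al k) (flux k) (stress k) (density u k) alt.
rewrite -[\sum_i kap i ^+ 2]/(@freq2 R k) -k0 => est.
have pu : potential u k = (\sum_i kap i * al k i) / freq2 k.
  rewrite /potential (eq_bigr (fun i => kap i * al k i)); first by [].
  by move=> i _; rewrite current_u.
have pw : potential w k = (\sum_i kap i * (\sum_l kap l *
    ((i == l)%:R * density u k + stress k i l) + flux k i + al k i)) / freq2 k.
  rewrite /potential; congr (_ / _); apply: eq_bigr => i _.
  by rewrite current_w.
by rewrite /T density_w pu pw.
Qed.

Let diss := dissipation (D := D).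

Let dissE : \sum_i ip (toL2 (D i)) (toL2 (D i)) = diss.
Proof. by apply: eq_bigr => i _; exact: ip_bm_self. Qed.

Lemma flux_dissipation :
  \sum_i mean (fun p => lorentz_flux (Be := Be) (D := D) i p ^+ 2) <= 6 * MB ^+ 2 * diss.
Proof.
have bD2 i : bounded_measurable (fun p => D i p ^+ 2) by exact: bm_sqr.
have bS : bounded_measurable (fun p => \sum_i D i p ^+ 2) by exact: bm_sum.
apply: (@le_trans _ _ (\sum_(i < 3) 2 * MB ^+ 2 * diss)); last first.
  by rewrite sumr_const card_ord -mulr_natl; lra.
apply: ler_sum => i _; rewrite /diss /dissipation -(mean_sum _ _ bD2) -(meanZ _ bS).
apply: le_mean; [exact: bm_sqr|exact: bmZ|] => p.
rewrite /lorentz_flux; set a := D _ p; set b := D _ p.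
have Bsq j : coord3 (Be p.1) j ^+ 2 <= MB ^+ 2.
  rewrite -real_normK ?num_real// lerXn2r ?nnegrE ?BM//.
  by apply: le_trans (BM p.1 j).
have := Bsq (ordS i); have := Bsq (ordS (ordS i)).
set y := coord3 _ _; set z := coord3 _ _ => hy hz.
have ab : a ^+ 2 + b ^+ 2 <= \sum_j D j p ^+ 2.
  have ne : ordS (ordS i) != ordS i by case: i {a b y z hy hz} => -[|[|[|//]]].
  rewrite (bigD1 (ordS i))//= (bigD1 (ordS (ordS i)))//= addrA lerDl.
  by apply: sumr_ge0 => j _; exact: sqr_ge0.
apply: (@le_trans _ _ (2 * MB ^+ 2 * (a ^+ 2 + b ^+ 2))); last first.
  by rewrite ler_wpM2l// mulr_ge0// sqr_ge0.
have h1 : (a * y) ^+ 2 <= a ^+ 2 * MB ^+ 2 by rewrite exprMn ler_wpM2l// sqr_ge0.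
have h2 : (b * z) ^+ 2 <= b ^+ 2 * MB ^+ 2 by rewrite exprMn ler_wpM2l// sqr_ge0.
by have := sqr_ge0 (a * y + b * z); rewrite sqrrB sqrrD; lra.
Qed.

(** The constant of [partial_sum_lower], plus half of the constant of
[macroscopic_bound], that is 32 times the volume. *)
Definition correction_loss (MB : R) : R :=
  35 * volume + 3 * velocity_bound + 12 * volume * MB ^+ 2.

Lemma partial_sum_lower N :
  2^-1 * (\sum_(n < N) coef (density u) n ^+ 2) - 2^-1 * density u 0 ^+ 2
    - (3 * volume + 3 * velocity_bound + 12 * volume * MB ^+ 2) * diss <=
  \sum_(n < N) (coef (density w) n * coef (potential u) n
               + coef (density u) n * coef (potential w) n).
Proof.
pose t n := 2^-1 * coef (density u) n ^+ 2
  - 2^-1 * coef (fun k : Z3 => (k == 0)%:R * density u k) n ^+ 2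
  - (3 * \sum_i coef (al^~ i) n ^+ 2 + \sum_i \sum_l coef (fun k : Z3 => stress k i l) n ^+ 2
     + 2 * \sum_i coef (flux^~ i) n ^+ 2).
apply: (@le_trans _ _ (\sum_(n < N) t n)); last first.
  apply: ler_sum => n _; rewrite /t /coef; case: (pickle_inv n) => [k|].
    exact: correction_mode.
  by rewrite expr0n/= !mulr0 subr0 addr0 !big1 ?mulr0 ?addr0 ?subr0.
have split_sum (a b c f e : 'I_N -> R) :
    \sum_n (2^-1 * a n - 2^-1 * b n - (3 * c n + f n + 2 * e n)) =
    2^-1 * (\sum_n a n) - 2^-1 * (\sum_n b n) - (3 * (\sum_n c n) + \sum_n f n + 2 * \sum_n e n).
  by rewrite !mulr_sumr -!big_split/= -!sumrB.
rewrite /t split_sum.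
have h0 := sum_coef_at (0 : Z3) (density u) N.
have V0 : 0 <= volume :> R := ltW volume_gt0.
have h1 : \sum_(n < N) \sum_i coef (al^~ i) n ^+ 2 <= volume * diss.
  rewrite exchange_big/= -dissE mulr_sumr; apply: ler_sum => i _.
  exact: bessel_density oppr_inj.
have h2 : \sum_(n < N) \sum_i coef (flux^~ i) n ^+ 2 <= volume * (6 * MB ^+ 2 * diss).
  apply: (@le_trans _ _ (volume * \sum_i mean (fun p => lorentz_flux (Be := Be) (D := D) i p ^+ 2))).
    rewrite exchange_big/= mulr_sumr; apply: ler_sum => i _.
    rewrite -ip_bm_self; last exact: bF.
    exact: bessel_density oppr_inj.
  by rewrite ler_wpM2l// flux_dissipation.
have h3 : \sum_(n < N) \sum_i \sum_l coef (fun k : Z3 => stress k i l) n ^+ 2 <=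
    3 * velocity_bound * diss.
  rewrite exchange_big/= (_ : 3 * _ * _ = \sum_(i < 3) velocity_bound * diss); last first.
    by rewrite sumr_const card_ord; ring.
  apply: ler_sum => i _; rewrite exchange_big/= -dissE mulr_sumr; apply: ler_sum => l _.
  exact: (@bessel_current _ id).
apply: lerB; first by rewrite lerD2l lerN2 ler_wpM2l.
rewrite (_ : (3 * _ + _ + _) * diss = 3 * (volume * diss) + 3 * velocity_bound * diss
    + 2 * (volume * (6 * MB ^+ 2 * diss))); last by ring.
by apply: lerD; [apply: lerD|] => //; rewrite ler_wpM2l.
Qed.

(** The correction recovers the density, at the price of the mass and of a multiple
of the dissipation. *)
Lemma correction_lower :
  2^-1 * volume * ip u u - 2^-1 * density u 0 ^+ 2 - correction_loss MB * diss <=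
  correction w u + correction u w.
Proof.
have cvg : (fun n => series (fun n => coef (density w) n * coef (potential u) n) n
    + series (fun n => coef (density u) n * coef (potential w) n) n) @ \oo -->
    correction w u + correction u w by apply: cvgD; exact: correction_cvg.
apply/ler_addgt0Pr => eta eta0.
have [N0 hN0] := macroscopic_bound th tD dD tX dX eta0.
rewrite -lerBlDr -(cvg_lim _ cvg)//; apply: limr_ge; first by apply/cvg_ex; eexists; exact: cvg.
exists N0 => // N /= /hN0.
move=> hN; rewrite series2E; apply: le_trans (partial_sum_lower N).
have -> : \sum_(n < N) coef (density u) n ^+ 2 =
    \sum_(n < N) coef (fun k => mean (fun p => h p * mode k p)) n ^+ 2.
  apply: eq_bigr => n _; rewrite /coef; case: (pickle_inv n) => [k|//].
  by rewrite /u densityE.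
rewrite /u (ip_bm_self bh); rewrite -/(dissipation (D := D)) -/diss in hN.
set a := \sum_(n < N) _ in hN *; set b := mean _ in hN *.
rewrite -subr_ge0 (_ : _ - _ = 2^-1 * (a + 64 * volume * diss + eta - volume * b) + 2^-1 * eta).
  by rewrite addr_ge0// mulr_ge0// ?subr_ge0// ltW.
by rewrite /correction_loss; field.
Qed.

End correction_lower.

(** * Exponential decay *)

Section L2_convergence.
Context {R : realType}.
Local Notation ip := (@ip2 _ _ R (@phase_measure R)).
Local Notation N := (snorm ip).

Lemma L2normE (f : L2 R) : (L2norm f = (N f)%:E)%E.
Proof. exact: Lnorm2E. Qed.

Lemma L2_cvgP (I : Type) (F : set_system I) (FF : Filter F) (u : I -> L2 R) (l : L2 R) :
  L2_cvg F u l <-> forall e, 0 < e -> \forall i \near F, N (u i - l) <= e.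
Proof.
rewrite /L2_cvg (_ : (fun i => L2norm (u i - l)) = (fun i => (N (u i - l))%:E)); last first.
  by apply/funext => i; rewrite L2normE.
have nn x : `|N x| = N x by rewrite ger0_norm ?sqrtr_ge0.
split=> [/fine_cvg/cvgr0Pnorm_le h e e0|h].
  by have := h e e0; apply: filterS => i /=; rewrite nn.
apply: cvg_EFin; first exact: nearW.
apply/cvgr0Pnorm_le => e e0; have := h e e0; apply: filterS => i /=.
by rewrite nn.
Qed.

Lemma L2_cvg_right (u : R -> L2 R) l : L2_cvg 0^'+ u l <-> sg_right_cvg ip u l.
Proof.
rewrite L2_cvgP; split=> h e e0.
  have := h e e0; rewrite near_withinE => -[d /= d0 hd].
  exists d => // s /andP[s0 sd]; apply: hd => //=.
  by rewrite sub0r normrN ger0_norm// ltW.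
have [d d0 hd] := h e e0.
rewrite near_withinE; exists d => //= s /=; rewrite sub0r normrN => sd s0.
by apply: hd; rewrite s0 (le_lt_trans (ler_norm s) sd).
Qed.

Lemma L2_cvg_seq (u : nat -> L2 R) l : L2_cvg \oo u l <-> seq_cvg ip u l.
Proof.
rewrite L2_cvgP; split=> h e e0.
  by have [n0 _ hn] := h e e0; exists n0 => n; exact: hn.
by have [n0 hn] := h e e0; exists n0 => // n; exact: hn.
Qed.

Lemma C0_strong (S : R -> L2 R -> L2 R) : C0_semigroup S -> strong_semigroup ip S.
Proof.
case=> lin bnd at0 add cvg0; split.
- by move=> t t0 a f g; apply: eq_ae_snorm; exact: lin.
- move=> t t0; have [M hM] := bnd t t0; exists M => f.
  by have := hM f; rewrite !L2normE -EFinM lee_fin.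
- by move=> f; apply: eq_ae_snorm; exact: at0.
- by move=> s t f s0 t0; apply: eq_ae_snorm; exact: add.
- by move=> f; apply/L2_cvg_right; exact: cvg0.
Qed.

End L2_convergence.

Section coercivity.
Context {R : realType}.
Local Notation P := (R3 R * R3 R)%type.
Local Notation Z3 := (int * int * int)%type.
Local Notation ip := (@ip2 _ _ R (@phase_measure R)).
Local Notation N := (snorm ip).
Let sip : semi_inner ip := semi_inner_ip2 _.

Lemma torus_bounded (f : R3 R -> R) : continuous f -> torus_periodic f ->
  exists M, forall x, `|f x| <= M.
Proof.
move=> cf pf; have : compact (f @` torus_cell).
  apply: continuous_compact; first exact: continuous_subspaceT.
  by apply: compact_setX; [apply: compact_setX|]; exact: segment_compact.
move=> /compact_bounded[M [_ MP]]; exists (M + 1) => x.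
have [y yc <-] := torus_reduction x pf.
by apply: (MP (M + 1)); [rewrite ltrDl|exists y].
Qed.

Context {Be : R3 R -> R3 R}.
Hypotheses (cBe : continuous Be) (pBe : torus_periodic Be).

Let cBi i : continuous (fun x => coord3 (Be x) i).
Proof.
move=> x; apply: (@continuous_comp _ _ _ Be (fun y => coord3 y i)); first exact: cBe.
exact: continuous_coord3.
Qed.

Let pBi i : torus_periodic (fun x => coord3 (Be x) i).
Proof. by move=> x j; rewrite pBe. Qed.

Lemma magnetic_cp i : continuous_periodic (fun p : P => coord3 (Be p.1) i).
Proof. exact: (cp_of_x (@cBi i) (pBi i)). Qed.

Lemma magnetic_bounded : exists MB, forall x i, `|coord3 (Be x) i| <= MB.
Proof.
have [M MP] := choice (fun i => torus_bounded (@cBi i) (pBi i)).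
have M0 i : 0 <= M i by apply: le_trans (MP i 0).
exists (\sum_i M i) => x i; rewrite (bigD1 i)//= (le_trans (MP i x))// lerDl.
by apply: sumr_ge0 => j _; exact: M0.
Qed.

Lemma P1_kinetic h p : P1 Be h p = kinetic_op (Be := Be) (X := fun i => dx i h)
  (D := fun i => dv i h) (DD := fun i => dv i (dv i h)) p.
Proof. by case: p. Qed.

Lemma ip_ae (f x : L2 R) (h : P -> R) : bounded_measurable h ->
  f = h %[ae @phase_measure R] -> ip f x = ip (toL2 h) x.
Proof.
move=> bh fh; apply: eq_ae_ip2; apply: filterS fh => p hp _.
by rewrite (toL2E (bm_square_integrable bh)) hp.
Qed.

Lemma eq_correction (f f' g g' : L2 R) : (forall x, ip f x = ip f' x) ->
  (forall x, ip g x = ip g' x) -> correction f g = correction f' g'.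
Proof.
move=> ff gg.
have e1 : density f = density f' by apply/funext => k; rewrite /density ff.
have e2 : potential g = potential g'.
  by apply/funext => k; rewrite /potential; under eq_bigr do rewrite gg.
by rewrite /correction e1 e2.
Qed.

(** The mode 0 is the constant 1, so that the density at 0 is the mass. *)
Lemma mass_linear : bounded_linear_form ip (fun f => density f 0) (N (emode 0)).
Proof.
split=> *; rewrite /density ?(sipDl sip) ?(sipZl sip)//.
by rewrite mulrC; exact: cauchy_schwarz.
Qed.

(** The estimates for test functions, transferred to the elements of the space that
represent them almost everywhere. *)
Lemma P1_coercive : exists loss, 0 <= loss /\ forall f g : L2 R, P1_op Be f g ->
  density g 0 = 0 /\ exists2 d, ip g f = d &
    0 <= d /\ 2^-1 * volume * ip f f - 2^-1 * density f 0 ^+ 2 - loss * d <=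
      correction g f + correction f g.
Proof.
have [MB hMB] := magnetic_bounded.
have V0 : 0 <= volume :> R := ltW volume_gt0.
have W0 : 0 <= velocity_bound :> R := ltW velocity_bound_gt0.
exists (correction_loss MB); split.
  have M0 : 0 <= 12 * volume * MB ^+ 2 by rewrite mulr_ge0 ?sqr_ge0// mulr_ge0.
  by rewrite /correction_loss; lra.
move=> f g [h [th fh gh]].
pose X i := dx i h; pose D i := dv i h; pose DD i := dv i (dv i h).
have tX i : tame (X i) by exact/test_tame/test_dx.
have tD i : tame (D i) by exact/test_tame/test_dv.
have tDD i : tame (DD i) by exact/test_tame/test_dv/test_dv.
have dX i := test_partial_x i th; have dD i := test_partial_v i th.
have dDD i := test_partial_v i (test_dv i th).
have tt := test_tame th; have bh := tame_bm tt.
set w := kinetic_op (Be := Be) (X := X) (D := D) (DD := DD).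
have wE : P1 Be h = w by apply/funext => p; exact: P1_kinetic.
have bw : bounded_measurable w := bm_kinetic magnetic_cp tX tD tDD.
rewrite wE in gh.
have ipf x : ip f x = ip (toL2 h) x := ip_ae x bh fh.
have ipg x : ip g x = ip (toL2 w) x := ip_ae x bw gh.
split.
  rewrite /density ipg ip_bm//; last exact: mode_square_integrable.
  rewrite -(mean_kinetic magnetic_cp tt tX tD tDD dX dD dDD).
  by apply: eq_mean => p; rewrite mode0 mulr1.
exists (dissipation (D := D)).
  rewrite ipg (sipC sip) ipf (sipC sip) ip_bm//; last exact: bm_square_integrable.
  exact: (kinetic_energy magnetic_cp tt tX tD tDD dX dD dDD).
split; first by apply: sumr_ge0 => i _; apply: mean_ge0 => p; exact: sqr_ge0.
have ff : ip f f = ip (toL2 h) (toL2 h) by rewrite ipf (sipC sip) ipf.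
have df : density f 0 = density (toL2 h) 0 := ipf _.
rewrite ff df (eq_correction ipg ipf) (eq_correction ipf ipg).
exact: (correction_lower magnetic_cp hMB tt tX tD tDD dX dD dDD).
Qed.

End coercivity.

Theorem theorem1p3 (R : realType) (Be : R3 R -> R3 R)
    (Be_smooth : smooth Be) (Be_periodic : torus_periodic Be) :
  exists kappa c : R,
    [/\ 0 < kappa, 0 < c &
      forall S : R -> L2 R -> L2 R,
        C0_semigroup S ->
        (forall f g : L2 R,
          semigroup_generator S f g <-> op_opp (op_closure (P1_op Be)) f g) ->
      forall f0 : L2 R,
        (\int[@phase_measure R]_p (f0 p)%:E = 0)%E ->
      forall t : R, 0 <= t ->
        (L2norm (S t f0) <= (c * expR (- (kappa * t)))%:E * L2norm f0)%E].
Proof.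
have sip := semi_inner_ip2 (@phase_measure R).
have [loss [loss0 coer]] := P1_coercive (smooth_continuous Be_smooth) Be_periodic.
have V0 : 0 < volume :> R := volume_gt0.
have bc := @correction_bounded R.
pose Cb : R := correction_bound.
have Cb0 : 0 <= Cb by rewrite mulr_ge0 ?sqrtr_ge0.
(* [eps * loss <= 1] lets the dissipation of the energy absorb that of the correction,
   [eps * Cb <= 4^-1] keeps the modified energy equivalent to the squared norm. *)
pose eps := (loss + 4 * Cb + 1)^-1.
have den0 : 0 < loss + 4 * Cb + 1 by lra.
have eps0 : 0 < eps by rewrite invr_gt0.
have epsE : eps * (loss + 4 * Cb + 1) = 1 by rewrite mulVf// gt_eqF.
have eC0 : 0 <= eps * Cb by rewrite mulr_ge0// ltW.
have eL0 : 0 <= eps * loss by rewrite mulr_ge0// ltW.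
have eL : eps * loss <= 1 by lra.
have eC : eps * Cb <= 4^-1 by lra.
pose G := modified_energy (ip := @ip2 _ _ R (@phase_measure R)) (b := correction) (eps := eps).
pose lam := 2^-1 * eps * volume.
have lam0 : 0 < lam by rewrite !mulr_gt0.
exists (lam / 2), 2; split => //; first by rewrite divr_gt0.
move=> S cS genS f0 f00 t t0.
rewrite !L2normE -EFinM lee_fin.
rewrite (_ : - (lam / 2 * t) = - (lam / 2) * t); last by rewrite mulNr.
apply: (@lyapunov_decay _ _ _ sip (L2_cauchy_complete phase_measure_lty) S
  (P1_op Be) G (fun f => density f 0) (snorm (@ip2 _ _ R (@phase_measure R)) (emode 0)) lam (2^-1 * eps)) => //.
- exact: C0_strong.
- move=> f g gen; have /genS[u [v [uv uf vg]]] : semigroup_generator S f g.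
    exact/L2_cvg_right.
  by exists u, v; split => //; exact/L2_cvg_seq.
- exact: (modified_energy_bounded sip bc (ltW eps0) eC).
- exact: (modified_energy_ge sip bc (ltW eps0) eC).
- exact: mass_linear.
- exact: sqrtr_ge0.
- exact: ltW.
- by rewrite mulr_ge0// ltW.
- by move=> u w /coer[].
- by move=> u w /coer[_ [d dE [d0 h]]]; exact: (modified_energy_coercive sip (ltW eps0) dE d0 eL h).
- rewrite /density ip_toL2; last exact: mode_square_integrable.
  rewrite /mean /Rintegral; under eq_integral do rewrite mode0 mulr1.
  by rewrite f00.
Qed.
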